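(* Let $\mathbf X,\mathbf Y$ be finite dimensional Hilbert spaces, $\varphi:\mathbf X\to\mathbb R$ and $\Phi:\mathbf X\to\mathbf Y$ twice continuously differentiable, $g:\mathbf Y\to\overline{\mathbb R}$ proper, lower semicontinuous and convex, and let $\Theta\subset\mathbf X$ be an affine set. Let $(\bar x,\bar y)$ be a solution to the KKT system $$0\in\nabla_xL(x,y)+N_\Theta(x),\qquad y\in\partial g(\Phi(x)).$$ Assume the following. (i) (SOSC) $\langle\nabla^2_{xx}L(\bar x,\bar y)w,w\rangle+\mathrm d^2g(\Phi(\bar x),\bar y)(\nabla\Phi(\bar x)w)>0$ for all $w\in\mathcal D\setminus\{0\}$, where $\mathcal D:=K_\Theta(\bar x,-\nabla_xL(\bar x,\bar y))\cap\{w\in\mathbf X\mid\nabla\Phi(\bar x)w\in K_g(\Phi(\bar x),\bar y)\}$. (ii) One of the following holds: (a) $g$ is $\mathcal C^2$-decomposable at $\bar u:=\Phi(\bar x)$, with a representation $g(u)=g(\bar u)+\vartheta(\Xi(u))$ near $\bar u$ satisfying the nondegeneracy condition $\mathrm{par}\{\partial\vartheta(\Xi(\bar u))\}\cap\ker\nabla\Xi(\bar u)^*=\{0\}$; or (b) $g$ is twice epi-differentiable at $\Phi(\bar x)$ for $\bar y$ and $$\widehat D(\partial g)(\Phi(\bar x),\bar y)(w)=\mathrm{cl}\big(D(\partial g)(\Phi(\bar x),\bar y)(w)-K_g(\Phi(\bar x),\bar y)^*\big)\quad\text{for all }w\in\mathbf Y.$$ (iii) The multiplier mapping $M_{\bar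 x,\psi}$ is calm at $(0,0)\in\mathbf X\times\mathbf Y$ for $\bar y$. (iv) The second subderivative of $g$ at $\Phi(\bar x)$ for $\bar y$ is semi-stable. Let $\epsilon:\mathbb R_+\to\mathbb R_+$ be a function with $\epsilon(t)=o(t)$. Then there exist positive constants $\hat c,\bar\rho,\varepsilon_0$ such that for any starting point $(x^0,y^0)\in\mathbb B_{\varepsilon_0}(\bar x,\bar y)$ and any sequence $\{\rho_k\}$ with $\rho_k\ge\bar\rho$ for all $k$, there is a primal-dual sequence $\{(x^k,y^k)\}$ satisfying for all $k$, with $\epsilon_k:=\epsilon(r(x^k,y^k))=o(r(x^k,y^k))$, $$\mathrm{dist}\big(-\nabla_x\mathcal L(x^{k+1},y^k,\rho_k),N_\Theta(x^{k+1})\big)\le\epsilon_k,\qquad y^{k+1}=y^k+\rho_k\nabla_y\mathcal L(x^{k+1},y^k,\rho_k),$$ $$\|x^{k+1}-x^k\|+\|y^{k+1}-y^k\|\le\hat c\,r(x^k,y^k).$$ Moreover, any such sequence converges to $(\bar x,\hat y)$ for some $\hat y\in M_{\bar x,\psi}(0,0)$, and the rates of convergence of $\{(x^k,y^k)\}$ to $(\bar x,\hat y)$ and of $\{\mathrm{dist}((x^k,y^k),\{\bar x\}\times M_{\bar x,\psi}(0,0))\}$ to zero are Q-linear. Furthermore, if $\rho_k\to\infty$, the rates of convergence of both sequences are Q-superlinear.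
   Context: $\overline{\mathbb R}=[-\infty,\infty]$; $\mathbb B$ is the closed unit ball and $\mathbb B_r(x)$ is the closed ball of radius $r$ centered at $x$; $C^*$ is the polar cone of $C$; $\mathrm{par}\,C$ is the linear subspace parallel to the affine hull of $C$; $\mathrm{dist}(x,C)$ is the distance from $x$ to $C$; $\mathrm{cl}$ is closure; $N_\Theta(x)$ is the normal cone of convex analysis, empty if $x\notin\Theta$; $\partial$ is the subdifferential of convex analysis. Product spaces carry the Euclidean product norm. Underlying problem: minimize $\psi(x):=\varphi(x)+g(\Phi(x))$ subject to $x\in\Theta$. Lagrangian: $L(x,y)=\varphi(x)+\langle y,\Phi(x)\rangle$. Augmented Lagrangian: for $\rho>0$, $\mathcal L(x,y,\rho)=\varphi(x)+(e_{1/\rho}g)(\Phi(x)+\rho^{-1}y)-\tfrac12\rho^{-1}\|y\|^2$, with Moreau envelope $(e_{1/\rho}g)(y)=\inf_{z\in\mathbf Y}\{g(z)+\tfrac12\rho\|y-z\|^2\}$. Residual function: $r(x,y)=\mathrm{dist}(-\nabla_xL(x,y),N_\Theta(x))+\|\Phi(x)-\mathrm{prox}_g(\Phi(x)+y)\|$ for $(x,y)\in\mathbf X\times\mathbf Y$, with $\mathrm{prox}_g(y)=\mathrm{argmin}_z\{g(z)+\tfrac12\|y-z\|^2\}$. Multiplier mapping: $M_{\bar x,\psi}(v,w)=\{y\in\mathbf Y\mid v\in\nabla_xL(\bar x,y)+N_\Theta(\bar x),\ y\in\partial g(\Phi(\bar x)+w)\}$ for $(v,w)\in\mathbf X\times\mathbf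 Y$. A set-valued mapping $F$ is calm at $x$ for $y\in F(x)$ if there are neighborhoods $U$ of $x$, $V$ of $y$ and $\kappa>0$ with $F(x')\cap V\subset F(x)+\kappa\|x-x'\|\mathbb B$ for all $x'\in U$. Tangent cone: $w\in T_\Omega(\bar x)$ iff there are $t_k\searrow0$, $w^k\to w$ with $\bar x+t_kw^k\in\Omega$. Subderivative: $\mathrm df(\bar x)(w)=\liminf_{t\searrow0,\,w'\to w}\frac{f(\bar x+tw')-f(\bar x)}t$. Critical cone, for $\bar v\in\partial f(\bar x)$: $K_f(\bar x,\bar v)=\{w\mid\langle\bar v,w\rangle=\mathrm df(\bar x)(w)\}$; for a set, $K_\Theta(\bar x,\bar v)=K_{\delta_\Theta}(\bar x,\bar v)=T_\Theta(\bar x)\cap[\bar v]^\perp$, where $\delta_\Theta$ is the indicator function and $[\bar v]=\{t\bar v\mid t\in\mathbb R\}$. Second-order difference quotient: $\Delta_t^2f(\bar x,\bar v)(w)=\frac{f(\bar x+tw)-f(\bar x)-t\langle\bar v,w\rangle}{\frac12t^2}$. Second subderivative: $\mathrm d^2f(\bar x,\bar v)(w)=\liminf_{t\searrow0,\,w'\to w}\Delta_t^2f(\bar x,\bar v)(w')$. $f$ is twice epi-differentiable at $\bar x$ for $\bar v$ if for all $w$ and all $t_k\searrow0$ there is $w^k\to w$ with $\Delta^2_{t_k}f(\bar x,\bar v)(w^k)\to\mathrm d^2f(\bar x,\bar v)(w)$. Semi-strict second subderivative: $\widehat{\mathrm d}^2f(\bar x,\bar v)(w)=\liminf_{t\searrow0,\,w'\to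 w,\,v\to\bar v,\,v\in\partial f(\bar x)}\Delta_t^2f(\bar x,v)(w')$. The second subderivative of $f$ at $\bar x$ for $\bar v$ is semi-stable if $\widehat{\mathrm d}^2f(\bar x,\bar v)(w)=\mathrm d^2f(\bar x,\bar v)(w)$ for all $w\in K_f(\bar x,\bar v)$. Graphical derivative: $\mathrm{gph}\,DF(\bar x,\bar y)=T_{\mathrm{gph}F}(\bar x,\bar y)$. Semi-strict graphical derivative: $\eta\in\widehat DF(\bar x,\bar y)(w)$ iff there exist $t_k\searrow0$, $(x^k,y^k)\to(\bar x,\bar y)$, $\hat y^k\to\bar y$ with $y^k\in F(x^k)$, $\hat y^k\in F(\bar x)$ and $\big(\frac{x^k-\bar x}{t_k},\frac{y^k-\hat y^k}{t_k}\big)\to(w,\eta)$. $\mathcal C^2$-decomposable: $g$ is $\mathcal C^2$-decomposable at $\bar u$ if $g(\bar u)$ is finite and $g(u)=g(\bar u)+\vartheta(\Xi(u))$ for $u$ in an open neighborhood $\mathcal O$ of $\bar u$, where $\vartheta:\mathbf Z\to\overline{\mathbb R}$ is proper, lsc and sublinear, $\Xi:\mathcal O\to\mathbf Z$ is $\mathcal C^2$-smooth with $\Xi(\bar u)=0$, and $\mathbf Z$ is a finite dimensional Hilbert space. A sequence $u^k\to\hat u$ converges Q-linearly if $\|u^{k+1}-\hat u\|\le q\|u^k-\hat u\|$ for some $q\in(0,1)$ and all large $k$, and Q-superlinearly if $\|u^{k+1}-\hat u\|\le q_k\|u^k-\hat u\|$ with $q_k\to0$.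
   Formalization: The starting point is additionally required to satisfy x^0 ∈ Θ (finite r(x^0,y^0)); otherwise N_Θ(x^0) is empty, r(x^0,y^0)=∞, and ε_0=ε(r(x^0,y^0)) is undefined because ε is defined only on R_+. *)

(* Defs.v *)
From HB Require Import structures.
From mathcomp Require Import all_boot all_order all_algebra.
From mathcomp Require Import all_classical all_reals all_analysis.
Import Order.TTheory GRing.Theory Num.Theory.
Import numFieldNormedType.Exports.

Set Implicit Arguments.
Unset Strict Implicit.
Unset Printing Implicit Defensive.

Local Open Scope classical_set_scope.
Local Open Scope ring_scope.

HB.mixin Record isFinHilbert (R : realType) V
    of Vector R V & NormedModule R V := {
  inner : {dot V for idfun} ;
  normr_inner : forall u : V, `|u| ^+ 2 = inner u u }.

(* Finite dimensional real Hilbert spaces; completeness is automatic. *)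
#[short(type=finHilbertType)]
HB.structure Definition FinHilbert (R : realType) :=
  {V of isFinHilbert R V & Vector R V & NormedModule R V}.

Section Smooth.
Context {R : realType} {V W : finHilbertType R}.

Definition grad (f : V -> R) (x : V) : V :=
  xget 0 [set v | forall w, 'd f x w = inner v w].

Definition adjoint (A : V -> W) (w : W) : V :=
  xget 0 [set v | forall u, inner v u = inner w (A u)].

End Smooth.

(* In finite dimension, joint continuity of D^2 f in the operator norm amounts
   to continuity of z |-> D^2 f(z)(v, w) for all v and w. *)
Definition C2_on (R : realType) (V : finHilbertType R) (W : normedModType R)
    (O : set V) (f : V -> W) : Prop :=
  forall x v w, O x ->
    [/\ differentiable f x, differentiable (fun z => 'd f z v) x &
        {for x, continuous (fun z => 'd (fun z' => 'd f z' v) z w)}].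

Section ProductNorm.
Context {R : realType} {V W : finHilbertType R}.

(* The library norm on V * W is the max norm; this is the Euclidean one. *)
Definition pnorm (p : V * W) : R := Num.sqrt (`|p.1| ^+ 2 + `|p.2| ^+ 2).

End ProductNorm.

Section Sets.
Context {R : realType} {V : finHilbertType R}.
Implicit Types (C : set V) (x v : V).

Definition polar C : set V := [set v | forall w, C w -> inner v w <= 0].

Definition affine_set C : Prop :=
  forall x y (t : R), C x -> C y -> C (t *: x + (1 - t) *: y).

Definition aff C : set V := smallest affine_set C.

(* For a nonempty affine set A, the parallel subspace is A - A. *)
Definition par C : set V := [set a - b | a in aff C & b in aff C].

Definition normal_cone C x : set V :=
  [set v | C x /\ forall x', C x' -> inner v (x' - x) <= 0].

(* The indicator function of convex analysis. *)
Definition indicator C x : \bar R := if `[< C x >] then 0%E else +oo%E.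

End Sets.

(* The distance from x to C for the norm N; it is +oo if C is empty. *)
Definition dist_to (R : realType) (V : zmodType) (N : V -> R) (x : V)
    (C : set V) : \bar R :=
  ereal_inf [set (N (x - c))%:E | c in C].

Section ExtendedRealFunctions.
Context {R : realType} {V : finHilbertType R}.
Implicit Types (f : V -> \bar R) (x v w : V) (t : R).
Local Open Scope ereal_scope.

Definition eproper f : Prop :=
  (forall x, f x != -oo) /\ (exists x, f x \is a fin_num).

Definition econvex f : Prop :=
  forall x y t, (0 < t < 1)%R ->
    f (t *: x + (1 - t) *: y)%R <= t%:E * f x + (1 - t)%:E * f y.

Definition sublinear f : Prop :=
  (forall t x, (0 < t)%R -> f (t *: x)%R = t%:E * f x) /\
  (forall x y, f (x + y)%R <= f x + f y).

Definition subdiff f x : set V :=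
  [set v | f x \is a fin_num /\ forall x', f x + (inner v (x' - x)%R)%:E <= f x'].

Definition subderiv f x w : \bar R :=
  limf_einf (fun p : R * V => (p.1^-1)%:E * (f (x + p.1 *: p.2)%R - f x))
    (filter_prod 0%R^'+ (nbhs w)).

Definition crit_cone f x v : set V := [set w | (inner v w)%:E = subderiv f x w].

Definition diff2 f x v t w : \bar R :=
  (f (x + t *: w)%R - f x - (t * inner v w)%:E) * ((2^-1 * t ^+ 2)^-1)%:E.

Definition subderiv2 f x v w : \bar R :=
  limf_einf (fun p : R * V => diff2 f x v p.1 p.2)
    (filter_prod 0%R^'+ (nbhs w)).

Definition semistrict_subderiv2 f x v w : \bar R :=
  limf_einf (fun p : R * V * V => diff2 f x p.2 p.1.1 p.1.2)
    (filter_prod (filter_prod 0%R^'+ (nbhs w))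
                 (within (subdiff f x) (nbhs v))).

Definition semistable f x v : Prop :=
  forall w, crit_cone f x v w ->
    semistrict_subderiv2 f x v w = subderiv2 f x v w.

Definition down0 (t : nat -> R) : Prop :=
  (forall k, (0 < t k)%R) /\ t @ \oo --> 0%R.

Definition twice_epi_differentiable f x v : Prop :=
  forall w (t : nat -> R), down0 t ->
    exists2 wk : nat -> V, wk @ \oo --> w &
      diff2 f x v (t k) (wk k) @[k --> \oo] --> subderiv2 f x v w.

(* The Moreau envelope e_{1/rho} f, indexed by rho rather than 1/rho. *)
Definition moreau f (rho : R) x : \bar R :=
  ereal_inf [set f z + (2^-1 * rho * `|x - z| ^+ 2)%:E | z in [set: V]].

Definition prox f x : V :=
  xget 0%R [set z | forall z',
    f z + (2^-1 * `|x - z| ^+ 2)%:E <= f z' + (2^-1 * `|x - z'| ^+ 2)%:E].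

End ExtendedRealFunctions.

Definition tangent_cone (R : realType) (V : normedModType R) (Omega : set V)
    (x : V) : set V :=
  [set w | exists (t : nat -> R) (wk : nat -> V),
    [/\ down0 t, wk @ \oo --> w & forall k, Omega (x + t k *: wk k)]].

Section SetValuedMappings.
Context {R : realType} {U V : normedModType R}.
Implicit Types F : U -> set V.

Definition graphical_deriv F (x : U) (y : V) (w : U) : set V :=
  [set eta | tangent_cone [set p : U * V | F p.1 p.2] (x, y) (w, eta)].

Definition semistrict_graphical_deriv F (x : U) (y : V) (w : U) : set V :=
  [set eta | exists (t : nat -> R) (xk : nat -> U) (yk yhk : nat -> V),
    [/\ down0 t,
        [/\ xk @ \oo --> x, yk @ \oo --> y & yhk @ \oo --> y],
        forall k, F (xk k) (yk k) /\ F x (yhk k),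
        (t k)^-1 *: (xk k - x) @[k --> \oo] --> w &
        (t k)^-1 *: (yk k - yhk k) @[k --> \oo] --> eta]].

(* The domain norm N is a parameter: on a product it is pnorm. *)
Definition calm (N : U -> R) F (x : U) (y : V) : Prop :=
  exists (A : set U) (B : set V) (kappa : R),
    [/\ nbhs x A, nbhs y B, 0 < kappa & forall x', A x' ->
      F x' `&` B `<=`
        [set z + (kappa * N (x - x')) *: b | z in F x & b in [set b | `|b| <= 1]]].

End SetValuedMappings.

Section Decomposable.
Context {R : realType} {Y : finHilbertType R}.

Definition C2_decomposition (g : Y -> \bar R) (ubar : Y) (Z : finHilbertType R)
    (O : set Y) (theta : Z -> \bar R) (Xi : Y -> Z) : Prop :=
  [/\ g ubar \is a fin_num, open_nbhs ubar O,
      [/\ eproper theta, lower_semicontinuous theta & sublinear theta],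
      C2_on O Xi /\ Xi ubar = 0 &
      forall u, O u -> g u = (g ubar + theta (Xi u))%E].

Definition nondegenerate_at (ubar : Y) (Z : finHilbertType R)
    (theta : Z -> \bar R) (Xi : Y -> Z) : Prop :=
  par (subdiff theta (Xi ubar)) `&` [set z | adjoint ('d Xi ubar) z = 0]
  = [set 0].

End Decomposable.

Section CompositeProblem.
Context {R : realType} {X Y : finHilbertType R}.
Variables (phi : X -> R) (Phi : X -> Y) (g : Y -> \bar R) (Theta : set X).

Definition lagrangian (x : X) (y : Y) : R := phi x + inner y (Phi x).

Definition gradx_L (x : X) (y : Y) : X := grad (lagrangian ^~ y) x.

Definition hess_L (x : X) (y : Y) (w : X) : X := 'd (gradx_L ^~ y) x w.

(* fine loses nothing: the envelope of a proper lsc convex function is finite. *)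
Definition aug_lagrangian (x : X) (y : Y) (rho : R) : R :=
  phi x + fine (moreau g rho (Phi x + rho^-1 *: y)) - 2^-1 * rho^-1 * `|y| ^+ 2.

Definition gradx_AL (x : X) (y : Y) (rho : R) : X :=
  grad (fun x' => aug_lagrangian x' y rho) x.

Definition grady_AL (x : X) (y : Y) (rho : R) : Y :=
  grad (fun y' => aug_lagrangian x y' rho) y.

(* Equal to +oo when x is not in Theta. *)
Definition residual (x : X) (y : Y) : \bar R :=
  (dist_to (@Num.norm _ X) (- gradx_L x y) (normal_cone Theta x)
   + `|Phi x - prox g (Phi x + y)|%:E)%E.

Definition KKT (x : X) (y : Y) : Prop :=
  normal_cone Theta x (- gradx_L x y) /\ subdiff g (Phi x) y.

Definition multipliers (xbar : X) (p : X * Y) : set Y :=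
  [set y | normal_cone Theta xbar (p.1 - gradx_L xbar y) /\
           subdiff g (Phi xbar + p.2) y].

Definition SOSC (xbar : X) (ybar : Y) : Prop :=
  forall w : X,
    crit_cone (indicator Theta) xbar (- gradx_L xbar ybar) w ->
    crit_cone g (Phi xbar) ybar ('d Phi xbar w) ->
    w != 0 ->
    (0 < (inner (hess_L xbar ybar w) w)%:E
         + subderiv2 g (Phi xbar) ybar ('d Phi xbar w))%E.

Definition ALM_sequence (eps : R -> R) (chat : R) (rho : nat -> R)
    (x : nat -> X) (y : nat -> Y) : Prop :=
  forall k,
    [/\ (dist_to (@Num.norm _ X) (- gradx_AL (x k.+1) (y k) (rho k))
           (normal_cone Theta (x k.+1))
         <= (eps (fine (residual (x k) (y k))))%:E)%E,
        y k.+1 = y k + rho k *: grady_AL (x k.+1) (y k) (rho k) &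
        ((`|x k.+1 - x k| + `|y k.+1 - y k|)%:E
         <= chat%:E * residual (x k) (y k))%E].

End CompositeProblem.

Section Rates.
Context {R : realType}.
Implicit Types e : nat -> R.

Definition Qlinear e : Prop :=
  exists2 q : R, 0 < q < 1 & \forall k \near \oo, e k.+1 <= q * e k.

Definition Qsuperlinear e : Prop :=
  exists2 q : nat -> R, q @ \oo --> 0 & forall k, e k.+1 <= q k * e k.

End Rates.

(* Main.v *)
Require Import Defs.
From HB Require Import structures.
From mathcomp Require Import all_boot all_order all_algebra.
From mathcomp Require Import all_classical all_reals all_analysis.
From mathcomp Require Import ring lra.
Import Order.TTheory GRing.Theory Num.Theory.
Import numFieldNormedType.Exports.

Set Implicit Arguments.
Unset Strict Implicit.
Unset Printing Implicit Defensive.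

Local Open Scope classical_set_scope.
Local Open Scope ring_scope.

(* Let M0 be the set of multipliers at xbar.  The second-order condition, with
   semi-stability, gives quadratic growth of the augmented Lagrangian along
   Theta around xbar, uniformly over the multipliers close to ybar.  It also
   gives, with calmness of the multiplier mapping, a two-sided error bound: near
   (xbar, ybar) the residual is comparable to the distance to {xbar} x M0.  This
   last step needs, for eta in the semi-strict graphical derivative of the
   subdifferential of g in direction w, that w is critical and that <eta, w> is
   at least the second subderivative; for decomposable g this is a second-order
   chain rule, in which nondegeneracy makes the inner multipliers converge.
   Growth shows that minimising the augmented Lagrangian over a small ball gives
   an interior point whose distance to (xbar, M0) is bounded by the distance of
   the multiplier, uniformly in rho: admissible steps exist.  After an admissible
   step the new pair solves the KKT system up to the inexactness o(r) and the
   shift (y - y+) / rho of the argument of g, so by the error bound the distance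
   to the solutions contracts by a factor that vanishes as rho grows; the step
   lengths are then summable. *)

(** * Inner products *)

(** The multiplier set need not be a single point, so dual differences are measured from multipliers
    that move with the sequence: the quotients of [y - yh] then lie in the semi-strict graphical
    derivative, and the growth argument works with moving subgradients. Semi-stability leads back to
    the second subderivative at [ybar], the only one that the SOSC knows. Affinity of [Theta] makes
    the normal cone one fixed subspace, so stationarity conditions are linear equations on feasible
    directions and can be subtracted. Uniformity in rho is the delicate point of the existence of
    steps. The augmented Lagrangian increases with rho, so growth at one [rho0] suffices, but the
    new multiplier is a priori only within rho K |x - xbar| + D of the old one's projection, D being
    the dual distance. Comparing values bounds rho |x - xbar|^2; in the primal estimate rho then
    cancels, and monotonicity of the subdifferential bounds the dual step. The constant [chat] is
    fixed by these steps before contraction is studied, since every admissible step must contract,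
    not only the constructed ones. *)

Section Inner.
Context {R : realType} {V : finHilbertType R}.
Implicit Types (u v w : V) (t : R).

Lemma innerC u v : inner u v = inner v u.
Proof. by rewrite hermC expr0 mul1r. Qed.

Lemma innerDl u v w : inner (u + v) w = inner u w + inner v w.
Proof. exact: linearDl. Qed.

Lemma innerDr u v w : inner w (u + v) = inner w u + inner w v.
Proof. exact: linearDr. Qed.

Lemma innerNl u w : inner (- u) w = - inner u w.
Proof. exact: linearNl. Qed.

Lemma innerNr u w : inner w (- u) = - inner w u.
Proof. exact: linearNr. Qed.

Lemma innerBl u v w : inner (u - v) w = inner u w - inner v w.
Proof. exact: linearBl. Qed.

Lemma innerBr u v w : inner w (u - v) = inner w u - inner w v.
Proof. exact: linearBr. Qed.

Lemma innerZl t u w : inner (t *: u) w = t * inner u w.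
Proof. exact: linearZl_LR. Qed.

Lemma innerZr t u w : inner w (t *: u) = t * inner w u.
Proof. by rewrite innerC innerZl innerC. Qed.

Lemma inner0l w : inner 0 w = 0 :> R.
Proof. exact: linear0l. Qed.

Lemma inner0r w : inner w 0 = 0 :> R.
Proof. by rewrite innerC inner0l. Qed.

Lemma normD_sqr u v : `|u + v| ^+ 2 = `|u| ^+ 2 + 2 * inner u v + `|v| ^+ 2.
Proof.
by rewrite !normr_inner innerDl !innerDr (innerC v u); ring.
Qed.

Lemma normB_sqr u v : `|u - v| ^+ 2 = `|u| ^+ 2 - 2 * inner u v + `|v| ^+ 2.
Proof. by rewrite normD_sqr innerNr normrN mulrN. Qed.

Lemma inner_le u v : inner u v <= `|u| * `|v|.
Proof.
have [->|u0] := eqVneq u 0; first by rewrite inner0l normr0 mul0r.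
have [->|v0] := eqVneq v 0; first by rewrite inner0r normr0 mulr0.
have pu : 0 < `|u| by rewrite normr_gt0.
have pv : 0 < `|v| by rewrite normr_gt0.
have := sqr_ge0 `|(`|v| *: u - `|u| *: v)|.
rewrite normB_sqr !normrZ !normr_id innerZl innerZr.
have -> : (`|v| * `|u|) ^+ 2 - 2 * (`|v| * (`|u| * inner u v)) + (`|u| * `|v|) ^+ 2
 = (2 * (`|u| * `|v|)) * (`|u| * `|v| - inner u v) by ring.
by rewrite pmulr_rge0 ?subr_ge0 // mulr_gt0 // mulr_gt0.
Qed.

Lemma inner_norm_le u v : `|inner u v| <= `|u| * `|v|.
Proof.
rewrite ler_norml inner_le andbT lerNl -innerNl.
by rewrite (le_trans (inner_le _ _)) // normrN.
Qed.

Lemma inner_eq0 u : (forall w, inner u w = 0) -> u = 0.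
Proof. by move=> /(_ u); rewrite -normr_inner => /eqP; rewrite sqrf_eq0 normr_eq0 => /eqP. Qed.

Lemma inner_inj u v : (forall w, inner u w = inner v w) -> u = v.
Proof.
move=> h; apply/eqP; rewrite -subr_eq0; apply/eqP/inner_eq0 => w.
by rewrite innerBl h subrr.
Qed.

Lemma norm_le_inner v (k : R) : 0 <= k -> (forall h, inner v h <= k * `|h|) -> `|v| <= k.
Proof.
move=> k0 /(_ v); rewrite -normr_inner expr2.
have [->|v0] := eqVneq v 0; first by rewrite normr0.
by rewrite ler_pM2r // normr_gt0.
Qed.

End Inner.

Lemma continuous_inner (R : realType) (V : finHilbertType R) (T : Type)
    (F : set_system T) {FF : Filter F} (f g : T -> V) (a b : V) :
  f @ F --> a -> g @ F --> b -> inner (f x) (g x) @[x --> F] --> inner a b.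
Proof.
move=> fa gb; apply/cvgrPdist_lt => e e0.
have ca : 0 < `|a| + `|b| + 1 + 1 by have := normr_ge0 a; have := normr_ge0 b; lra.
set d := Num.min 1 (e / (`|a| + `|b| + 1 + 1)).
have d0 : 0 < d by rewrite lt_min ltr01 divr_gt0.
have /cvgrPdist_lt /(_ _ d0) fd := fa.
have /cvgrPdist_lt /(_ _ d0) gd := gb.
near=> x.
have hf : `|a - f x| < d by near: x.
have hg : `|b - g x| < d by near: x.
have -> : inner a b - inner (f x) (g x) =
  inner a (b - g x) + inner (a - f x) b - inner (a - f x) (b - g x).
  by rewrite !innerBl !innerBr; ring.
apply: (@le_lt_trans _ _ (`|a| * d + d * `|b| + d * `|b - g x|)).
  apply: (le_trans (ler_normB _ _)); apply: lerD.
    apply: (le_trans (ler_normD _ _)); apply: lerD.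
      by rewrite (le_trans (inner_norm_le _ _)) // ler_wpM2l // ltW.
    by rewrite (le_trans (inner_norm_le _ _)) // ler_wpM2r // ltW.
  by rewrite (le_trans (inner_norm_le _ _)) // ler_wpM2r // ltW.
have d1 : d <= 1 by rewrite ge_min lexx.
have de : d * (`|a| + `|b| + 1 + 1) <= e.
  by rewrite -ler_pdivlMr // ge_min lexx orbT.
apply: lt_le_trans de.
have : d * `|b - g x| <= d * 1 by rewrite ler_wpM2l ?ltW // (lt_le_trans hg).
by move=> h; rewrite !mulrDr (mulrC _ d) -!addrA !ltrD2l; lra.
Unshelve. all: by end_near.
Qed.

Ltac vec := apply: inner_inj => ?;
  rewrite ?(innerDl, innerBl, innerNl, innerZl, inner0l); ring.

Lemma fin_num_real (R : realType) (x : \bar R) : x \is a fin_num -> exists r, x = r%:E.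
Proof. by case: x => // r _; exists r. Qed.

(** * Compactness and linear maps in finite dimension *)

Import VectorInternalTheory.

Lemma linear_rV_continuous (R : realType) (n : nat) (W : normedModType R)
    (f : {linear 'rV[R]_n -> W}) : continuous f.
Proof.
have -> : (f : _ -> _) = (fun x => \sum_(i < n) x 0 i *: f (delta_mx 0 i)).
  apply/funext => x; rewrite {1}(row_sum_delta x) linear_sum.
  by apply: eq_bigr => i _; rewrite linearZ.
apply: continuous_big => [|i _ x]; first exact: add_continuous.
apply: (@cvgZr_tmp R W _ (nbhs x) _ (fun y : 'rV[R]_n => y 0 i)).
exact: coord_continuous.
Qed.

Section FiniteDimension.
Context {R : realType} {V : finHilbertType R}.
Implicit Types (u v w : V).

Lemma r2v_continuous : continuous (r2v : 'rV[R]_(dim V) -> V).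
Proof. exact: linear_rV_continuous. Qed.

(** Equivalence of norms: [|r2v x|] attains a minimum on the compact unit sphere of the coordinates,
    injectivity of [r2v] makes it positive, and homogeneity does the rest. The sphere is empty in
    dimension 0. *)
Lemma v2r_bounded : exists2 k : R, 0 < k & forall v, `|v2r v| <= k * `|v|.
Proof.
pose S := [set x : 'rV[R]_(dim V) | `|x| = 1].
have cS : compact S.
  apply: bounded_closed_compact.
    exists 1; split; first exact: num_real.
    by move=> x x1 y /= ->; exact: ltW.
  have -> : S = (fun x : 'rV[R]_(dim V) => `|x|) @^-1` [set 1] by [].
  apply: closed_comp; first by move=> ? _; exact: norm_continuous.
  exact: closed_eq.
have [S0|/set0P/negP] := pselect (S !=set0); last first.
  rewrite negbK => /eqP S0; exists 1 => // v; rewrite mul1r.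
  suff -> : v2r v = 0 by rewrite normr0.
  apply/eqP; apply/negPn/negP => vn0.
  suff : S (`|v2r v|^-1 *: v2r v) by rewrite S0.
  by rewrite /S /= normrZ normfV normr_id mulVf // normr_eq0.
have cont : {within S, continuous (fun x => `|r2v x : V|)}.
  apply: continuous_subspaceT => x.
  apply: continuous_comp; [exact: r2v_continuous|exact: norm_continuous].
have [c cS1 cmin] := compact_EVT_min S0 cS cont.
have c0 : 0 < `|r2v c : V|.
  rewrite normr_gt0; apply/eqP => c0.
  have : c = 0 by rewrite -[c](@r2vK R V) c0 linear0.
  by move: cS1; rewrite inE /S /= => + c00; rewrite c00 normr0 => /eqP; rewrite eq_sym oner_eq0.
exists (`|r2v c : V|^-1); first by rewrite invr_gt0.
move=> v; have [->|v0] := eqVneq v 0.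
  by rewrite linear0 !normr0 mulr0.
have n0 : 0 < `|v2r v|.
  rewrite normr_gt0; apply: contra_neq v0 => v0.
  by rewrite -[v]v2rK v0 linear0.
have : (`|v2r v|^-1 *: v2r v) \in S.
  by rewrite inE /S /= normrZ normfV normr_id mulVf // gt_eqF.
move=> /cmin; rewrite linearZ /= v2rK normrZ normfV normr_id.
by rewrite ler_pdivlMl // ler_pdivlMl // mulrC.
Qed.

Lemma v2r_continuous : continuous (v2r : V -> 'rV[R]_(dim V)).
Proof.
have [k k0 hk] := v2r_bounded.
move=> v; apply/cvgrPdist_lt => e e0.
near=> u.
rewrite -linearB (le_lt_trans (hk _)) // -ltr_pdivlMl //.
near: u; apply: cvgr_dist_lt => //.
by rewrite mulr_gt0 // invr_gt0.
Unshelve. all: by end_near.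
Qed.

Lemma findim_linear_continuous (W : normedModType R) (f : {linear V -> W}) : continuous f.
Proof.
move=> v.
pose h : {linear 'rV[R]_(dim V) -> W} := f \o r2v.
have -> : (f : V -> W) = h \o v2r by apply/funext => x /=; rewrite v2rK.
exact: (@continuous_comp _ _ _ v2r h v (@v2r_continuous v) (@linear_rV_continuous R _ W h (v2r v))).
Qed.

Lemma closed_norm_le (r : R) (a : V) : closed [set x : V | `|x - a| <= r].
Proof.
have -> : [set x : V | `|x - a| <= r] = (fun x : V => `|x - a|) @^-1` [set x | x <= r] by [].
apply: closed_comp; last exact: closed_le.
by move=> y _; apply: cvg_norm; apply: cvgB; [exact: cvg_id|exact: cvg_cst].
Qed.

Lemma compact_closed_ball (r : R) (a : V) : compact [set x : V | `|x - a| <= r].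
Proof.
have -> : [set x : V | `|x - a| <= r] = r2v @` [set y | `|r2v y - a| <= r].
  apply/seteqP; split => x /=; last by move=> [y /= ? <-].
  by move=> h; exists (v2r x) => //=; rewrite v2rK.
apply: continuous_compact.
  by apply: continuous_subspaceT; exact: r2v_continuous.
apply: bounded_closed_compact; last first.
  change (closed ((r2v : 'rV[R]_(dim V) -> V) @^-1` [set x : V | `|x - a| <= r])).
  apply: closed_comp; last exact: closed_norm_le.
  by move=> y _; exact: r2v_continuous.
have [k k0 hk] := v2r_bounded.
exists (k * (r + `|a|)); split; first by rewrite num_real.
move=> M hM y /= hy; apply: ltW; apply: le_lt_trans hM.
have ry : `|r2v y| <= r + `|a|.
  by rewrite -[r2v y](subrK a) (le_trans (ler_normD _ _)) // lerD2r.
by have := hk (r2v y); rewrite r2vK => /le_trans; apply; rewrite ler_wpM2l // ltW.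
Qed.

(** The condition [n <= s n] stands in for strict monotonicity of [s]: it suffices for passing to
    limits and survives repeated extraction. *)
Lemma bounded_subsequence (u : nat -> V) (M : R) : (forall n, `|u n| <= M) ->
  exists (s : nat -> nat) (l : V), (forall n, (n <= s n)%N) /\ u \o s @ \oo --> l.
Proof.
move=> uM.
have cB := @compact_closed_ball M 0.
have [l [_ cl]] : [set x : V | `|x - 0| <= M] `&` cluster (u @ \oo) !=set0.
  apply: (cB (u @ \oo)); exists 0%N => // n _ /=; by rewrite subr0.
have hs n : exists m, (n <= m)%N /\ `|l - u m| < n.+1%:R^-1.
  have n0 : 0 < n.+1%:R^-1 :> R by rewrite invr_gt0.
  have [_ [[m nm <-] hm]] := cl (u @` [set k | (n <= k)%N]) (ball l n.+1%:R^-1)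
    (ex_intro2 _ _ n I (fun k nk => imageP u nk)) (nbhsx_ballx _ _ n0).
  by exists m; split => //; move: hm; rewrite -ball_normE.
have [s hs'] := choice hs.
exists s, l; split; first by move=> n; have [] := hs' n.
apply/cvgrPdist_lt => e e0; near=> n.
have [_ /lt_trans] := hs' n; apply.
near: n; exact: near_infty_natSinv_lt (PosNum e0).
Unshelve. all: by end_near.
Qed.

End FiniteDimension.

(** * Minimisation, projections and Riesz representation *)

Section Lsc.
Context {R : realType} {V : finHilbertType R}.
Implicit Types (f : V -> \bar R) (C : set V).

Lemma lsc_cvg_le f (u : nat -> V) (x : V) (a : nat -> R) (l : R) :
  lower_semicontinuous f -> u @ \oo --> x -> a @ \oo --> l ->
  (forall n, (f (u n) <= (a n)%:E)%E) -> (f x <= l%:E)%E.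
Proof.
move=> lf ux al fa; rewrite leNgt; apply/negP => lfx.
have [b [lb bf]] : exists b : R, l < b /\ (b%:E < f x)%E.
  case: (f x) lfx => [r| |] //.
    by rewrite lte_fin => lr; exists ((l + r) / 2); rewrite lte_fin; split; lra.
  by exists (l + 1); rewrite ltry; split => //; lra.
have [W Wx Wf] := lf _ _ bf.
have [n [Wn an]] : exists n, W (u n) /\ a n < b.
  near \oo => n; exists n; split; near: n; first exact: ux.
  by apply: cvgr_lt; [exact: al|].
by have := lt_le_trans (Wf _ Wn) (fa n); rewrite lte_fin ltNge (ltW an).
Unshelve. all: by end_near.
Qed.

Lemma continuous_lsc (f : V -> R) : continuous f -> lower_semicontinuous (EFin \o f).
Proof.
move=> cf x a /=; rewrite lte_fin => afx; exists [set y | a < f y] => //.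
by have /cvgr_gt := cf x; apply.
Qed.

Lemma indicator_lsc C : closed C -> lower_semicontinuous (@indicator R V C).
Proof.
move=> cC x a; rewrite /indicator; case: asboolP => [Cx|nCx] ax.
  exists setT; [exact: filterT|move=> y _; case: asboolP => // _; exact: ltry].
exists (~` C); first by apply: open_nbhs_nbhs; split => //; exact: closed_openC.
by move=> y nCy; case: asboolP => // _; exact: ltry.
Qed.

(* Convexity is not assumed: an indicator gives metric projections, a linear
   functional gives Riesz representation. *)
Lemma prox_exists f (a b rho : R) (x z0 : V) :
  lower_semicontinuous f -> (forall z, ((- (a + b * `|z|))%:E <= f z)%E) ->
  f z0 \is a fin_num -> 0 < rho -> 0 <= b ->
  exists2 p, f p \is a fin_num & forall z,
    (f p + (2^-1 * rho * `|x - p| ^+ 2)%:E <= f z + (2^-1 * rho * `|x - z| ^+ 2)%:E)%E.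
Proof.
move=> lf fab fz0 rho0 b0.
pose h z := fine (f z) + 2^-1 * rho * `|x - z| ^+ 2.
pose E := [set h z | z in [set z | f z \is a fin_num]].
have fge z : f z \is a fin_num -> - (a + b * `|z|) <= fine (f z).
  by move=> fz; rewrite -lee_fin fineK.
have normz z : `|z| <= `|x| + `|x - z|.
  by rewrite -[z in leLHS](subKr x) (le_trans (ler_normB _ _)).
have hge z : f z \is a fin_num ->
    2^-1 * rho * `|x - z| ^+ 2 - b * `|x - z| - (a + b * `|x|) <= h z.
  move=> fz; have := fge z fz; have := ler_wpM2l b0 (normz z); rewrite /h; lra.
have Elb : has_inf E.
  split; first by exists (h z0), z0.
  exists (- (b ^+ 2 / (2 * rho)) - (a + b * `|x|)) => _ [z fz <-].
  apply: le_trans (hge z fz); rewrite lerD2r.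
  set t := `|x - z|.
  have -> : 2^-1 * rho * t ^+ 2 - b * t =
     (2^-1 * rho) * (t - b / rho) ^+ 2 - b ^+ 2 / (2 * rho).
    by field; rewrite gt_eqF.
  by rewrite lerDr mulr_ge0 ?sqr_ge0 // mulr_ge0 ?ltW.
set m := inf E.
have hn n : exists z, f z \is a fin_num /\ h z < m + n.+1%:R^-1.
  have n0 : 0 < n.+1%:R^-1 :> R by rewrite invr_gt0.
  by have [_ [z fz <-] hz] := inf_adherent n0 Elb; exists z.
have [u hu] := choice hn.
have fu n : f (u n) \is a fin_num by have [] := hu n.
have hun n : h (u n) < m + n.+1%:R^-1 by have [] := hu n.
pose c : R := `|m| + 1 + `|a| + b * `|x|.
have c0 : 0 <= c by rewrite !addr_ge0 ?mulr_ge0.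
(* Minimising sequences stay in this ball: if t = [|x - u n|] is at least 1, [hge] and
   [h (u n) < m + 1] give rho t^2 / 2 <= b t + c <= (b + c) t. *)
pose M := `|x| + Num.max 1 (2 * (b + c) / rho).
have uM n : `|u n| <= M.
  apply: le_trans (normz _) _; rewrite lerD2l le_max.
  have [/ltW -> //|t1] := ltP `|x - u n| 1.
  apply/orP; right; rewrite ler_pdivlMr //.
  have := hge _ (fu n).
  have : h (u n) < m + 1.
    by rewrite (lt_le_trans (hun n)) // lerD2l invf_le1 ?ler1n.
  have := ler_norm m; have := ler_norm a.
  set t := `|x - u n| in t1 *.
  move=> h1 h2 h3 h4.
  have t0 : 0 < t by exact: lt_le_trans t1.
  have h6 : 2^-1 * rho * t ^+ 2 <= (b + c) * t.
    have h6 : c <= c * t by rewrite ler_peMr.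
    have ec : c = `|m| + 1 + `|a| + b * `|x| by [].
    move: (h _) h3 h4 => hn1 h3 h4; clearbody c t; rewrite mulrDl; lra.
  have : (2^-1 * rho * t) * t <= (b + c) * t by rewrite -mulrA -expr2.
  by rewrite ler_pM2r //; lra.
have [s [p [sn sp]]] := bounded_subsequence uM.
pose e n := m + n.+1%:R^-1 - 2^-1 * rho * `|x - u (s n)| ^+ 2.
have ce : e @ \oo --> m + 0 - 2^-1 * rho * `|x - p| ^+ 2.
  apply: cvgB; first by apply: cvgD; [exact: cvg_cst|exact: cvg_harmonic].
  apply: cvgMr; rewrite expr2; under eq_fun do rewrite expr2.
  by apply: cvgM; apply: cvg_norm; apply: cvgB => //; exact: cvg_cst.
have fp : (f p <= (m + 0 - 2^-1 * rho * `|x - p| ^+ 2)%:E)%E.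
  apply: (lsc_cvg_le lf sp ce) => n /=.
  rewrite -[f _]fineK // lee_fin /e lerBrDr; apply: le_trans (ltW (hun _)) _.
  by rewrite lerD2l lef_pV2 ?posrE // ler_nat ltnS.
have fpf : f p \is a fin_num.
  rewrite fin_numE; apply/andP; split; apply/eqP => fpE.
    by have := fab p; rewrite fpE.
  by move: fp; rewrite fpE.
exists p => // z.
have [fz|] := boolP (f z \is a fin_num); last first.
  rewrite fin_numE negb_and !negbK => /orP[/eqP fz|/eqP ->].
    by have := fab z; rewrite fz.
  by rewrite addye // leey.
rewrite -[f p]fineK // -[f z]fineK // -!EFinD lee_fin.
have : m <= h z by apply: ge_inf; [case: Elb|exists z].
move: fp; rewrite -{1}[f p]fineK // lee_fin /h; lra.
Qed.

Lemma lin_quad_ge0 (a b : R) : (forall t, 0 <= t * a + t ^+ 2 * b) -> a = 0.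
Proof.
move=> h; apply/eqP; apply/negPn/negP => a0.
have b0 : 0 < `|b| + 1 by rewrite ltr_wpDl.
have := h (- (a / (2 * (`|b| + 1)))).
have -> : - (a / (2 * (`|b| + 1))) * a + (- (a / (2 * (`|b| + 1)))) ^+ 2 * b =
  (a ^+ 2 / (4 * (`|b| + 1) ^+ 2)) * (b - 2 * (`|b| + 1)).
  by field; rewrite gt_eqF.
rewrite pmulr_rge0; last by rewrite divr_gt0 ?exprn_even_gt0 // mulr_gt0 ?exprn_gt0.
by have := ler_norm b; have := normr_ge0 b; lra.
Qed.

(** The representing vector minimises [2^-1 * |z|^2 - f z]. Comparing the minimiser p with p + t w
    leaves a quadratic in t that is nonnegative and vanishes at 0, so its linear coefficient <p, w>
    - f w is zero. *)
Lemma riesz (f : {linear V -> R}) : exists v : V, forall w, f w = inner v w.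
Proof.
have [k k0 kf] := linear_lipschitz (@findim_linear_continuous _ _ _ f).
have lf : lower_semicontinuous (fun z => (- f z)%:E).
  apply: (@continuous_lsc (fun z => - f z)) => x.
  by apply: cvgN; exact: findim_linear_continuous.
have fk z : ((- (0 + k * `|z|))%:E <= (- f z)%:E)%E.
  by rewrite lee_fin lerN2 add0r (le_trans (ler_norm _)).
have [p _ hp] := @prox_exists (fun z => (- f z)%:E) 0 k 1 0 0 lf fk isT ltr01 (ltW k0).
exists p => w; apply/eqP; rewrite eq_sym -subr_eq0; apply/eqP.
apply: (@lin_quad_ge0 _ (2^-1 * `|w| ^+ 2)) => t.
have := hp (p + t *: w); rewrite -!EFinD lee_fin !sub0r !normrN normD_sqr.
have -> : f (p + t *: w) = f p + t * f w by rewrite linearD linearZ.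
by rewrite innerZr normrZ exprMn real_normK ?num_real //; lra.
Qed.

Lemma closed_projection C (x : V) : closed C -> C !=set0 ->
  exists2 c, C c & forall c', C c' -> `|x - c| <= `|x - c'|.
Proof.
move=> cC [c0 Cc0].
have ind0 : indicator C c0 = 0%E :> \bar R by rewrite /indicator; case: asboolP.
have lb z : ((- (0 + 0 * `|z|))%:E <= indicator C z :> \bar R)%E.
  rewrite mul0r addr0 oppr0 /indicator; case: asboolP => // _; exact: leey.
have indf : indicator C c0 \is a @fin_num R by rewrite ind0.
have [p pf hp] := prox_exists x (indicator_lsc cC) lb indf ltr01 (lexx 0).
have Cp : C p by move: pf; rewrite /indicator; case: asboolP.
exists p => // c' Cc'; have := hp c'.
rewrite /indicator; case: asboolP => // _; case: asboolP => // _.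
rewrite !add0e lee_fin ler_pM2l; last by rewrite mulr_gt0.
by rewrite ler_sqr ?nnegrE.
Qed.

(** A vector space of maximal dimension contained in C exhausts C, since the line of a further
    vector of C would raise the dimension. C is then the zero set of the continuous map
    [x - projv U x]. *)
Lemma subspace_closed C : C 0 -> (forall x y, C x -> C y -> C (x + y)) ->
  (forall (t : R) x, C x -> C (t *: x)) -> closed C.
Proof.
move=> C0 CD CZ.
pose P n := `[< exists U : {vspace V}, \dim U = n /\ forall x, x \in U -> C x >].
have P0 : exists n, P n.
  exists 0%N; apply/asboolP; exists 0%VS; split; first exact: dimv0.
  by move=> x; rewrite memv0 => /eqP ->.
have Pmax n : P n -> (n <= \dim {:V})%N.
  by move/asboolP => [U [<- _]]; apply: dimvS; exact: subvf.
have [n /asboolP [U [dU UC]] Umax] := ex_maxnP P0 Pmax.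
have CU x : C x -> x \in U.
  move=> Cx; apply/negPn/negP => xU.
  have : P (\dim (U + <[x]>)%VS).
    apply/asboolP; exists (U + <[x]>)%VS; split => // _ /memv_addP [y yU [_ /vlineP [k ->] ->]].
    by apply: CD; [exact: UC|exact: CZ].
  move/Umax; rewrite -dU leqNgt => /negP; apply.
  rewrite ltn_neqAle dimvS ?addvSl // andbT.
  apply: contra xU => /eqP dd.
  have : (U == (U + <[x]>))%VS by rewrite eqEdim addvSl dd leqnn.
  by move/eqP => ->; exact: (subvP (addvSr U <[x]>%VS)) (memv_line x).
have -> : C = (fun x => x - projv U x) @^-1` [set x | `|x - 0| <= 0].
  apply/seteqP; split => x /=.
    by move=> /CU xU; rewrite projv_id // subrr subr0 normr0.
  rewrite subr0 normr_le0 subr_eq0 => /eqP ->; apply: UC; exact: memv_proj.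
apply: closed_comp; last exact: closed_norm_le.
move=> x _; apply: cvgB; first exact: cvg_id.
exact: findim_linear_continuous.
Qed.

End Lsc.

(** * Proximal mappings and Moreau envelopes *)

Section Subdiff.
Context {R : realType} {V : finHilbertType R}.
Implicit Types (g : V -> \bar R) (p v z : V).

Lemma subdiff_le g p v z : subdiff g p v -> g z \is a fin_num ->
  fine (g p) + inner v (z - p) <= fine (g z).
Proof. by move=> [gp /(_ z) h] gz; move: h; rewrite -{1}(fineK gp) -{1}(fineK gz) -EFinD lee_fin. Qed.

Lemma subdiff_monotone g p p' v v' : subdiff g p v -> subdiff g p' v' ->
  0 <= inner (v - v') (p - p').
Proof.
move=> sp sp'; have [gp _] := sp; have [gp' _] := sp'.
have := subdiff_le sp gp'; have := subdiff_le sp' gp.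
rewrite innerBl !innerBr; lra.
Qed.

Lemma lin_quad_gt0 (a b : R) :
  (forall t, 0 < t < 1 -> 0 <= t * a + t ^+ 2 * b) -> 0 <= a.
Proof.
move=> h; rewrite leNgt; apply/negP => a0.
have b0 : 0 < `|b| + `|a| + 1 by rewrite ltr_wpDl // addr_ge0.
(* Here t (|b| + |a| + 1) = - a / 2, so a + t b <= a / 2 < 0; the summand |a| keeps t below 1. *)
pose t := - a / (2 * (`|b| + `|a| + 1)).
have t0 : 0 < t by rewrite divr_gt0 ?oppr_gt0 // mulr_gt0.
have t1 : t < 1.
  rewrite ltr_pdivrMr ?mulr_gt0 // mul1r.
  by have := normr_ge0 b; rewrite (ltr0_norm a0); lra.
have := h t; rewrite t0 t1 => /(_ isT).
have -> : t * a + t ^+ 2 * b = t * (a + t * b) by ring.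
rewrite pmulr_rge0 //.
have : t * b <= t * (`|b| + `|a| + 1).
  by rewrite ler_wpM2l ?(ltW t0) //; have := ler_norm b; have := normr_ge0 a; lra.
have -> : t * (`|b| + `|a| + 1) = - a / 2 by rewrite /t; field; rewrite gt_eqF.
lra.
Qed.

End Subdiff.

Section Envelope.
Context {R : realType} {V : finHilbertType R}.

(* The growth condition replaces an affine minorant, whose existence for
   general proper lsc convex functions would need a separation argument. *)
Definition lsc_convex (g : V -> \bar R) : Prop :=
  [/\ lower_semicontinuous g, econvex g, exists z, g z \is a fin_num &
      exists a b : R, 0 <= b /\ forall z, ((- (a + b * `|z|))%:E <= g z)%E].

Definition proxr (g : V -> \bar R) (rho : R) (x : V) : V :=
  xget 0 [set p | forall z,
    (g p + (2^-1 * rho * `|x - p| ^+ 2)%:E <= g z + (2^-1 * rho * `|x - z| ^+ 2)%:E)%E].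

(** The Moreau envelope as a real number, read off at the minimiser; [moreauE] identifies it with
    the infimum. *)
Definition env (g : V -> \bar R) (rho : R) (x : V) : R :=
  fine (g (proxr g rho x)) + 2^-1 * rho * `|x - proxr g rho x| ^+ 2.

Lemma prox_proxr (g : V -> \bar R) x : prox g x = proxr g 1 x.
Proof. by rewrite /proxr mulr1. Qed.

Context (g : V -> \bar R) (gc : lsc_convex g).
Implicit Types (x p v z : V) (rho : R).

Lemma lsc_convex_fin z : (g z < +oo)%E -> g z \is a fin_num.
Proof.
by case: gc => _ _ _ [a [b [_ /(_ z)]]]; case: (g z).
Qed.

Lemma proxr_spec rho x : 0 < rho ->
  g (proxr g rho x) \is a fin_num /\ forall z,
  (g (proxr g rho x) + (2^-1 * rho * `|x - proxr g rho x| ^+ 2)%:E <=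
   g z + (2^-1 * rho * `|x - z| ^+ 2)%:E)%E.
Proof.
move=> rho0; case: (gc) => lg _ [z0 gz0] [a [b [b0 gab]]].
have [p gp hp] := prox_exists x lg gab gz0 rho0 b0.
pose S := [set p | forall z, (g p + (2^-1 * rho * `|x - p| ^+ 2)%:E <=
  g z + (2^-1 * rho * `|x - z| ^+ 2)%:E)%E].
have hpr : S (proxr g rho x) by apply: xgetPex; exists p.
split => //; apply: lsc_convex_fin.
have := hpr z0; rewrite -(fineK gz0) -EFinD.
by case: (g _) => // r; rewrite ltry.
Qed.

Lemma proxr_fin rho x : 0 < rho -> g (proxr g rho x) \is a fin_num.
Proof. by move=> /proxr_spec => /(_ x)[]. Qed.

Lemma env_le rho x z : 0 < rho -> g z \is a fin_num ->
  env g rho x <= fine (g z) + 2^-1 * rho * `|x - z| ^+ 2.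
Proof.
move=> r0 gz; have [gp /(_ z)] := proxr_spec x r0.
by rewrite -(fineK gp) -(fineK gz) -!EFinD lee_fin.
Qed.

Lemma moreauE rho x : 0 < rho -> moreau g rho x = (env g rho x)%:E.
Proof.
move=> r0; have [gp hp] := proxr_spec x r0.
have E : (env g rho x)%:E =
  (g (proxr g rho x) + (2^-1 * rho * `|x - proxr g rho x| ^+ 2)%:E)%E.
  by rewrite /env EFinD fineK.
apply/eqP; rewrite eq_le; apply/andP; split.
  by apply: ereal_inf_lbound; exists (proxr g rho x).
by apply: le_ereal_inf_tmp => _ [z _ <-]; rewrite E.
Qed.

(** The minimiser p is compared with p + t (z - p); convexity bounds g there, and the quadratic term
    is of order t^2. *)
Lemma min_subdiff rho x p : g p \is a fin_num ->
  (forall z, (g p + (2^-1 * rho * `|x - p| ^+ 2)%:E <=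
   g z + (2^-1 * rho * `|x - z| ^+ 2)%:E)%E) -> subdiff g p (rho *: (x - p)).
Proof.
move=> gp hp; split => // z.
have [gz|ngz] := boolP (g z \is a fin_num); last first.
  case: gc => _ _ _ [a [b [_ /(_ z) h]]].
  move: ngz h; rewrite fin_numE negb_and !negbK => /orP[/eqP ->//|/eqP -> _].
  exact: leey.
have [r gpE] := fin_num_real gp; have [q gzE] := fin_num_real gz.
rewrite gpE gzE -EFinD lee_fin -subr_ge0.
apply: (@lin_quad_gt0 _ _ (2^-1 * rho * `|z - p| ^+ 2)) => t t01.
have gconv : econvex g by case: gc.
have := gconv z p t t01.
have -> : t *: z + (1 - t) *: p = p + t *: (z - p) by vec.
rewrite gpE gzE -!EFinM -EFinD => gt.
have /fin_num_real[c gtE] : g (p + t *: (z - p)) \is a fin_num.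
  by apply: lsc_convex_fin; apply: le_lt_trans gt _; rewrite ltry.
move: gt (hp (p + t *: (z - p))).
rewrite gtE gpE -!EFinD !lee_fin.
have -> : x - (p + t *: (z - p)) = (x - p) - t *: (z - p) by vec.
rewrite (normB_sqr (x - p)) innerZr normrZ exprMn real_normK ?num_real // innerZl.
lra.
Qed.

Lemma proxr_subdiff rho x : 0 < rho ->
  subdiff g (proxr g rho x) (rho *: (x - proxr g rho x)).
Proof. by move=> r0; have [gp hp] := proxr_spec x r0; exact: min_subdiff. Qed.

Lemma proxr_unique rho x p : 0 < rho -> subdiff g p (rho *: (x - p)) -> proxr g rho x = p.
Proof.
move=> r0 sp; apply/eqP; rewrite -subr_eq0 -normr_le0.
have := subdiff_monotone (proxr_subdiff x r0) sp.
set p' := proxr _ _ _.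
have -> : rho *: (x - p') - rho *: (x - p) = - rho *: (p' - p) by vec.
rewrite innerZl -normr_inner mulNr oppr_ge0 pmulr_rle0 //.
by rewrite exprn_even_le0 //= => /eqP ->.
Qed.

(** Firm nonexpansiveness: x - x' splits into the difference of the proximal points and that of the
    residuals x - p, and monotonicity makes their inner product nonnegative. Each summand is
    therefore bounded by |x - x'|; [proxr_grad_lip] uses the other one. *)
Lemma proxr_lip rho x x' : 0 < rho ->
  `|proxr g rho x - proxr g rho x'| <= `|x - x'|.
Proof.
move=> r0; have := subdiff_monotone (proxr_subdiff x r0) (proxr_subdiff x' r0).
set p := proxr _ _ x; set p' := proxr _ _ x'.
rewrite -scalerBr innerZl pmulr_rge0 // => h.
rewrite -ler_sqr ?nnegrE //.
have -> : x - x' = (x - p - (x' - p')) + (p - p').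
  by vec.
rewrite [leRHS]normD_sqr; have := sqr_ge0 `|x - p - (x' - p')|; lra.
Qed.

Lemma proxr_grad_lip rho x x' : 0 < rho ->
  `|rho *: (x - proxr g rho x) - rho *: (x' - proxr g rho x')| <= rho * `|x - x'|.
Proof.
move=> r0; have := subdiff_monotone (proxr_subdiff x r0) (proxr_subdiff x' r0).
set p := proxr _ _ x; set p' := proxr _ _ x'.
rewrite -scalerBr innerZl pmulr_rge0 // => h.
rewrite normrZ gtr0_norm // ler_pM2l // -ler_sqr ?nnegrE //.
have -> : x - x' = (x - p - (x' - p')) + (p - p').
  by vec.
rewrite [leRHS]normD_sqr; have := sqr_ge0 `|p - p'|; lra.
Qed.

(** The upper bound takes the proximal point of x as competitor at x'; the lower bound is the
    subgradient inequality between the two proximal points. *)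
Lemma env_taylor rho x x' : 0 < rho ->
  `|env g rho x' - env g rho x - inner (rho *: (x - proxr g rho x)) (x' - x)|
  <= 2^-1 * rho * `|x' - x| ^+ 2.
Proof.
move=> r0; rewrite ler_norml; apply/andP; split.
  apply: (@le_trans _ _ 0); first by rewrite oppr_le0 mulr_ge0 ?sqr_ge0 ?mulr_ge0 ?ltW.
  have := subdiff_le (proxr_subdiff x r0) (proxr_fin x' r0).
  rewrite /env; set p := proxr _ _ x; set p' := proxr _ _ x'.
  rewrite !innerZl => h.
  have : 0 <= 2^-1 * rho * `|(x - p) - (x' - p')| ^+ 2.
    by rewrite mulr_ge0 ?sqr_ge0 ?mulr_ge0 ?ltW.
  have e : x' - x = (p' - p) + ((x' - p') - (x - p)).
    by vec.
  rewrite e normB_sqr (innerDr (p' - p)) (innerBr (x' - p')) -normr_inner.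
  lra.
have := env_le x' r0 (proxr_fin x r0); rewrite [env g rho x]/env.
set p := proxr _ _ x.
have -> : x' - p = (x - p) + (x' - x) by vec.
rewrite normD_sqr innerZl; lra.
Qed.

End Envelope.

(** * Differentials, gradients and adjoints *)

Section Differentiability.
Context {R : realType} {V : finHilbertType R}.

(* No continuity of l is required, the domain being finite dimensional. *)
Lemma diff_intro (W : normedModType R) (f : V -> W) (x : V) (l : {linear V -> W}) :
  (forall e : R, 0 < e -> \forall h \near 0, `|f (x + h) - f x - l h| <= e * `|h|) ->
  differentiable f x /\ 'd f x = l :> (V -> W).
Proof.
move=> hl.
have lc : continuous l by exact: findim_linear_continuous.
have E : f \o shift x = cst (f x) + l +o_ 0 id.
  apply/eqaddoP => e e0; near=> h.
  have -> : (f \o shift x - (cst (f x) + l)) h = f (x + h) - f x - l h.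
    by rewrite /= !fctE opprD addrA (addrC h).
  by near: h; exact: hl.
have D := diff_unique lc E.
split => //; apply/diff_locallyP; split; first by rewrite D.
by rewrite E D.
Unshelve. all: by end_near.
Qed.

Lemma diff_elim (W : normedModType R) (f : V -> W) (x : V) : differentiable f x ->
  forall e : R, 0 < e -> \forall h \near 0, `|f (x + h) - f x - 'd f x h| <= e * `|h|.
Proof.
move=> /diff_locally E e e0.
have /eqaddoP /(_ e e0) := E; apply: filterS => h.
by rewrite /= !fctE opprD addrA (addrC h).
Qed.

Lemma grad_eq (f : V -> R) (x v : V) : (forall w, 'd f x w = inner v w) -> grad f x = v.
Proof.
move=> h; rewrite /grad.
have : [set v | forall w, 'd f x w = inner v w] v by [].
move=> /(xgetI 0) /= hx; apply: inner_inj => w; by rewrite -hx h.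
Qed.

Lemma gradE (f : V -> R) (x w : V) : inner (grad f x) w = 'd f x w.
Proof.
have [v hv] := riesz ('d f x).
by rewrite (grad_eq hv) hv.
Qed.

Lemma adjointE (W : finHilbertType R) (A : {linear V -> W}) (w : W) (u : V) :
  inner (adjoint A w) u = inner w (A u).
Proof.
pose F : V -> R := fun u => inner w (A u).
have Flin : linear F by move=> a b c; rewrite /F linearP innerDr innerZr.
pose FL := HB.pack_for {linear V -> R} F (GRing.isLinear.Build R V R _ F Flin).
have [v hv] := riesz FL.
have : [set v | forall u, inner v u = inner w (A u)] v by move=> /= z; rewrite -hv.
by move=> /(xgetI 0) /=; exact.
Qed.

End Differentiability.

Section HasDiff.
Context {R : realType} {U V W : normedModType R}.
Implicit Types (f : U -> V) (x : U).

(** The differential is recorded as a plain function, so that formulas can be assembled by the rules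
    below without packing linear maps. *)
Definition has_diff (A B : normedModType R) (f : A -> B) (x : A) (l : A -> B) : Prop :=
  differentiable f x /\ forall h, 'd f x h = l h.

Lemma has_diff_ext f f' x l l' : f =1 f' -> l =1 l' -> has_diff f x l -> has_diff f' x l'.
Proof. by move=> /funext <- /funext <-. Qed.

Lemma has_diff_cst (c : V) x : has_diff (fun _ : U => c) x (fun _ => 0).
Proof. by split => [|h]; [exact: differentiable_cst|rewrite diff_cst]. Qed.

Lemma has_diff_id x : has_diff id x id.
Proof. by split => [|h]; [exact: ex_diff|rewrite diff_val]. Qed.

Lemma has_diffD f f' x l l' : has_diff f x l -> has_diff f' x l' ->
  has_diff (fun z => f z + f' z) x (fun h => l h + l' h).
Proof.
move=> [df fE] [df' fE']; split => [|h]; first exact: differentiableD.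
by rewrite -fE -fE' (diffD df df').
Qed.

Lemma has_diffB f f' x l l' : has_diff f x l -> has_diff f' x l' ->
  has_diff (fun z => f z - f' z) x (fun h => l h - l' h).
Proof.
move=> [df fE] [df' fE']; split => [|h]; first exact: differentiableB.
by rewrite -fE -fE' (diffB df df').
Qed.

Lemma has_diffZ (c : R) f x l : has_diff f x l -> has_diff (fun z => c *: f z) x (fun h => c *: l h).
Proof.
move=> [df fE]; split => [|h]; first exact: differentiableZ.
by rewrite -fE (diffZ c df).
Qed.

Lemma has_diff_comp f (k : V -> W) x l m : has_diff f x l -> has_diff k (f x) m ->
  has_diff (fun z => k (f z)) x (fun h => m (l h)).
Proof.
move=> [df fE] [dk kE]; split => [|h]; first exact: (differentiable_comp df dk).
by rewrite -fE -kE (diff_comp df dk).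
Qed.

End HasDiff.

Section EnvelopeDiff.
Context {R : realType} {V : finHilbertType R} (g : V -> \bar R) (gc : lsc_convex g).

Lemma env_diff rho x : 0 < rho -> has_diff (env g rho) x (inner (rho *: (x - proxr g rho x))).
Proof.
move=> r0; set q := rho *: _.
have Flin : linear (inner q : V -> R) by move=> a b c; rewrite innerDr innerZr.
pose FL := HB.pack_for {linear V -> R} (inner q : V -> R)
   (GRing.isLinear.Build R V R _ (inner q : V -> R) Flin).
have [|D E] := @diff_intro R V R (env g rho) x FL.
  move=> e e0; near=> h.
  have := env_taylor gc x (x + h) r0; rewrite -/q (_ : x + h - x = h); last by vec.
  move=> /le_trans; apply.
  rewrite expr2 mulrA ler_wpM2r // -ler_pdivlMl ?mulr_gt0 // ltW //.
  near: h; apply: nbhs0_lt; by rewrite mulr_gt0 // invr_gt0 mulr_gt0.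
by split => // h; rewrite E.
Unshelve. all: by end_near.
Qed.

End EnvelopeDiff.

(** * Second-order expansions *)

Section SecondOrder.
Context {R : realType} {V : finHilbertType R}.

(** B is the derivative of ['d f] at a in the operator norm. The expansion is that of the
    derivative; the Taylor formula for f itself is deduced in [taylor2_functional]. *)
Definition second_order (W : normedModType R) (f : V -> W) (a : V) (B : V -> V -> W) : Prop :=
  [/\ forall v, linear (B^~ v), forall h, linear (B h),
      exists2 K : R, 0 < K & forall h v, `|B h v| <= K * `|h| * `|v| &
      forall e : R, 0 < e -> \forall h \near 0, differentiable f (a + h) /\
        forall v, `|'d f (a + h) v - 'd f a v - B h v| <= e * `|h| * `|v|].

(** [C2_on] treats each direction separately; expanding v over a basis makes the remainder uniform
    in v, at the price of the sum of the bounds [k i] of the coordinate forms. *)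
Lemma C2_second_order (W : normedModType R) (f : V -> W) (O : set V) (a : V) :
  C2_on O f -> open_nbhs a O -> exists B, second_order f a B.
Proof.
move=> fC2 Oa; have OOa : O a by case: Oa.
pose n := \dim {:V}; pose b (i : 'I_n) : V := (vbasis {:V})`_i.
pose c (i : 'I_n) := coord (vbasis {:V}) i.
have vE v : v = \sum_i c i v *: b i by apply: coord_vbasis; rewrite memvf.
have ck i : exists k : R, 0 < k /\ forall v, `|c i v| <= k * `|v|.
  have ci : continuous (c i : V -> R).
    exact: (@findim_linear_continuous R V R (c i : {linear V -> R^o})).
  by have [k k0 hk] := @linear_lipschitz R V R (c i : {linear V -> R^o}) ci; exists k.
have [k hk] := choice ck.
pose D i := 'd (fun z => 'd f z (b i)) a.
have Dm i : exists m : R, 0 < m /\ forall h, `|D i h| <= m * `|h|.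
  by have [m m0 hm] := linear_lipschitz (@findim_linear_continuous _ _ _ (D i)); exists m.
have [m hm] := choice Dm.
have k0 i : 0 < k i by case: (hk i).
have m0 i : 0 < m i by case: (hm i).
have hk' i v : `|c i v| <= k i * `|v| by case: (hk i).
have hm' i v : `|D i v| <= m i * `|v| by case: (hm i).
exists (fun h v => \sum_i c i v *: D i h); split.
- move=> v t h h'; rewrite scaler_sumr -big_split /=; apply: eq_bigr => i _.
  by rewrite linearP scalerDr !scalerA mulrC.
- move=> h t v v'; rewrite scaler_sumr -big_split /=; apply: eq_bigr => i _.
  have -> : c i (t *: v + v') = t * c i v + c i v' by rewrite /c linearD linearZ.
  by rewrite scalerDl scalerA.
- exists (1 + \sum_i k i * m i).
    by rewrite ltr_pwDl // sumr_ge0 // => i _; rewrite mulr_ge0 ?ltW.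
  move=> h v; apply: le_trans (ler_norm_sum _ _ _) _.
  apply: (@le_trans _ _ ((\sum_i k i * m i) * `|h| * `|v|)).
    rewrite !mulr_suml; apply: ler_sum => i _; rewrite normrZ.
    apply: (@le_trans _ _ (k i * `|v| * (m i * `|h|))); first by rewrite ler_pM.
    by rewrite le_eqVlt; apply/orP; left; apply/eqP; ring.
  by rewrite ler_wpM2r // ler_wpM2r // lerDr.
- move=> e e0; pose S := 1 + \sum_i k i.
  have S0 : 0 < S by rewrite ltr_pwDl // sumr_ge0 // => i _; rewrite ltW.
  have nO : \forall h \near 0, O (a + h).
    have : (fun h => a + h) @ (0 : V) --> a.
      by rewrite -[X in _ --> X]addr0; apply: cvgD; [exact: cvg_cst|exact: cvg_id].
    by apply; exact: open_nbhs_nbhs.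
  have nD : \forall h \near 0, forall i, `|'d f (a + h) (b i) - 'd f a (b i) - D i h| <= e / S * `|h|.
    apply: filter_forall => i.
    have [_ dD _] := fC2 a (b i) 0 OOa.
    by apply: (diff_elim dD); rewrite divr_gt0.
  near=> h; split.
    have hO : O (a + h) by near: h.
    by have [] := fC2 (a + h) 0 0 hO.
  have hD : forall i, `|'d f (a + h) (b i) - 'd f a (b i) - D i h| <= e / S * `|h| by near: h.
  move=> v.
  have -> : 'd f (a + h) v - 'd f a v - \sum_i c i v *: D i h =
     \sum_i c i v *: ('d f (a + h) (b i) - 'd f a (b i) - D i h).
    have dE z : 'd f z v = \sum_i c i v *: 'd f z (b i).
      by rewrite {1}(vE v) linear_sum; apply: eq_bigr => i _; rewrite linearZ.
    rewrite [X in X - _ - _](dE (a + h)) [X in _ - X - _](dE a) -!sumrB; apply: eq_bigr => i _.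
    by rewrite !scalerBr.
  apply: le_trans (ler_norm_sum _ _ _) _.
  apply: (@le_trans _ _ (\sum_i k i * `|v| * (e / S * `|h|))).
    by apply: ler_sum => i _; rewrite normrZ ler_pM.
  rewrite -mulr_suml -mulr_suml.
  have -> : (\sum_i k i) * `|v| * (e / S * `|h|) = (e * `|h| * `|v|) * ((\sum_i k i) / S).
    by ring.
  rewrite ler_piMr ?mulr_ge0 ?(ltW e0) // ler_pdivrMr // mul1r /S lerDr //.
Unshelve. all: by end_near.
Qed.

Lemma second_order_bound (W : normedModType R) (f : V -> W) a B : second_order f a B ->
  exists2 C : R, 0 < C & \forall h \near 0,
    forall v, `|'d f (a + h) v - 'd f a v| <= C * `|h| * `|v|.
Proof.
move=> [_ _ [K K0 hK] hd]; exists (K + 1); first by rewrite addr_gt0.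
near=> h => v.
have [_ /(_ v) hv] : differentiable f (a + h) /\
        forall v, `|'d f (a + h) v - 'd f a v - B h v| <= 1 * `|h| * `|v|.
  by near: h; exact: hd.
rewrite -[X in `|X|](subrK (B h v)) (le_trans (ler_normD _ _)) //.
by have := hK h v; rewrite !mulrDl; lra.
Unshelve. all: by end_near.
Qed.

Lemma is_derive_line (W : normedModType R) (f : V -> W) (l : {linear W -> R}) (a h : V) (t : R) :
  continuous l -> differentiable f (a + t *: h) ->
  is_derive t 1 (fun s : R => l (f (a + s *: h))) (l ('d f (a + t *: h) h)).
Proof.
move=> lc df.
pose k (s : R) : V := a + s *: h.
have kd : differentiable k t.
  apply: differentiableD; first exact: differentiable_cst.
  exact: differentiableZl.
have dk : 'd k t 1 = h.
  rewrite /k diffD; [|exact: differentiable_cst|exact: differentiableZl].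
  by rewrite diff_cst /= add0r diffZl // diff_val /= scale1r.
have dfk : differentiable f (k t) by [].
have dl : differentiable l (f (k t)) by exact: linear_differentiable.
have dc : differentiable (f \o k) t by exact: differentiable_comp.
have dlc : differentiable (l \o (f \o k)) t by exact: differentiable_comp.
split; first exact: diff_derivable.
rewrite deriveE //.
have -> : 'd (l \o (f \o k)) t = 'd l ((f \o k) t) \o 'd (f \o k) t :> (R -> R) by exact: diff_comp.
rewrite /= diff_lin //.
have -> : 'd (f \o k) t = 'd f (k t) \o 'd k t :> (R -> W) by exact: diff_comp.
by rewrite /= dk.
Qed.

(** The neighbourhood does not depend on l, so [taylor2] may take for l the inner product with the
    very remainder to be bounded at h. The mean value theorem is thus needed only for real
    functions. *)
Lemma taylor2_functional (W : normedModType R) (f : V -> W) a B (e : R) : second_order f a B -> 0 < e ->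
  \forall h \near 0, forall (l : {linear W -> R}) (c : R), 0 <= c -> (forall w, `|l w| <= c * `|w|) ->
    `|l (f (a + h) - f a - 'd f a h - 2^-1 *: B h h)| <= c * e * `|h| ^+ 2.
Proof.
move=> [lB1 lB2 _ hd] e0.
have /nbhs_norm0P [r r0 hr] := hd e e0.
apply/nbhs_norm0P; exists r => // h /= hh l c c0 lc.
have lcont : continuous l.
  move=> w; apply/cvgrPdist_lt => d d0.
  have c1 : 0 < `|c| + 1 by rewrite ltr_wpDl.
  near=> u.
  rewrite -linearB; apply: le_lt_trans (lc _) _.
  apply: (@le_lt_trans _ _ ((`|c| + 1) * `|w - u|)).
    by rewrite ler_wpM2r // (le_trans (ler_norm _)) // lerDl.
  rewrite -ltr_pdivlMl //; near: u; apply: cvgr_dist_lt => //.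
  by rewrite mulr_gt0 // invr_gt0.
pose q := l (B h h).
(* The derivative of psi at t is l applied to the remainder of ['d f] at [t *: h] in the direction
   h, which is already known to be small. *)
pose psi (t : R) := l (f (a + t *: h)) - t * l ('d f a h) - 2^-1 * t ^+ 2 * q.
pose dpsi (t : R) := l ('d f (a + t *: h) h) - l ('d f a h) - t * q.
have dt (t : R) : 0 <= t <= 1 -> differentiable f (a + t *: h) /\
   forall v, `|'d f (a + t *: h) v - 'd f a v - B (t *: h) v| <= e * `|t *: h| * `|v|.
  move=> /andP[t0 t1]; apply: hr => /=; apply: le_lt_trans hh.
  by rewrite normrZ ger0_norm // ler_piMl.
have hpsi (t : R) : 0 <= t <= 1 -> is_derive t 1 psi (dpsi t).
  move=> /dt[df _].
  have D1 := is_derive_line lcont df.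
  have D2 : is_derive t 1 (fun s : R => s * l ('d f a h)) (l ('d f a h)).
    by apply: is_derive_eq; rewrite scaler0 add0r /GRing.scale /= mulr1.
  have D3 : is_derive t 1 (fun s : R => 2^-1 * s ^+ 2 * q) (t * q).
    apply: is_derive_eq; rewrite ?scaler0 ?add0r /GRing.scale /=.
    by field.
  have -> : psi = (fun s => l (f (a + s *: h))) - (fun s => s * l ('d f a h)) -
     (fun s => 2^-1 * s ^+ 2 * q) by [].
  exact: is_deriveB.
have [||x xin] := @MVT R psi dpsi 0 1 ltr01.
- by move=> t; rewrite in_itv /= => /andP[t0 t1]; apply: hpsi; rewrite !ltW.
- apply: derivable_within_continuous => t; rewrite in_itv /= => ht.
  by have [] := hpsi t ht.
move: xin; rewrite in_itv /= => /andP[x0 x1].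
rewrite subr0 mulr1 /psi scale1r scale0r addr0 expr1n expr0n /= !mulr0 !mul0r !subr0 !mul1r mulr1.
move=> E.
have -> : l (f (a + h) - f a - 'd f a h - 2^-1 *: B h h) = dpsi x.
  have lZ (k : R) w : l (k *: w) = k * l w by exact: linearZ.
  rewrite -E !linearB lZ /q; ring.
have x01 : 0 <= x <= 1 by rewrite !ltW.
have [_ /(_ h) hx] := dt x x01.
have -> : dpsi x = l ('d f (a + x *: h) h - 'd f a h - B (x *: h) h).
  have lZ (k : R) w : l (k *: w) = k * l w by exact: linearZ.
  have B0 : B 0 h = 0 by have := lB1 h (-1) 0 0; rewrite /= scaler0 addr0 scaleN1r addNr.
  have Bx : B (x *: h) h = x *: B h h by have := lB1 h x h 0; rewrite /= !addr0 B0 addr0.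
  by rewrite /dpsi /q !linearB Bx lZ.
apply: le_trans (lc _) _; rewrite -mulrA ler_wpM2l //; apply: le_trans hx _.
rewrite normrZ (gtr0_norm x0) expr2 -!mulrA ler_wpM2l ?(ltW e0) //.
by rewrite ler_piMl ?mulr_ge0 // ltW.
Unshelve. all: by end_near.
Qed.

Lemma taylor2_real (f : V -> R) a B (e : R) : second_order f a B -> 0 < e ->
  \forall h \near 0, `|f (a + h) - f a - 'd f a h - 2^-1 * B h h| <= e * `|h| ^+ 2.
Proof.
move=> fB e0; have := taylor2_functional fB e0; apply: filterS => h.
move=> /(_ idfun 1 ler01); rewrite /= mul1r; apply => w; by rewrite mul1r.
Qed.

Lemma taylor2 (W : finHilbertType R) (f : V -> W) a B (e : R) : second_order f a B -> 0 < e ->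
  \forall h \near 0, `|f (a + h) - f a - 'd f a h - 2^-1 *: B h h| <= e * `|h| ^+ 2.
Proof.
move=> fB e0; have := taylor2_functional fB e0; apply: filterS => h.
set w := _ - _ - _ - _.
have Flin : linear (inner w : W -> R) by move=> x y z; rewrite innerDr innerZr.
pose FL := HB.pack_for {linear W -> R} (inner w : W -> R)
   (GRing.isLinear.Build R W R _ (inner w : W -> R) Flin).
move=> /(_ FL `|w| (normr_ge0 _) (inner_norm_le w)) /=.
rewrite -normr_inner ger0_norm ?sqr_ge0 // expr2 -mulrA.
have [->|w0] := eqVneq w 0; first by rewrite normr0 mulr_ge0 ?sqr_ge0 // ltW.
by rewrite ler_pM2l // normr_gt0.
Qed.

Lemma second_order_remainder (W : finHilbertType R) (f : V -> W) a B : second_order f a B ->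
  exists2 C : R, 0 < C & \forall h \near 0,
    [/\ `|f (a + h) - f a - 'd f a h| <= C * `|h| ^+ 2,
        `|f (a + h) - f a| <= C * `|h| &
         forall v, `|'d f (a + h) v - 'd f a v| <= C * `|h| * `|v|].
Proof.
move=> fB; have [C C0 hC] := second_order_bound fB.
have [_ _ [K K0 hK] _] := fB.
have [k k0 hk] := linear_lipschitz (@findim_linear_continuous _ _ _ ('d f a)).
exists (C + K + k + 1); first by rewrite !addr_gt0.
near=> h.
have h1 : `|h| <= 1 by near: h; apply: nbhs0_le.
have hT : `|f (a + h) - f a - 'd f a h - 2^-1 *: B h h| <= 1 * `|h| ^+ 2.
  by near: h; exact: taylor2.
have hR : `|f (a + h) - f a - 'd f a h| <= (K + 1) * `|h| ^+ 2.
  rewrite -[X in `|X|](subrK (2^-1 *: B h h)) (le_trans (ler_normD _ _)) // mulrDl addrC lerD //.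
  rewrite normrZ ger0_norm // expr2 mulrA; have := hK h h.
  have : 0 <= K * `|h| * `|h| by apply: mulr_ge0 => //; apply: mulr_ge0 => //; exact: ltW.
  lra.
have h2 : `|h| ^+ 2 <= `|h| by rewrite expr2 ler_piMl.
have n0 := normr_ge0 h.
have q0 := sqr_ge0 `|h|.
split.
- apply: le_trans hR _; rewrite ler_wpM2r //; lra.
- rewrite -[X in `|X|](subrK ('d f a h)) (le_trans (ler_normD _ _)) //.
  apply: (@le_trans _ _ ((K + 1) * `|h| ^+ 2 + k * `|h|)); first by rewrite lerD.
  apply: (@le_trans _ _ ((K + 1) * `|h| + k * `|h|)).
    by rewrite lerD2r ler_wpM2l // addr_ge0 ?ltW.
  rewrite -mulrDl ler_wpM2r //; lra.
- move=> v; apply: (@le_trans _ _ (C * `|h| * `|v|)).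
    by move: v; near: h.
  rewrite ler_wpM2r // ler_wpM2r //; lra.
Unshelve. all: by end_near.
Qed.

Lemma second_order_cvg (W : normedModType R) (f : V -> W) x B (a b : nat -> V) (la lb : V) :
  second_order f x B -> a @ \oo --> la -> b @ \oo --> lb ->
  (fun n => B (a n) (b n)) @ \oo --> B la lb.
Proof.
move=> [lB1 lB2 [K K0 hK] _] ala blb.
have -> : (fun n => B (a n) (b n)) = (fun n => (B (a n) (b n) - B la lb) + B la lb).
  by apply/funext => n; rewrite subrK.
rewrite -[X in _ --> X]add0r; apply: cvgD; last exact: cvg_cst.
apply/norm_cvg0P.
have l3 : (fun n => K * `|a n - la| * `|b n| + K * `|la| * `|b n - lb|) @ \oo -->
    K * `|la - la| * `|lb| + K * `|la| * `|lb - lb|.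
  apply: cvgD; first apply: cvgM; last 2 first.
  - exact: cvg_norm.
  - by apply: cvgMr; apply: cvg_norm; apply: cvgB => //; exact: cvg_cst.
  - by apply: cvgMr; apply: cvg_norm; apply: cvgB => //; exact: cvg_cst.
rewrite !subrr !normr0 mulr0 mul0r mulr0 addr0 in l3.
apply: (squeeze_cvgr _ (cvg_cst 0) l3); apply: nearW => n; rewrite normr_ge0 /=.
have -> : B (a n) (b n) - B la lb = B (a n - la) (b n) + B la (b n - lb).
  have := lB1 (b n) (-1) la (a n); rewrite /= !scaleN1r (addrC (- la)) => ->.
  have := lB2 la (-1) lb (b n); rewrite /= !scaleN1r (addrC (- lb)) => ->.
  by rewrite (addrC (- B la (b n))) (addrC (- B la lb)) addrA subrK.
by rewrite (le_trans (ler_normD _ _)) // lerD.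
Qed.

Lemma second_orderZl (W : normedModType R) (f : V -> W) x B (t : R) h v :
  second_order f x B -> B (t *: h) v = t *: B h v.
Proof.
move=> [lB1 _ _ _].
have B0 : B 0 v = 0 by have := lB1 v (-1) 0 0; rewrite /= scaler0 addr0 scaleN1r addNr.
by have := lB1 v t h 0; rewrite /= !addr0 B0 addr0.
Qed.

Lemma second_orderZr (W : normedModType R) (f : V -> W) x B (t : R) h v :
  second_order f x B -> B h (t *: v) = t *: B h v.
Proof.
move=> [_ lB2 _ _].
have B0 : B h 0 = 0 by have := lB2 h (-1) 0 0; rewrite scaler0 addr0 scaleN1r addNr.
by have := lB2 h t v 0; rewrite !addr0 B0 addr0.
Qed.

Section Quotients.
Variables (t : nat -> R) (w : nat -> V) (wl : V).
Hypotheses (t0 : down0 t) (wc : w @ \oo --> wl).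

Let tw0 : (fun n => t n *: w n) @ \oo --> (0 : V).
Proof. by rewrite -(scale0r wl); apply: cvgZ => //; case: t0. Qed.

Lemma diff_quotient_cvg (W : normedModType R) (f : V -> W) a B (v : nat -> V) (vl : V) :
  second_order f a B -> v @ \oo --> vl ->
  (fun n => (t n)^-1 *: ('d f (a + t n *: w n) (v n) - 'd f a (v n))) @ \oo --> B wl vl.
Proof.
move=> so vc; have [tp _] := t0.
have Bc := second_order_cvg so wc vc.
have -> : (fun n => (t n)^-1 *: ('d f (a + t n *: w n) (v n) - 'd f a (v n))) =
  (fun n => (t n)^-1 *: ('d f (a + t n *: w n) (v n) - 'd f a (v n) - B (t n *: w n) (v n)) + B (w n) (v n)).
  apply/funext => n; rewrite (second_orderZl _ _ _ so) [in RHS]scalerBr scalerA mulVf ?gt_eqF //.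
  by rewrite scale1r subrK.
rewrite -[X in _ --> X]add0r; apply: cvgD => //.
apply/cvgr0Pnorm_lt => e e0.
have c0 : 0 < `|wl| * `|vl| + 1 by rewrite ltr_wpDl // mulr_ge0.
have [_ _ _ hd] := so.
have e1 : 0 < e / (`|wl| * `|vl| + 1) by rewrite divr_gt0.
near=> n.
have [_ /(_ (v n)) hn] : differentiable f (a + t n *: w n) /\ forall v',
  `|'d f (a + t n *: w n) v' - 'd f a v' - B (t n *: w n) v'| <= e / (`|wl| * `|vl| + 1) * `|t n *: w n| * `|v'|.
  by near: n; exact: (tw0 (hd _ e1)).
rewrite normrZ gtr0_norm ?invr_gt0 // ltr_pdivrMl //; apply: le_lt_trans hn _.
have -> : e / (`|wl| * `|vl| + 1) * `|t n *: w n| * `|v n| =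
    t n * (e / (`|wl| * `|vl| + 1) * (`|w n| * `|v n|)) by rewrite normrZ gtr0_norm //; ring.
rewrite ltr_pM2l // [X in _ < X](_ : e = e / (`|wl| * `|vl| + 1) * (`|wl| * `|vl| + 1)); last by rewrite divfK ?gt_eqF.
rewrite ltr_pM2l //; near: n.
have : (fun n => `|w n| * `|v n|) @ \oo --> `|wl| * `|vl| by apply: cvgM; exact: cvg_norm.
by move=> /cvgr_lt; apply; rewrite ltrDl.
Unshelve. all: by end_near.
Qed.

(** The Taylor estimate is a hypothesis so that one proof serves both Hilbert-valued and real-valued
    functions. *)
Lemma taylor2_quotient (W : normedModType R) (f : V -> W) a B : second_order f a B ->
  (forall e : R, 0 < e ->
    \forall h \near 0, `|f (a + h) - f a - 'd f a h - 2^-1 *: B h h| <= e * `|h| ^+ 2) ->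
  (fun n => (t n ^+ 2)^-1 *: (f (a + t n *: w n) - f a - 'd f a (t n *: w n))) @ \oo --> 2^-1 *: B wl wl.
Proof.
move=> so taylor; have [tp _] := t0.
have Bc : (fun n => 2^-1 *: B (w n) (w n)) @ \oo --> 2^-1 *: B wl wl.
  by apply: cvgZl_tmp; exact: second_order_cvg so wc wc.
have -> : (fun n => (t n ^+ 2)^-1 *: (f (a + t n *: w n) - f a - 'd f a (t n *: w n))) =
  (fun n => (t n ^+ 2)^-1 *: (f (a + t n *: w n) - f a - 'd f a (t n *: w n) - 2^-1 *: B (t n *: w n) (t n *: w n))
   + 2^-1 *: B (w n) (w n)).
  apply/funext => n; rewrite (second_orderZl _ _ _ so) (second_orderZr _ _ _ so).
  rewrite [in RHS]scalerBr !scalerA.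
  have -> : t n ^- 2 / 2 * (t n * t n) = 2^-1 by field; rewrite gt_eqF.
  by rewrite subrK.
rewrite -[X in _ --> X]add0r; apply: cvgD => //.
apply/cvgr0Pnorm_lt => e e0.
have c0 : 0 < `|wl| ^+ 2 + 1 by rewrite ltr_wpDl // sqr_ge0.
have e1 : 0 < e / (`|wl| ^+ 2 + 1) by rewrite divr_gt0.
have hd := taylor _ e1.
near=> n.
have hn : `|f (a + t n *: w n) - f a - 'd f a (t n *: w n) - 2^-1 *: B (t n *: w n) (t n *: w n)|
   <= e / (`|wl| ^+ 2 + 1) * `|t n *: w n| ^+ 2.
  by near: n; exact: (tw0 hd).
have t2 : 0 < t n ^+ 2 by rewrite exprn_gt0.
rewrite normrZ gtr0_norm ?invr_gt0 // ltr_pdivrMl //; apply: le_lt_trans hn _.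
rewrite normrZ gtr0_norm // exprMn mulrCA ltr_pM2l //.
rewrite [X in _ < X](_ : e = e / (`|wl| ^+ 2 + 1) * (`|wl| ^+ 2 + 1)); last by rewrite divfK ?gt_eqF.
rewrite ltr_pM2l //; near: n.
have : (fun n => `|w n| ^+ 2) @ \oo --> `|wl| ^+ 2.
  by rewrite expr2; under eq_fun do rewrite expr2; apply: cvgM; exact: cvg_norm.
by move=> /cvgr_lt; apply; rewrite ltrDl.
Unshelve. all: by end_near.
Qed.

Lemma taylor2_quotient_cvg (W : finHilbertType R) (f : V -> W) a B : second_order f a B ->
  (fun n => (t n ^+ 2)^-1 *: (f (a + t n *: w n) - f a - 'd f a (t n *: w n))) @ \oo --> 2^-1 *: B wl wl.
Proof. by move=> so; apply: taylor2_quotient => // e; exact: taylor2. Qed.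

Lemma taylor2_quotient_real (f : V -> R) a B : second_order f a B ->
  (fun n => (t n ^+ 2)^-1 * (f (a + t n *: w n) - f a - 'd f a (t n *: w n))) @ \oo --> 2^-1 * B wl wl.
Proof. by move=> so; have := taylor2_quotient so (fun e => taylor2_real so (e := e)). Qed.

End Quotients.

End SecondOrder.

(** * Subderivatives along sequences *)

Section Liminf.
Context {R : realType}.

Lemma limf_einf_le_cvg (T : choiceType) (S : filteredType T) (F : set_system S) (f : S -> \bar R)
    (p : nat -> S) (c : nat -> R) (l : R) :
  p @ \oo `=>` F -> c @ \oo --> l ->
  (\forall k \near \oo, (f (p k) <= (c k)%:E)%E) -> (limf_einf f F <= l%:E)%E.
Proof.
move=> pF cl fc; rewrite limf_einfE; apply: ge_ereal_sup => _ [A FA <-].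
apply/lee_addgt0Pr => e e0.
near \oo => k.
apply: (@le_trans _ _ (f (p k))).
  apply: ereal_inf_lbound; exists (p k) => //.
  by near: k; exact: pF.
apply: (@le_trans _ _ (c k)%:E); first by near: k.
rewrite -EFinD lee_fin ltW //.
by near: k; apply: (cvgr_lt l) => //; rewrite ltrDl.
Unshelve. all: by end_near.
Qed.

Lemma limf_einf_ge (T : choiceType) (S : filteredType T) (F : set_system S) (f : S -> \bar R) (l : R) :
  (forall e : R, 0 < e -> F [set p | ((l - e)%:E <= f p)%E]) -> (l%:E <= limf_einf f F)%E.
Proof.
move=> h; apply/lee_addgt0Pr => e e0; rewrite -leeBlDr // -EFinB limf_einfE.
apply: le_trans (ereal_sup_ubound _); last by exists [set p | ((l - e)%:E <= f p)%E]; [exact: h|reflexivity].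
by apply: le_ereal_inf_tmp => _ [p /= ? <-].
Qed.

Lemma down0_cvg (t : nat -> R) : down0 t -> t @ \oo `=>` 0^'+.
Proof.
move=> [tpos t0] A [e /= e0 eA].
have /cvgrPdist_lt /(_ e e0) := t0; apply: filterS => k h /=.
by apply: eA => //=.
Qed.

Lemma cvg_filter_prod (S T : Type) (F : set_system S) (G : set_system T)
    (f : nat -> S) (g : nat -> T) :
  f @ \oo `=>` F -> g @ \oo `=>` G -> (fun k => (f k, g k)) @ \oo `=>` filter_prod F G.
Proof.
move=> fF gG A [[P Q] /= [FP GQ] PQA].
have h1 : \forall k \near \oo, P (f k) by exact: fF.
have h2 : \forall k \near \oo, Q (g k) by exact: gG.
by apply: filterS2 h1 h2 => k Pk Qk; exact: (PQA (f k, g k)).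
Qed.

Lemma subseq_infty (s : nat -> nat) : (forall n, (n <= s n)%N) -> s @ \oo --> \oo.
Proof.
move=> sn A [N _ NA]; exists N => // n /= Nn; apply: NA => /=.
exact: leq_trans Nn (sn n).
Qed.

Lemma cvg_subseq (T : topologicalType) (u : nat -> T) (l : T) (s : nat -> nat) :
  (forall n, (n <= s n)%N) -> u @ \oo --> l -> (u \o s) @ \oo --> l.
Proof. by move=> sn ul; apply: cvg_comp ul; exact: subseq_infty. Qed.

Lemma down0_subseq (t : nat -> R) (s : nat -> nat) :
  (forall n, (n <= s n)%N) -> down0 t -> down0 (t \o s).
Proof. by move=> sn [t0 tc]; split; [move=> k; exact: t0|exact: cvg_subseq]. Qed.

End Liminf.

Section SecondSubderivative.
Context {R : realType} {V : finHilbertType R}.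
Implicit Types (f : V -> \bar R) (x v w : V).

Lemma subderiv_le_cvg f x w (t : nat -> R) (u : nat -> V) (c : nat -> R) (l : R) :
  down0 t -> u @ \oo --> w -> c @ \oo --> l ->
  (\forall k \near \oo, (((t k)^-1)%:E * (f (x + t k *: u k)%R - f x) <= (c k)%:E)%E) ->
  (subderiv f x w <= l%:E)%E.
Proof.
move=> t0 uw cl h; apply: (@limf_einf_le_cvg _ _ _ _ _ (fun k => (t k, u k)) c) => //.
by apply: cvg_filter_prod => //; exact: down0_cvg.
Qed.

Lemma subderiv2_le_cvg f x v w (t : nat -> R) (u : nat -> V) (c : nat -> R) (l : R) :
  down0 t -> u @ \oo --> w -> c @ \oo --> l ->
  (\forall k \near \oo, (diff2 f x v (t k) (u k) <= (c k)%:E)%E) ->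
  (subderiv2 f x v w <= l%:E)%E.
Proof.
move=> t0 uw cl h; apply: (@limf_einf_le_cvg _ _ _ _ _ (fun k => (t k, u k)) c) => //.
by apply: cvg_filter_prod => //; exact: down0_cvg.
Qed.

Lemma semistrict_subderiv2_le_cvg f x v w (t : nat -> R) (u z : nat -> V) (c : nat -> R) (l : R) :
  down0 t -> u @ \oo --> w -> z @ \oo --> v -> (forall k, subdiff f x (z k)) -> c @ \oo --> l ->
  (\forall k \near \oo, (diff2 f x (z k) (t k) (u k) <= (c k)%:E)%E) ->
  (semistrict_subderiv2 f x v w <= l%:E)%E.
Proof.
move=> t0 uw zv sz cl h.
apply: (@limf_einf_le_cvg _ _ _ _ _ (fun k => ((t k, u k), z k)) c) => //.
apply: (@cvg_filter_prod _ _ _ _ (fun k => (t k, u k)) z).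
  by apply: cvg_filter_prod => //; exact: down0_cvg.
move=> A /= hA.
have hz : \forall k \near \oo, subdiff f x (z k) -> A (z k) := zv _ hA.
exact: filterS (fun k (hk : subdiff f x (z k) -> A (z k)) => hk (sz k)) hz.
Qed.

Lemma diff2_fin f x v (t : R) w (r q : R) : f x = r%:E -> f (x + t *: w) = q%:E ->
  diff2 f x v t w = ((q - r - t * inner v w) * (2^-1 * t ^+ 2)^-1)%:E.
Proof. by move=> fx fw; rewrite /diff2 fx fw -!EFinB -EFinM. Qed.

Lemma diff2_fin_inv f x v (t : R) w (r : R) : f x = r%:E -> 0 < t ->
  diff2 f x v t w \is a fin_num -> f (x + t *: w) \is a fin_num.
Proof.
move=> fx t0; have s0 : (0 < ((2^-1 * t ^+ 2)^-1)%:E)%E.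
  by rewrite lte_fin invr_gt0 mulr_gt0 // exprn_gt0.
rewrite /diff2 fx; case: (f _) => [q| |] //.
  by rewrite (_ : (+oo - r%:E - (t * inner v w)%:E)%E = +oo%E) // gt0_mulye.
by rewrite (_ : (-oo - r%:E - (t * inner v w)%:E)%E = -oo%E) // gt0_mulNye.
Qed.

Lemma subderiv_ge f x v w : subdiff f x v -> ((inner v w)%:E <= subderiv f x w)%E.
Proof.
move=> [fx sv]; have [r rE] := fin_num_real fx; apply: limf_einf_ge => e e0.
exists ([set t | 0 < t], [set w' | inner v w - e < inner v w']).
  split => /=; first exact: nbhs_right_gt.
  have : inner v w' @[w' --> w] --> inner v w.
    by apply: continuous_inner; [exact: cvg_cst|exact: cvg_id].
  by move=> /cvgr_gt; apply; rewrite ltrBlDr ltrDl.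
move=> [t w'] /= [t0 hw'].
have := sv (x + t *: w'); rewrite rE addrAC subrr add0r innerZr -EFinD.
case: (f _) => [q| |] //.
  rewrite !lee_fin => h.
  apply: (le_trans (ltW hw')).
  by rewrite mulrC ler_pdivlMr // mulrC lerBrDl.
by rewrite addye // gt0_muley ?leey // lte_fin invr_gt0.
Qed.

(** One half of criticality holds for every direction by [subderiv_ge]; an upper estimate along a
    single sequence gives the other half, its quadratic term vanishing after division by t. *)
Lemma crit_cone_cvg f x v w (t : nat -> R) (u z : nat -> V) (C : R) :
  subdiff f x v -> down0 t -> u @ \oo --> w -> z @ \oo --> v ->
  (\forall k \near \oo, (f (x + t k *: u k)%R <= f x + (t k * inner (z k) (u k) + C * t k ^+ 2)%:E)%E) ->
  crit_cone f x v w.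
Proof.
move=> sv t0 uw zv h; rewrite /crit_cone /=; apply/eqP; rewrite eq_le subderiv_ge //=.
have [fx _] := sv; have [r rE] := fin_num_real fx.
have tk k : 0 < t k by case: t0.
have cl : (fun k => inner (z k) (u k) + C * t k) @ \oo --> inner v w.
  rewrite -[X in _ --> X]addr0 -[X in _ --> _ + X](mulr0 C).
  apply: cvgD; first exact: continuous_inner.
  by apply: cvgMr; case: t0.
apply: (subderiv_le_cvg t0 uw cl); apply: filterS h => k; rewrite rE -EFinD.
case: (f _) => [q| |] //.
  rewrite !lee_fin => h.
  by rewrite mulrC ler_pdivrMr // lerBlDl (le_trans h) // lerD2l expr2; lra.
by move=> _; rewrite addNye gt0_muleNy ?leNye // lte_fin invr_gt0.
Qed.

(** The subgradient inequality at [xk k], tested at x, reads f(xk) <= f(x) + <yk, xk - x> with yk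
    tending to v: this is the upper estimate of [crit_cone_cvg] with C = 0. *)
Lemma semistrict_graphical_deriv_crit f x v w a :
  subdiff f x v -> semistrict_graphical_deriv (subdiff f) x v w a -> crit_cone f x v w.
Proof.
move=> sv [t [xk [yk [yhk [t0 [xkx yky yhky] hF wk ak]]]]].
apply: (@crit_cone_cvg f x v w t (fun k => (t k)^-1 *: (xk k - x)) yk 0) => //.
have [fx _] := sv.
apply: nearW => k; have tk : t k != 0 by rewrite gt_eqF //; case: t0.
rewrite scalerA divff // scale1r addrC subrK.
have [syk _] := hF k; have [fxk _] := syk.
rewrite innerZr mulrA divff // mul1r mul0r addr0.
rewrite -(fineK fx) -(fineK fxk) -EFinD lee_fin.
by have := subdiff_le syk fx; rewrite -opprB innerNr; lra.
Qed.

(** The subgradient inequality at x + t u is tested at x + t m z, where z is a recovery sequence for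
    the shortened steps m t, 0 < m < 1. With D the second subderivative the limit reads D <= m^2 D +
    2 (1 - m) <a, w>; dividing by 1 - m gives (1 + m) D <= 2 <a, w>, and m is taken close to 1. An
    infinite D is excluded by testing at x itself. *)
Lemma graphical_deriv_ge f x v w a : subdiff f x v -> twice_epi_differentiable f x v ->
  graphical_deriv (subdiff f) x v w a -> (subderiv2 f x v w <= (inner a w)%:E)%E.
Proof.
move=> sv epi [t [wa [t0 wac hF]]].
have [fx _] := sv; have [r rE] := fin_num_real fx.
pose u k := (wa k).1; pose b k := (wa k).2.
have uw : u @ \oo --> w by apply: cvg_comp wac _; exact: cvg_fst.
have ba : b @ \oo --> a by apply: cvg_comp wac _; exact: cvg_snd.
have tk k : 0 < t k by case: t0.
have sb k : subdiff f (x + t k *: u k) (v + t k *: b k) by exact: hF.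
have quot z k : f (x + t k *: z) \is a fin_num ->
    (diff2 f x v (t k) (u k) <= diff2 f x v (t k) z - (2 * inner (b k) (z - u k))%:E)%E.
  move=> fz; have [q qE] := fin_num_real fz.
  have [fu _] := sb k; have [p pE] := fin_num_real fu.
  rewrite (diff2_fin v rE qE) (diff2_fin v rE pE) -EFinB lee_fin.
  have := subdiff_le (sb k) fz; rewrite qE pE /=.
  have -> : x + t k *: z - (x + t k *: u k) = t k *: (z - u k) by vec.
  rewrite innerZr innerDl innerZl innerBr => h.
  have -> : 2 * inner (b k) (z - u k) = (t k ^+ 2 * inner (b k) (z - u k)) * (2^-1 * t k ^+ 2)^-1.
    by field; rewrite gt_eqF.
  rewrite -mulrBl ler_pM2r ?invr_gt0 ?mulr_gt0 ?exprn_gt0 //.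
  rewrite expr2; lra.
case E : (subderiv2 f x v w) => [D| |]; last by rewrite leNye.
- rewrite lee_fin.
  suff hl (m : R) : 0 < m < 1 -> (1 + m) * D <= 2 * inner a w.
    rewrite leNgt; apply/negP => aD.
    have [D0|D0] := leP D 0.
      have := hl 2^-1; rewrite ?invr_gt0 ?invf_lt1 ?ltr0n ?ltr1n //= => /(_ isT).
      by lra.
    (* If <a, w> < D with D > 0, this m satisfies m D >= <a, w>, hence (1 + m) D > 2 <a, w>. *)
    pose m := Num.max 2^-1 (inner a w / D).
    have m0 : 0 < m < 1.
      by rewrite lt_max invr_gt0 ltr0n /= gt_max invf_lt1 ?ltr1n //= ltr_pdivrMr // mul1r.
    have := hl m m0.
    have : inner a w / D <= m by rewrite le_max lexx orbT.
    rewrite ler_pdivrMr // mulrDl mul1r; lra.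
  move=> /andP[m0 m1].
  have tm0 : down0 (fun k => m * t k).
    split; first by move=> k; rewrite mulr_gt0.
    by rewrite -(mulr0 m); apply: cvgMr; case: t0.
  have [z zw dz] := epi w _ tm0.
  move: dz; rewrite E => /fine_cvgP[dzf dz].
  pose c k := m ^+ 2 * fine (diff2 f x v (m * t k) (z k)) - 2 * inner (b k) (m *: z k - u k).
  have cc : c @ \oo --> m ^+ 2 * D - 2 * inner a (m *: w - w).
    apply: cvgB; first by apply: cvgMr; exact: dz.
    apply: cvgMr; apply: continuous_inner => //; apply: cvgB => //.
    by apply: cvgZl_tmp.
  have : (D%:E <= (m ^+ 2 * D - 2 * inner a (m *: w - w))%:E)%E.
    rewrite -E; apply: (subderiv2_le_cvg t0 uw cc).
    apply: filterS dzf => k; rewrite /c.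
    have ez : x + (m * t k) *: z k = x + t k *: (m *: z k) by rewrite scalerA (mulrC m).
    move=> dfin; have [q fz] : exists q, f (x + t k *: (m *: z k)) = q%:E.
      by apply: fin_num_real; rewrite -ez; apply: (diff2_fin_inv rE _ dfin); rewrite mulr_gt0.
    have fzf : f (x + t k *: (m *: z k)) \is a fin_num by rewrite fz.
    apply: le_trans (quot _ k fzf) _.
    rewrite (diff2_fin v rE fz) (@diff2_fin f x v (m * t k) (z k) r q rE) ?ez //=.
    rewrite -EFinB lee_fin lerD2r innerZr.
    rewrite le_eqVlt; apply/orP; left; apply/eqP; field.
    by rewrite !gt_eqF.
  rewrite lee_fin innerBr innerZr => h.
  have : (1 - m) * ((1 + m) * D) <= (1 - m) * (2 * inner a w) by lra.
  by rewrite ler_pM2l // subr_gt0.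
- have : (+oo <= (2 * inner a w)%:E)%E.
    rewrite -E; apply: (@subderiv2_le_cvg _ _ _ _ t u (fun k => 2 * inner (b k) (u k))) => //.
      by apply: cvgMr; exact: continuous_inner.
    apply: nearW => k.
    have f0 : f (x + t k *: 0) = r%:E by rewrite scaler0 addr0.
    have ff0 : f (x + t k *: 0) \is a fin_num by rewrite f0.
    apply: le_trans (quot 0 k ff0) _; rewrite (diff2_fin v rE f0) inner0r mulr0 subr0 subrr mul0r.
    by rewrite -EFinB lee_fin sub0r sub0r innerNr; lra.
  by [].
Qed.

End SecondSubderivative.

(** * Affine sets and sublinear functions *)

Lemma cvg_le_const (R : realType) (u : nat -> R) (l c : R) : u @ \oo --> l ->
  (\forall n \near \oo, u n <= c) -> l <= c.
Proof. by move=> ul h; apply: (cvgr_to_le ul). Qed.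

Section Affine.
Context {R : realType} {V : finHilbertType R}.
Implicit Types (A : set V) (a x y z : V).

Lemma affine_addB A x y z : affine_set A -> A x -> A y -> A z -> A (x + (y - z)).
Proof.
move=> aA Ax Ay Az.
(* The point lies on the line through z and the midpoint of x and y. *)
have -> : x + (y - z) = 2 *: (2^-1 *: x + (1 - 2^-1) *: y) + (1 - 2) *: z.
  by apply: inner_inj => w; rewrite ?(innerDl, innerBl, innerNl, innerZl); field.
by apply: (aA) => //; exact: (aA).
Qed.

Lemma affine_direction_closed A a : affine_set A -> A a -> closed [set h | A (a + h)].
Proof.
move=> aA Aa; apply: subspace_closed => [|x y /= hx hy|t x /= hx].
- by rewrite /= addr0.
- have -> : a + (x + y) = (a + x) + ((a + y) - a) by vec.
  exact: affine_addB.
- have -> : a + t *: x = t *: (a + x) + (1 - t) *: a by vec.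
  exact: aA.
Qed.

Lemma affine_directionZ A a x (t : R) : affine_set A -> A a -> A (a + x) -> A (a + t *: x).
Proof.
move=> aA Aa Ax; have -> : a + t *: x = t *: (a + x) + (1 - t) *: a by vec.
exact: aA.
Qed.

Lemma affine_aff A : affine_set (aff A).
Proof.
move=> x y t hx hy B hB; have [aB AB] := hB.
by apply: aB; [exact: hx|exact: hy].
Qed.

Lemma sub_aff A : A `<=` aff A.
Proof. by move=> x Ax B [_ AB]; exact: AB. Qed.

Lemma parE A a : aff A a -> par A = [set h | aff A (a + h)].
Proof.
move=> Aa; apply/seteqP; split => h /=.
  by move=> [x Ax [y Ay <-]]; exact: (affine_addB (affine_aff (A:=A)) Aa Ax Ay).
by move=> Ah; exists (a + h) => //; exists a => //; vec.
Qed.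

End Affine.

Section Sublinear.
Context {R : realType} {Z : finHilbertType R} (theta : Z -> \bar R).
Hypotheses (tp : eproper theta) (tl : lower_semicontinuous theta) (ts : sublinear theta).

Let tfin z : (theta z < +oo)%E -> theta z \is a fin_num.
Proof. by have [/(_ z)] := tp; case: (theta z). Qed.

(** Homogeneity for t > 0 leaves the value at 0 open. Lower semicontinuity along x0 / n gives theta
    0 <= 0, properness makes it finite, and theta 0 = 2 theta 0 concludes. *)
Lemma sublinear0 : theta 0 = 0%E.
Proof.
have [tpos _] := ts; have [tN [x0 /fin_num_real[r rE]]] := tp.
have : (theta 0%R <= 0%:E)%E.
  apply: (@lsc_cvg_le _ _ theta (fun n => n.+1%:R^-1 *: x0) 0 (fun n => n.+1%:R^-1 * r)) => //.
  - by rewrite -(scale0r x0); apply: cvgZr_tmp; exact: cvg_harmonic.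
  - by rewrite -(mul0r r); apply: cvgMl; exact: cvg_harmonic.
  - by move=> n; rewrite tpos ?invr_gt0 // rE -EFinM.
move=> t0; have /fin_num_real[q qE] : theta 0 \is a fin_num.
  by apply: tfin; apply: le_lt_trans t0 _; rewrite ltry.
have two0 : 0 < 2 :> R by [].
have := tpos 2 0 two0; rewrite scaler0 qE -EFinM => /eqP.
by rewrite eqe => /eqP h; congr (_%:E); lra.
Qed.

Lemma sublinear_lsc_convex : lsc_convex theta.
Proof.
have [tpos tadd] := ts; have [tN [x0 fx0]] := tp.
split => //.
- by move=> x y t /andP[t0 t1]; rewrite -!tpos ?subr_gt0 //; exact: tadd.
- by exists x0.
(* Lower semicontinuity at 0 gives theta > -1 on a ball of radius r; homogeneity turns this into
   theta z >= - (2 / r) |z|. *)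
- have [W /nbhs_ballP[r /= r0 rW] hW] : exists2 V, nbhs 0 V & forall y, V y -> ((-1)%:E < theta y)%E.
    by apply: tl; rewrite sublinear0 lte_fin oppr_lt0.
  exists 0, (2 / r); split; first by rewrite divr_ge0 ?ltW.
  move=> z; rewrite add0r; have [->|z0] := eqVneq z 0.
    by rewrite normr0 mulr0 oppr0 sublinear0.
  have nz : 0 < `|z| by rewrite normr_gt0.
  have := hW ((r / (2 * `|z|)) *: z).
  have k0 : 0 < r / (2 * `|z|) by rewrite divr_gt0 ?mulr_gt0.
  rewrite tpos // => /(_ _)/ltW; set k := r / _ in k0 *.
  have Wz : W (k *: z).
    apply: rW; rewrite -ball_normE /= sub0r normrN normrZ gtr0_norm // /k.
    have -> : r / (2 * `|z|) * `|z| = r / 2 by field; rewrite gt_eqF.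
    lra.
  move=> /(_ Wz); have := tN z; case: (theta z) => [q| |] // _.
    rewrite -EFinM !lee_fin => h.
    rewrite -(ler_pM2l k0) (le_trans _ h) // /k.
    rewrite le_eqVlt; apply/orP; left; apply/eqP; field.
    by rewrite !gt_eqF.
  by move=> _; rewrite leey.
Qed.

Lemma subdiff_sublinear0 m : subdiff theta 0 m <-> forall z, ((inner m z)%:E <= theta z)%E.
Proof.
split => [[_ h] z|h]; first by have := h z; rewrite sublinear0 add0e subr0.
by split; [rewrite sublinear0|move=> z; rewrite sublinear0 add0e subr0].
Qed.

(** Testing the subgradient inequality at 2 z and at 0 forces theta z = <m, z>, after which the
    inequality no longer involves z. *)
Lemma subdiff_sublinear z m : subdiff theta z m ->
  subdiff theta 0 m /\ theta z = (inner m z)%:E.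
Proof.
move=> [/fin_num_real[q qE] h]; have [tpos _] := ts.
have E : q = inner m z.
  have := h (2 *: z); rewrite tpos // qE -EFinM -EFinD lee_fin.
  rewrite scaler_nat mulr2n addrK => h1.
  have := h 0; rewrite sublinear0 qE -EFinD lee_fin sub0r innerNr; lra.
split; last by rewrite qE E.
apply/subdiff_sublinear0 => z'.
by have := h z'; rewrite qE E -EFinD innerBr addrC subrK.
Qed.

Lemma subdiff_sublinear0_closed (m : nat -> Z) l :
  (forall n, subdiff theta 0 (m n)) -> m @ \oo --> l -> subdiff theta 0 l.
Proof.
move=> hm ml; apply/subdiff_sublinear0 => z.
have hz n : ((inner (m n) z)%:E <= theta z)%E.
  by move/subdiff_sublinear0: (hm n); exact.
case E : (theta z) => [q| |]; last 2 first.
- exact: leey.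
- by have := hz 0%N; rewrite E.
rewrite lee_fin; apply: (@cvg_le_const _ (fun n => inner (m n) z)).
  by apply: continuous_inner => //; exact: cvg_cst.
by apply: nearW => n; have := hz n; rewrite E lee_fin.
Qed.

End Sublinear.

Lemma lin_quad_near (R : realType) (a b d : R) : 0 < d ->
  (forall t, 0 < t < d -> 0 <= t * a + t ^+ 2 * b) -> 0 <= a.
Proof.
move=> d0 h; rewrite -(pmulr_rge0 _ d0); apply: (@lin_quad_gt0 _ _ (d ^+ 2 * b)) => t /andP[t0 t1].
have := h (t * d); rewrite mulr_gt0 // -[X in _ < X]mul1r ltr_pM2r // t1 => /(_ isT).
by congr (_ <= _); ring.
Qed.

Lemma diff_min0 (R : realType) (V : finHilbertType R) (F : V -> R) (x h : V) (d : R) :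
  differentiable F x -> 0 < d -> (forall t, `|t| < d -> F x <= F (x + t *: h)) -> 'd F x h = 0.
Proof.
move=> dF d0 hmin.
suff pos h' : (forall t, `|t| < d -> F x <= F (x + t *: h')) -> 0 <= 'd F x h'.
  apply/eqP; rewrite eq_le pos // andbT -oppr_ge0 -linearN pos // => t td.
  by rewrite scalerN -scaleNr hmin // normrN.
move=> {}hmin; apply/ler_addgt0Pr => e e0.
have h1 : 0 < `|h'| + 1 by rewrite ltr_wpDl.
have e1 : 0 < e / (`|h'| + 1) by rewrite divr_gt0.
have /nbhs_norm0P[r /= r0 hr] := diff_elim dF e1.
pose t := Num.min (d / 2) (r / (2 * (`|h'| + 1))).
have t0 : 0 < t by rewrite lt_min !divr_gt0 ?mulr_gt0.
have td : `|t| < d by rewrite gtr0_norm // gt_min; apply/orP; left; lra.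
have := hr (t *: h'); rewrite /= normrZ gtr0_norm //.
have tr : t * `|h'| < r.
  apply: (@le_lt_trans _ _ (t * (`|h'| + 1))).
    by apply: ler_wpM2l; [exact: ltW|rewrite lerDl].
  apply: (@le_lt_trans _ _ (r / (2 * (`|h'| + 1)) * (`|h'| + 1))).
    by apply: ler_wpM2r; [exact: ltW|rewrite ge_min lexx orbT].
  have -> : r / (2 * (`|h'| + 1)) * (`|h'| + 1) = r / 2 by field; rewrite gt_eqF.
  lra.
have dZ : 'd F x (t *: h') = t * 'd F x h' by exact: linearZ.
move=> /(_ tr); rewrite dZ => /ler_normlP[_ hb].
have hm := hmin t td.
rewrite -(pmulr_rge0 _ t0).
have : e / (`|h'| + 1) * (t * `|h'|) <= t * e.
  have -> : e / (`|h'| + 1) * (t * `|h'|) = t * e * (`|h'| / (`|h'| + 1)) by ring.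
  rewrite ler_piMr ?mulr_ge0 ?(ltW t0) ?(ltW e0) //.
  by rewrite ler_pdivrMr // mul1r lerDl.
rewrite mulrDr; lra.
Qed.

(** * Subgradients of decomposable functions *)

Section LinearForms.
Context {R : realType} {V : finHilbertType R}.

Definition inner_lin (v : V) : {linear V -> R} :=
  HB.pack_for {linear V -> R} (inner v : V -> R)
   (GRing.isLinear.Build R V R _ (inner v : V -> R)
     (fun a b c => etrans (innerDr (a *: b) c v) (congr1 (+%R^~ (inner v c)) (innerZr a b v)))).

Lemma diff_inner (v u : V) : has_diff (inner v : V -> R) u (inner v).
Proof.
have [|D E] := @diff_intro R V R (inner v : V -> R) u (inner_lin v).
  move=> e e0; apply: nearW => h /=.
  have -> : inner v (u + h) - inner v u - inner v h = 0 by rewrite innerDr; ring.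
  by rewrite normr0 mulr_ge0 // ltW.
by split => // h; rewrite E.
Qed.

Lemma diff_half_sqr (a u : V) : has_diff (fun u => 2^-1 * `|u - a| ^+ 2 : R) u (inner (u - a)).
Proof.
have [|D E] := @diff_intro R V R (fun u => 2^-1 * `|u - a| ^+ 2) u (inner_lin (u - a)).
  move=> e e0; near=> h => /=.
  have -> : u + h - a = (u - a) + h by rewrite addrAC.
  rewrite normD_sqr.
  have -> : 2^-1 * (`|u - a| ^+ 2 + 2 * inner (u - a) h + `|h| ^+ 2) -
    2^-1 * `|u - a| ^+ 2 - inner (u - a) h = (2^-1 * `|h|) * `|h| by field.
  rewrite ger0_norm ?mulr_ge0 // ler_wpM2r // -ler_pdivlMl // invrK ltW //.
  by near: h; apply: nbhs0_lt; rewrite mulr_gt0.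
by split => // h; rewrite E.
Unshelve. all: by end_near.
Qed.

End LinearForms.

Section ChainRule.
Context {R : realType} {Y Z : finHilbertType R}.
Context (g : Y -> \bar R) (theta : Z -> \bar R) (Xi : Y -> Z) (g0 : R).
Hypotheses (tp : eproper theta) (tl : lower_semicontinuous theta) (ts : sublinear theta).

(* A quantitative form of the injectivity of [adjoint ('d Xi u)] on [par C]
   for [C = subdiff theta 0], avoiding the adjoint. *)
Definition inj_on_diff (c : R) (u : Y) : Prop :=
  forall m m' k, subdiff theta 0 m -> subdiff theta 0 m' -> 0 <= k ->
    (forall h, inner (m - m') ('d Xi u h) <= k * `|h|) -> c * `|m - m'| <= k.

(** Injectivity controls only differences of elements of [subdiff theta 0], so [m 0] serves as an
    anchor for the whole sequence. *)
Lemma bounded_multiplier_cvg (u0 : Y) (c L : R) (u : nat -> Y) (y : nat -> Y) (m : nat -> Z) (M : R) :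
  0 < c -> (forall n, inj_on_diff c (u n)) -> (forall n h, `|'d Xi (u n) h| <= L * `|h|) -> 0 <= L ->
  (forall n, subdiff theta 0 (m n)) -> (forall n h, inner (m n) ('d Xi (u n) h) = inner (y n) h) ->
  (forall n, `|y n| <= M) -> exists K : R, forall n, `|m n| <= K.
Proof.
move=> c0 uinj uL L0 mC my yM.
have M0 : 0 <= M by exact: le_trans (yM 0%N).
exists ((M + `|m 0%N| * L) / c + `|m 0%N|) => n.
rewrite -[m n](subrK (m 0%N)) (le_trans (ler_normD _ _)) // lerD2r.
rewrite ler_pdivlMr // mulrC; apply: (uinj n) => //.
  by rewrite addr_ge0 ?mulr_ge0.
move=> h; rewrite innerBl my mulrDl lerD //.
  by rewrite (le_trans (inner_le _ _)) // ler_wpM2r.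
rewrite -innerNl (le_trans (inner_le _ _)) // normrN -mulrA ler_wpM2l //.
Qed.

(** Penalisation replaces a nonsmooth calculus rule: theta is smoothed into its envelopes, and [F n]
    is minimised over a small ball K. The minimisers converge along a subsequence to u0, hence
    become interior, where stationarity expresses y - (u - u0) through a subgradient [m n] of theta.
    Injectivity bounds these subgradients, and a limit point is the required m. *)
Lemma chain_rule (u0 y : Y) (B0 : Y -> Y -> Z) (c : R) :
  second_order Xi u0 B0 -> 0 < c ->
  (\forall h \near 0, g (u0 + h) = (g0%:E + theta (Xi (u0 + h)%R))%E /\ inj_on_diff c (u0 + h)) ->
  subdiff g u0 y ->
  exists2 m, subdiff theta 0 m & (forall h, inner y h = inner m ('d Xi u0 h)) /\
    theta (Xi u0) = (inner m (Xi u0))%:E.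
Proof.
move=> so c0 gnear sy.
have tc := sublinear_lsc_convex tp tl ts.
have [C C0 hC] := second_order_remainder so.
have [_ _ _ /(_ 1 ltr01) hd] := so.
have [k k0 hk] := linear_lipschitz (@findim_linear_continuous _ _ _ ('d Xi u0)).
have [r1 /= r10 hr1] := proj1 nbhs_norm0P (filterI gnear (filterI hC hd)).
pose r := r1 / 2.
have r0 : 0 < r by rewrite divr_gt0.
pose K := [set u : Y | `|u - u0| <= r].
have inK u : K u -> [/\ g u = (g0%:E + theta (Xi u))%E, inj_on_diff c u,
   `|Xi u - Xi u0| <= C * `|u - u0|, (forall v, `|'d Xi u v - 'd Xi u0 v| <= C * `|u - u0| * `|v|) &
   differentiable Xi u].
  rewrite /K /= => ur; have : `|u - u0| < r1 by apply: le_lt_trans ur _; rewrite /r; lra.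
  have uE : u0 + (u - u0) = u by vec.
  by move=> /hr1 /=; rewrite uE => -[[? ?] [[_ ? ?] [? _]]].
have Xc u : K u -> {for u, continuous Xi}.
  by move=> /inK[_ _ _ _]; exact: differentiable_continuous.
have [gu0 _] := sy.
have Ku0 : K u0 by rewrite /K /= subrr normr0 ltW.
have gE0 : g u0 = (g0%:E + theta (Xi u0))%E by have [] := inK _ Ku0.
have tu0 : theta (Xi u0) \is a fin_num.
  by move: gu0; rewrite gE0; case: (theta _).
have [q qE] := fin_num_real tu0.
pose rho (n : nat) : R := n.+1%:R.
have rho0 n : 0 < rho n by rewrite ltr0n.
(* The quadratic term makes u0 the only possible limit of the minimisers. *)
pose F n u := env theta (rho n) (Xi u) - inner y u + 2^-1 * `|u - u0| ^+ 2.
have dF n u : K u -> has_diff (F n) u (fun h =>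
    inner (rho n *: (Xi u - proxr theta (rho n) (Xi u))) ('d Xi u h) - inner y h + inner (u - u0) h).
  move=> Ku; have [_ _ _ _ dX] := inK _ Ku.
  apply: has_diffD (diff_half_sqr u0 u); apply: has_diffB (diff_inner y u).
  exact: (has_diff_comp (conj dX (fun _ => erefl)) (env_diff tc (Xi u) (rho0 n))).
have cF n : {within K, continuous (F n)}.
  apply: continuous_in_subspaceT => u; rewrite inE => Ku.
  by have [/differentiable_continuous] := dF n u Ku.
have cK : compact K by exact: compact_closed_ball.
have hmin n : exists u, K u /\ forall u', K u' -> F n u <= F n u'.
  have [u uK umin] := compact_EVT_min (ex_intro _ _ Ku0) cK (cF n).
  exists u; split; first by move: uK; rewrite inE.
  by move=> u' Ku'; apply: umin; rewrite inE.
have [u hu] := choice hmin.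
have uK n : K (u n) by case: (hu n).
have umin n u' : K u' -> F n (u n) <= F n u' by case: (hu n) => _; exact.
pose p n := proxr theta (rho n) (Xi (u n)).
pose m n := rho n *: (Xi (u n) - p n).
have sm n : subdiff theta (p n) (m n) by exact: proxr_subdiff.
have mC n : subdiff theta 0 (m n) by have [] := subdiff_sublinear tp tl ts (sm n).
have mp n : theta (p n) = (inner (m n) (p n))%:E by have [] := subdiff_sublinear tp tl ts (sm n).
have F0 n : F n u0 <= q - inner y u0.
  rewrite /F subrr normr0 expr0n mulr0 addr0 lerD2r.
  by have := env_le tc (Xi u0) (rho0 n) tu0; rewrite subrr normr0 expr0n mulr0 addr0 qE.
have key n : inner (m n) (p n) + 2^-1 * rho n * `|Xi (u n) - p n| ^+ 2 <=
   q + inner y (u n - u0) - 2^-1 * `|u n - u0| ^+ 2.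
  have := le_trans (umin n u0 Ku0) (F0 n); rewrite /F /env -/(p n) mp /= innerBr; lra.
have unorm n : `|u n| <= `|u0| + r.
  by rewrite -[u n](subrK u0) (le_trans (ler_normD _ _)) // addrC lerD2l; exact: uK.
have [s1 [ul [s1n ulc]]] := bounded_subsequence unorm.
have ep : (fun n => Xi (u n) - p n) @ \oo --> (0 : Z).
  have [_ _ _ [a [b [b0 hab]]]] := tc.
  (* With e = |Xi u - p|, the linear minorant of theta costs a term b e <= e^2 / 4 + b^2; since e^2
     <= rho e^2, what remains of [key] is rho e^2 <= 4 T. *)
  pose T := `|q| + `|y| * r + `|a| + b * (`|Xi u0| + C * r) + b ^+ 2.
  have eT n : `|Xi (u n) - p n| ^+ 2 <= 4 * T * n.+1%:R^-1.
    have := hab (p n); rewrite mp lee_fin => h1.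
    have [_ _ hX _ _] := inK _ (uK n).
    have h2 : `|p n| <= `|Xi u0| + C * r + `|Xi (u n) - p n|.
      rewrite (_ : `|p n| = `|Xi u0 + (Xi (u n) - Xi u0) - (Xi (u n) - p n)|); last by congr (`| _ |); vec.
      rewrite (le_trans (ler_normB _ _)) // lerD2r (le_trans (ler_normD _ _)) // lerD2l.
      by rewrite (le_trans hX) // ler_pM2l //; exact: uK.
    have h3 : inner y (u n - u0) <= `|y| * r.
      by rewrite (le_trans (inner_le _ _)) // ler_wpM2l //; exact: uK.
    have h4 := key n.
    have h5 := ler_wpM2l b0 h2.
    have h6 := sqr_ge0 (2^-1 * `|Xi (u n) - p n| - b).
    have h7 := ler_norm q.
    have h8 := ler_norm a.
    have h9 := sqr_ge0 `|u n - u0|.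
    set e := `|Xi (u n) - p n| in h2 h4 h5 h6 *.
    have h10 : e ^+ 2 <= rho n * e ^+ 2 by rewrite ler_peMl ?sqr_ge0 // ler1n.
    have hT : rho n * e ^+ 2 <= 4 * T by rewrite /T; lra.
    by rewrite ler_pdivlMr // mulrC.
  apply/cvgr0Pnorm_lt => e e0; near=> n.
  rewrite -ltr_sqr ?nnegrE // ?ltW //.
  apply: le_lt_trans (eT n) _; near: n.
  have : (fun n => 4 * T * n.+1%:R^-1) @ \oo --> 4 * T * (0 : R).
    by apply: cvgMr; exact: cvg_harmonic.
  by rewrite mulr0 => /cvgr_lt; apply; rewrite exprn_gt0.
have Kul : K ul.
  have cKl : closed K by exact: closed_norm_le.
  by apply: (@closed_cvg _ _ \oo _ (u \o s1) K cKl _ ul ulc); apply: nearW => n; exact: uK.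
have Xul : (fun n => Xi (u (s1 n))) @ \oo --> Xi ul.
  exact: (continuous_cvg _ (Xc _ Kul) ulc).
have pul : (p \o s1) @ \oo --> Xi ul.
  have -> : p \o s1 = fun n => Xi (u (s1 n)) - (Xi (u (s1 n)) - p (s1 n)).
    by apply/funext => n /=; vec.
  rewrite -[X in _ --> X]subr0; apply: cvgB => //.
  exact: (cvg_subseq s1n ep).
have tul : (theta (Xi ul) <= (q + inner y (ul - u0) - 2^-1 * `|ul - u0| ^+ 2)%:E)%E.
  apply: (@lsc_cvg_le _ _ theta (p \o s1) _
    (fun n => q + inner y (u (s1 n) - u0) - 2^-1 * `|u (s1 n) - u0| ^+ 2)) => //.
    apply: cvgB.
      apply: cvgD; first exact: cvg_cst.
      by apply: continuous_inner; [exact: cvg_cst|apply: cvgB => //; exact: cvg_cst].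
    apply: cvgMr; rewrite expr2; under eq_fun do rewrite expr2.
    by apply: cvgM; apply: cvg_norm; apply: cvgB => //; exact: cvg_cst.
  move=> n /=; rewrite mp lee_fin; apply: le_trans (key (s1 n)).
  by rewrite lerDl mulr_ge0 ?sqr_ge0 // mulr_ge0 // ltW.
(* The subgradient inequality for y at u0 is the reverse of [tul] without the square, which is
   therefore zero. *)
have ulE : ul = u0.
  have [gul _ _ _ _] := inK _ Kul.
  have [t tE] : exists t, theta (Xi ul) = t%:E.
    apply: fin_num_real; have [tN _] := tp; have := tN (Xi ul).
    by move: tul; case: (theta _).
  have gulf : g ul \is a fin_num by rewrite gul tE.
  have := subdiff_le sy gulf; rewrite gE0 gul tE qE /=.
  move: tul; rewrite tE lee_fin => h1 h2.
  have : `|ul - u0| ^+ 2 <= 0 by lra.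
  by rewrite exprn_even_le0 //= normr_eq0 subr_eq0 => /eqP.
have ulr : \forall n \near \oo, `|u (s1 n) - u0| < r.
  rewrite ulE in ulc.
  have /cvgrPdist_lt /(_ r r0) := ulc.
  by apply: filterS => n /=; rewrite distrC.
have [N _ hN] := ulr.
pose s2 n := s1 (n + N)%N.
have s2n n : (n <= s2 n)%N by apply: leq_trans (s1n _); rewrite leq_addr.
have us2 : (u \o s2) @ \oo --> u0.
  have hNn n : (n <= n + N)%N by rewrite leq_addr.
  rewrite -ulE; exact: (cvg_subseq hNn ulc).
have statio n h : inner (m (s2 n)) ('d Xi (u (s2 n)) h) = inner (y - (u (s2 n) - u0)) h.
  have ur : `|u (s2 n) - u0| < r by apply: hN => /=; rewrite leq_addl.
  have [dFu dFE] := dF (s2 n) _ (uK (s2 n)).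
  have h1 : 0 < `|h| + 1 by rewrite ltr_wpDl.
  have d0 : 0 < (r - `|u (s2 n) - u0|) / (`|h| + 1) by rewrite divr_gt0 // subr_gt0.
  have stat : 'd (F (s2 n)) (u (s2 n)) h = 0; last first.
    by move: stat; rewrite dFE -/(p _) -/(m _) (innerBl y); lra.
  apply: (diff_min0 dFu d0).
  move=> t ht; apply: umin; rewrite /K /=.
  have -> : u (s2 n) + t *: h - u0 = (u (s2 n) - u0) + t *: h by rewrite addrAC.
  rewrite (le_trans (ler_normD _ _)) // normrZ -lerBrDl.
  apply: (@le_trans _ _ (`|t| * (`|h| + 1))); first by rewrite ler_wpM2l // lerDl.
  by rewrite -ler_pdivlMr // ltW.
have [||||||Mm hMm] := @bounded_multiplier_cvg u0 c (k + C * r) (u \o s2)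
   (fun n => y - (u (s2 n) - u0)) (m \o s2) (`|y| + r) c0.
- by move=> n; have [] := inK _ (uK (s2 n)).
- move=> n h; have [_ _ _ hX _] := inK _ (uK (s2 n)).
  rewrite -['d Xi _ h](subrK ('d Xi u0 h)) (le_trans (ler_normD _ _)) // addrC mulrDl lerD //.
  rewrite (le_trans (hX h)) // ler_wpM2r // ler_pM2l //; exact: uK.
- by rewrite addr_ge0 ?mulr_ge0 // ltW.
- by move=> n; exact: mC.
- exact: statio.
- by move=> n; rewrite (le_trans (ler_normB _ _)) // lerD2l; exact: uK.
have [s3 [ml [s3n mlc]]] := bounded_subsequence hMm.
have us3 : (fun n => u (s2 (s3 n))) @ \oo --> u0 := cvg_subseq s3n us2.
have ps3 : (fun n => p (s2 (s3 n))) @ \oo --> Xi u0.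
  have X0 : (fun n => Xi (u (s2 (s3 n)))) @ \oo --> Xi u0.
    exact: (continuous_cvg _ (Xc _ Ku0) us3).
  have e0 : (fun n => Xi (u (s2 (s3 n))) - p (s2 (s3 n))) @ \oo --> (0 : Z).
    have hs n : (n <= (s2 \o s3) n)%N by exact: leq_trans (s3n n) (s2n _).
    exact: (cvg_subseq hs ep).
  have -> : (fun n => p (s2 (s3 n))) = fun n => Xi (u (s2 (s3 n))) - (Xi (u (s2 (s3 n))) - p (s2 (s3 n))).
    by apply/funext => n /=; vec.
  by rewrite -[X in _ --> X]subr0; apply: cvgB.
have mlC : subdiff theta 0 ml.
  by apply: (subdiff_sublinear0_closed tp tl ts _ mlc) => n; exact: mC.
exists ml => //; split.
  move=> h.
  have dX : (fun n => 'd Xi (u (s2 (s3 n))) h) @ \oo --> 'd Xi u0 h.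
    apply/cvgrPdist_lt => e e0; near=> n; rewrite distrC.
    have [_ _ _ hX _] := inK _ (uK (s2 (s3 n))).
    apply: le_lt_trans (hX h) _.
    have ch : 0 < C * (`|h| + 1) by rewrite mulr_gt0 // ltr_wpDl.
    apply: (@le_lt_trans _ _ (`|u (s2 (s3 n)) - u0| * (C * (`|h| + 1)))).
      rewrite (mulrC C) -mulrA ler_wpM2l // ler_pM2l // lerDl //.
    rewrite -ltr_pdivlMr // distrC; near: n; apply: cvgr_dist_lt => //.
    by rewrite divr_gt0 // mulr_gt0 // ltr_wpDl.
  have l1 : (fun n => inner (m (s2 (s3 n))) ('d Xi (u (s2 (s3 n))) h)) @ \oo --> inner ml ('d Xi u0 h).
    exact: continuous_inner.
  have l2 : (fun n => inner (y - (u (s2 (s3 n)) - u0)) h) @ \oo --> inner y h.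
    apply: continuous_inner; last exact: cvg_cst.
    rewrite -[X in _ --> X]subr0 -(subrr u0).
    by apply: cvgB; [exact: cvg_cst|apply: cvgB => //; exact: cvg_cst].
  have E : (fun n => inner (m (s2 (s3 n))) ('d Xi (u (s2 (s3 n))) h)) =
           (fun n => inner (y - (u (s2 (s3 n)) - u0)) h).
    by apply/funext => n; exact: statio.
  by rewrite E in l1; exact: cvg_unique l2 l1.
apply/eqP; rewrite eq_le; apply/andP; split.
  apply: (@lsc_cvg_le _ _ theta _ _ (fun n => inner (m (s2 (s3 n))) (p (s2 (s3 n)))) _ tl ps3).
    exact: continuous_inner.
  by move=> n; rewrite mp.
by move/(subdiff_sublinear0 tp tl ts): mlC; exact.
Unshelve. all: by end_near.
Qed.

End ChainRule.

(** In [decomposable_star], p and q are the derivatives of Xi in the direction w at the moving and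
    at the fixed point, and s is the value of Xi. The right side is then nonnegative: m attains
    theta at s, while mh is one of the forms below theta. *)
Lemma multiplier_quotient (R : realType) (Z : finHilbertType R) (t : R) (m mh p q s : Z) : t != 0 ->
  t^-1 * (inner m p - inner mh q) - (inner m (t^-1 *: (p - q) - (t ^+ 2)^-1 *: (s - t *: q)) +
    inner mh ((t ^+ 2)^-1 *: (s - t *: q))) = (t ^+ 2)^-1 * (inner m s - inner mh s).
Proof. by move=> t0; rewrite !(innerBr, innerZr); field. Qed.

(** * A second-order chain rule for decomposable functions *)

Section DecomposableStar.
Context {R : realType} {Y Z : finHilbertType R}.
Context (g : Y -> \bar R) (theta : Z -> \bar R) (Xi : Y -> Z) (O : set Y) (ubar : Y).
Hypotheses (gN : forall u, g u != -oo%E) (gconv : econvex g) (dec : C2_decomposition g ubar O theta Xi)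
  (nd : nondegenerate_at ubar theta Xi).

Let tp : eproper theta. Proof. by case: dec => _ _ []. Qed.
Let tl : lower_semicontinuous theta. Proof. by case: dec => _ _ []. Qed.
Let ts : sublinear theta. Proof. by case: dec => _ _ []. Qed.
Let Xi0 : Xi ubar = 0. Proof. by case: dec => _ _ _ []. Qed.
Let Oubar : open_nbhs ubar O. Proof. by case: dec. Qed.
Let gO u : O u -> g u = (g ubar + theta (Xi u))%E. Proof. by case: dec => _ _ _ _; exact. Qed.
Let XiC2 : C2_on O Xi. Proof. by case: dec => _ _ _ []. Qed.

(** Compactness of the unit sphere of the parallel space: failing unit vectors would converge to a
    unit vector of that space in the kernel of the adjoint. *)
Lemma nondegenerate_inj : exists2 c : R, 0 < c & forall z k, par (subdiff theta 0) z -> 0 <= k ->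
  (forall h, inner z ('d Xi ubar h) <= k * `|h|) -> c * `|z| <= k.
Proof.
pose P := par (subdiff theta 0).
(* Nondegeneracy is an equality of sets, so it also provides 0 in the parallel space, and with it a
   point of the affine hull. *)
have P0 : P 0.
  have : [set 0] (0 : Z) by [].
  by rewrite -nd /= Xi0 => -[].
have [a Ca] : exists a, aff (subdiff theta 0) a by case: P0 => a Ca _; exists a.
have aA : affine_set (aff (subdiff theta 0)) := affine_aff (A:=_).
have PE : P = [set h | aff (subdiff theta 0) (a + h)] := parE Ca.
have Pc : closed P by rewrite PE; exact: affine_direction_closed.
have PZ t z : P z -> P (t *: z) by rewrite PE; exact: affine_directionZ.
apply: contrapT => hno.
have hn (n : nat) : exists z, [/\ P z, `|z| = 1 & forall h, inner z ('d Xi ubar h) <= n.+1%:R^-1 * `|h|].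
  apply: contrapT => hnn; apply: hno; exists n.+1%:R^-1; first by rewrite invr_gt0.
  move=> z k Pz k0 hz; rewrite leNgt; apply/negP => kz.
  have z0 : 0 < `|z|.
    rewrite normr_gt0; apply/eqP => z0; move: kz; rewrite z0 normr0 mulr0 ltNge k0 //.
  apply: hnn; exists (`|z|^-1 *: z); split.
  - exact: PZ.
  - by rewrite normrZ normfV normr_id mulVf // gt_eqF.
  - move=> h; rewrite innerZl ler_pdivrMl // (le_trans (hz h)) // mulrA ler_wpM2r //.
    by rewrite mulrC ltW.
have [z hz] := choice hn.
have zn n : `|z n| <= 1 by have [_ -> _] := hz n.
have [s [l [sn sl]]] := bounded_subsequence zn.
have Pl : P l.
  apply: (@closed_cvg _ _ \oo _ (z \o s) P Pc _ l sl); apply: nearW => n.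
  by have [] := hz (s n).
have l1 : `|l| = 1.
  have h1 : (fun n => `|(z \o s) n|) @ \oo --> `|l| by exact: cvg_norm.
  have E : (fun n => `|(z \o s) n|) = (fun=> 1) by apply/funext => n; have [_ -> _] := hz (s n).
  by rewrite E in h1; exact: cvg_unique h1 (cvg_cst _).
have le0 h : inner l ('d Xi ubar h) <= 0.
  have h1 : (fun n => inner ((z \o s) n) ('d Xi ubar h)) @ \oo --> inner l ('d Xi ubar h).
    by apply: continuous_inner => //; exact: cvg_cst.
  have h2 : (fun n => n.+1%:R^-1 * `|h|) @ \oo --> 0 * `|h|.
    by apply: cvgMl; exact: cvg_harmonic.
  rewrite mul0r in h2.
  apply: (ler_cvg_to h1 h2); apply: nearW => n.
  have [_ _ /(_ h) /= hh] := hz (s n); apply: le_trans hh _.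
  by rewrite ler_wpM2r // lef_pV2 ?posrE // ler_nat ltnS.
have : [set 0] l.
  rewrite -nd /= Xi0; split => //; apply: inner_eq0 => h; rewrite adjointE.
  apply/eqP; rewrite eq_le le0 /=.
  by have := le0 (- h); rewrite linearN innerNr oppr_le0.
by move=> /= l0; move: l1; rewrite l0 normr0 => /eqP; rewrite eq_sym oner_eq0.
Qed.

Lemma inj_on_diff_near : exists2 c : R, 0 < c & \forall h \near 0, inj_on_diff theta Xi c (ubar + h).
Proof.
have [c c0 hc] := nondegenerate_inj.
have [B so] := C2_second_order XiC2 Oubar.
have [C C0 hC] := second_order_bound so.
exists (c / 2); first by rewrite divr_gt0.
near=> h => m m' k mC m'C k0 hk.
have Pm : par (subdiff theta 0) (m - m').
  by exists m; [exact: sub_aff|exists m' => //; exact: sub_aff].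
have dX : forall v, `|'d Xi (ubar + h) v - 'd Xi ubar v| <= C * `|h| * `|v| by near: h.
have hs : C * `|h| <= c / 2.
  rewrite -ler_pdivlMl //; near: h; apply: nbhs0_le; by rewrite mulr_gt0 ?invr_gt0 ?divr_gt0.
have : c * `|m - m'| <= k + c / 2 * `|m - m'|.
  apply: hc => //; first by rewrite addr_ge0 ?mulr_ge0 ?divr_ge0 // ltW.
  move=> v.
  have -> : 'd Xi ubar v = 'd Xi (ubar + h) v - ('d Xi (ubar + h) v - 'd Xi ubar v) by vec.
  rewrite innerBr mulrDl lerD // -innerNr (le_trans (inner_le _ _)) // normrN.
  rewrite (mulrC (c / 2)) -mulrA ler_wpM2l // (le_trans (dX v)) // ler_wpM2r //.
lra.
Unshelve. all: by end_near.
Qed.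

(** The representation of g is local, but convexity carries an estimate at ubar + s v, s small, over
    to ubar + v. The curvature of Xi contributes an error of order s^2, which disappears after
    division by s. *)
Lemma decomposable_subdiff (m : Z) : subdiff theta 0 m -> subdiff g ubar (adjoint ('d Xi ubar) m).
Proof.
move=> mC; have gfin : g ubar \is a fin_num by case: dec.
have [g0 g0E] := fin_num_real gfin.
split => // u; have := gN u; case gu : (g u) => [q| |] // _; last by rewrite leey.
rewrite g0E -EFinD lee_fin adjointE -subr_ge0.
have [B so] := C2_second_order XiC2 Oubar.
have [C C0 hC] := second_order_remainder so.
have nO : \forall h \near 0, O (ubar + h).
  have : (fun h => ubar + h) @ (0 : Y) --> ubar.
    by rewrite -[X in _ --> X]addr0; apply: cvgD; [exact: cvg_cst|exact: cvg_id].
  by apply; exact: open_nbhs_nbhs.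
have [r /= r0 hr] := proj1 nbhs_norm0P (filterI hC nO).
set v := u - ubar.
have v1 : 0 < `|v| + 1 by rewrite ltr_wpDl.
apply: (@lin_quad_near _ _ (`|m| * (C * `|v| ^+ 2)) (Num.min 1 (r / (`|v| + 1)))).
  by rewrite lt_min ltr01 divr_gt0.
move=> s /andP[s0]; rewrite lt_min => /andP[s1 sr].
have svr : `|s *: v| < r.
  rewrite normrZ gtr0_norm //; apply: (@le_lt_trans _ _ (s * (`|v| + 1))).
    by apply: ler_wpM2l; [exact: ltW|rewrite lerDl].
  by rewrite -ltr_pdivlMr.
have /= [[hX _ _] Os] := hr _ svr.
have s01 : 0 < s < 1 by rewrite s0.
have := gconv u ubar s01.
have -> : s *: u + (1 - s) *: ubar = ubar + s *: v by rewrite /v; vec.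
rewrite gu g0E (gO Os) g0E -!EFinM -EFinD.
have := (proj1 (subdiff_sublinear0 tp tl ts m)) mC (Xi (ubar + s *: v)).
case: (theta _) => [th| |] //; rewrite -EFinD !lee_fin => h1 h2.
have dZ : 'd Xi ubar (s *: v) = s *: 'd Xi ubar v by rewrite linearZ.
have h3 : inner m (s *: 'd Xi ubar v) - `|m| * (C * `|s *: v| ^+ 2) <= inner m (Xi (ubar + s *: v)).
  have -> : Xi (ubar + s *: v) = s *: 'd Xi ubar v + (Xi (ubar + s *: v) - Xi ubar - 'd Xi ubar (s *: v)).
    by rewrite dZ Xi0; vec.
  rewrite innerDr lerD2l -lerNl -[leLHS]innerNr (le_trans (inner_le _ _)) // normrN ler_wpM2l //.
move: h3; rewrite innerZr normrZ exprMn real_normK ?num_real // => h3.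
lra.
Qed.

(** Subgradients at the moving and at the fixed points are written with multipliers [mk] and [mhk];
    injectivity bounds both and gives them the same limit ml. The number <ml, B om om> then
    separates the two sides: it is at most <eta, om> by [multiplier_quotient], and at least the
    semi-strict second subderivative. *)
Lemma decomposable_star (ybar om eta : Y) :
  subdiff g ubar ybar -> semistable g ubar ybar ->
  semistrict_graphical_deriv (subdiff g) ubar ybar om eta ->
  (subderiv2 g ubar ybar om <= (inner eta om)%:E)%E.
Proof.
move=> sy ss hst.
have crit := semistrict_graphical_deriv_crit sy hst.
(* Semi-stability makes it enough to bound a liminf in which the subgradient may vary. *)
rewrite -(ss _ crit).
have [t [uk0 [yk0 [zk0 [t0 [uku yky zky] hF wk etak]]]]] := hst.
have [c c0 hc] := inj_on_diff_near.
have [B so] := C2_second_order XiC2 Oubar.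
have [lB1 lB2 [KB KB0 hKB] _] := so.
have [C C0 hC] := second_order_remainder so.
have [L L0 hL] := linear_lipschitz (@findim_linear_continuous _ _ _ ('d Xi ubar)).
have [gu _] := sy; have [g0 g0E] := fin_num_real gu.
have OO : open O by case: Oubar.
have nO : \forall h \near 0, O (ubar + h).
  have : (fun h => ubar + h) @ (0 : Y) --> ubar.
    by rewrite -[X in _ --> X]addr0; apply: cvgD; [exact: cvg_cst|exact: cvg_id].
  by apply; exact: open_nbhs_nbhs.
have [r /= r0 hr] := proj1 nbhs_norm0P (filterI hC (filterI hc nO)).
have hr' u : `|u - ubar| < r -> [/\ O u, inj_on_diff theta Xi c u &
     forall v, `|'d Xi u v - 'd Xi ubar v| <= C * `|u - ubar| * `|v|].
  have uE : ubar + (u - ubar) = u by vec.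
  by move=> /hr /=; rewrite uE => -[[_ _ ?] [? ?]].
have CR u y : `|u - ubar| < r -> subdiff g u y -> exists m, [/\ subdiff theta 0 m,
    forall h, inner y h = inner m ('d Xi u h) & theta (Xi u) = (inner m (Xi u))%:E].
  move=> ur sgu; have [Ou _ _] := hr' u ur.
  have [B0 so0] := @C2_second_order _ _ _ Xi O u XiC2 (conj OO Ou).
  have [|m mC [my mt]] := @chain_rule _ _ _ g theta Xi g0 tp tl ts u y B0 c so0 c0 _ sgu; last by exists m.
  near=> h.
  have uhr : `|u + h - ubar| < r.
    have -> : u + h - ubar = (u - ubar) + h by rewrite addrAC.
    rewrite (le_lt_trans (ler_normD _ _)) // -ltrBrDl.
    by near: h; apply: nbhs0_lt; rewrite subr_gt0.
  by have [Ouh ih _] := hr' _ uhr; split => //; rewrite -g0E; exact: gO.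
have [N _ hN] : \forall n \near \oo, `|uk0 n - ubar| < r.
  by have /cvgrPdist_lt /(_ r r0) := uku; apply: filterS => n; rewrite distrC.
have N1 n : (n <= n + N)%N by rewrite leq_addr.
have ukr n : `|uk0 (n + N)%N - ubar| < r by apply: hN => /=; rewrite leq_addl.
have ubr : `|ubar - ubar| < r by rewrite subrr normr0.
have [m hm] := choice (fun n => CR _ _ (ukr n) (proj1 (hF (n + N)%N))).
have [mh hmh] := choice (fun n => CR _ _ ubr (proj2 (hF (n + N)%N))).
have bnd (v : nat -> Y) (l : Y) : v @ \oo --> l -> exists M, forall n, `|v n| <= M.
  move=> vl; have : bounded_fun v by apply: cvg_seq_bounded; apply/cvg_ex; exists l.
  move=> [M [_ hM]]; exists (M + 1) => n; apply: hM => //; by rewrite ltrDl.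
have [My hMy] := bnd _ _ yky.
have [Mz hMz] := bnd _ _ zky.
have LC0 : 0 <= L + C * r by rewrite addr_ge0 ?mulr_ge0 // ltW.
have dXb u h : `|u - ubar| < r -> `|'d Xi u h| <= (L + C * r) * `|h|.
  move=> ur; have [_ _ hX] := hr' u ur.
  rewrite -['d Xi u h](subrK ('d Xi ubar h)) (le_trans (ler_normD _ _)) // addrC mulrDl lerD //.
  by rewrite (le_trans (hX h)) // ler_wpM2r // ler_pM2l // ltW.
have [||||||Mm hMm] := @bounded_multiplier_cvg _ _ _ theta Xi ubar c (L + C * r) (fun n => uk0 (n + N)%N)
   (fun n => yk0 (n + N)%N) m My c0.
- by move=> n; have [] := hr' _ (ukr n).
- by move=> n h; exact: dXb.
- by [].
- by move=> n; have [] := hm n.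
- by move=> n h; have [_ ->] := hm n.
- by move=> n; exact: hMy.
have [||||||Mh hMh] := @bounded_multiplier_cvg _ _ _ theta Xi ubar c (L + C * r) (fun n => ubar)
   (fun n => zk0 (n + N)%N) mh Mz c0.
- by move=> n; have [] := hr' _ ubr.
- by move=> n h; exact: dXb.
- by [].
- by move=> n; have [] := hmh n.
- by move=> n h; have [_ ->] := hmh n.
- by move=> n; exact: hMz.
have [s1 [ml [s1n mlc]]] := bounded_subsequence hMm.
have [s2 [mhl [s2n mhlc]]] := bounded_subsequence (fun n => hMh (s1 n)).
pose s n := (s1 (s2 n) + N)%N.
have sn n : (n <= s n)%N by rewrite (leq_trans (s2n n)) // (leq_trans (s1n _)) // N1.
pose tk := t \o s; pose uk := uk0 \o s; pose yk := yk0 \o s; pose zk := zk0 \o s.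
pose mk n := m (s1 (s2 n)); pose mhk n := mh (s1 (s2 n)).
have mkl : mk @ \oo --> ml := cvg_subseq s2n mlc.
have mhkl : mhk @ \oo --> mhl by exact: mhlc.
have tk0 : down0 tk := down0_subseq sn t0.
have tkp n : 0 < tk n by case: tk0.
have ukl : uk @ \oo --> ubar := cvg_subseq sn uku.
have ykl : yk @ \oo --> ybar := cvg_subseq sn yky.
have zkl : zk @ \oo --> ybar := cvg_subseq sn zky.
have ukr' n : `|uk n - ubar| < r by exact: ukr.
pose w n := (tk n)^-1 *: (uk n - ubar).
have wl : w @ \oo --> om := cvg_subseq sn wk.
pose et n := (tk n)^-1 *: (yk n - zk n).
have etl : et @ \oo --> eta := cvg_subseq sn etak.
have ukE n : uk n = ubar + tk n *: w n by rewrite /w scalerA divff ?gt_eqF // scale1r addrC subrK.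
have mkC n : subdiff theta 0 (mk n) by have [] := hm (s1 (s2 n)).
have mky n h : inner (yk n) h = inner (mk n) ('d Xi (uk n) h) by have [_ ->] := hm (s1 (s2 n)).
have mkt n : theta (Xi (uk n)) = (inner (mk n) (Xi (uk n)))%:E by have [_ _ ->] := hm (s1 (s2 n)).
have mhkC n : subdiff theta 0 (mhk n) by have [] := hmh (s1 (s2 n)).
have mhky n h : inner (zk n) h = inner (mhk n) ('d Xi ubar h) by have [_ ->] := hmh (s1 (s2 n)).
have dXk h (v : nat -> Y) : v @ \oo --> h -> (fun n => 'd Xi (uk n) (v n)) @ \oo --> 'd Xi ubar h.
  move=> vh.
  have l1 : (fun n => 'd Xi ubar (v n)) @ \oo --> 'd Xi ubar h.
    exact: (continuous_cvg _ (@findim_linear_continuous _ _ _ ('d Xi ubar) h) vh).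
  have l2 : (fun n => 'd Xi (uk n) (v n) - 'd Xi ubar (v n)) @ \oo --> (0 : Z).
    apply/norm_cvg0P.
    have l3 : (fun n => C * `|uk n - ubar| * `|v n|) @ \oo --> C * `|ubar - ubar| * `|h|.
      apply: cvgM; last exact: cvg_norm.
      by apply: cvgMr; apply: cvg_norm; apply: cvgB => //; exact: cvg_cst.
    rewrite subrr normr0 mulr0 mul0r in l3.
    apply: (squeeze_cvgr _ (cvg_cst 0) l3); apply: nearW => n.
    by rewrite normr_ge0 /=; have [_ _ hX] := hr' _ (ukr' n).
  have -> : (fun n => 'd Xi (uk n) (v n)) = (fun n => ('d Xi (uk n) (v n) - 'd Xi ubar (v n)) + 'd Xi ubar (v n)).
    by apply/funext => n; rewrite subrK.
  by rewrite -[X in _ --> X]add0r; apply: cvgD.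
have mlE : mhl = ml.
  have mlC : subdiff theta 0 ml by apply: (subdiff_sublinear0_closed tp tl ts _ mkl).
  have mhlC : subdiff theta 0 mhl by apply: (subdiff_sublinear0_closed tp tl ts _ mhkl).
  have [_ inju _] := hr' _ ubr.
  have : c * `|mhl - ml| <= 0.
    apply: inju => // h; rewrite mul0r innerBl.
    have e1 : inner ybar h = inner ml ('d Xi ubar h).
      have l1 : (fun n => inner (mk n) ('d Xi (uk n) h)) @ \oo --> inner ml ('d Xi ubar h).
        by apply: continuous_inner => //; apply: dXk; exact: cvg_cst.
      have l2 : (fun n => inner (yk n) h) @ \oo --> inner ybar h.
        by apply: continuous_inner => //; exact: cvg_cst.
      have E : (fun n => inner (yk n) h) = (fun n => inner (mk n) ('d Xi (uk n) h)) by apply/funext => n.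
      by rewrite E in l2; exact: cvg_unique l2 l1.
    have e2 : inner ybar h = inner mhl ('d Xi ubar h).
      have l1 : (fun n => inner (mhk n) ('d Xi ubar h)) @ \oo --> inner mhl ('d Xi ubar h).
        by apply: continuous_inner => //; exact: cvg_cst.
      have l2 : (fun n => inner (zk n) h) @ \oo --> inner ybar h.
        by apply: continuous_inner => //; exact: cvg_cst.
      have E : (fun n => inner (zk n) h) = (fun n => inner (mhk n) ('d Xi ubar h)) by apply/funext => n.
      by rewrite E in l2; exact: cvg_unique l2 l1.
    by rewrite -e1 -e2 subrr.
  by rewrite pmulr_rle0 // normr_le0 subr_eq0 => /eqP.
rewrite mlE in mhkl.
pose r1 n := (tk n ^+ 2)^-1 *: (Xi (uk n) - 'd Xi ubar (tk n *: w n)).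
pose r2 n := (tk n)^-1 *: ('d Xi (uk n) (w n) - 'd Xi ubar (w n)).
have r1l : r1 @ \oo --> 2^-1 *: B om om.
  have -> : r1 = (fun n => (tk n ^+ 2)^-1 *: (Xi (ubar + tk n *: w n) - Xi ubar - 'd Xi ubar (tk n *: w n))).
    by apply/funext => n; rewrite /r1 Xi0 subr0 -ukE.
  by have := taylor2_quotient_cvg tk0 wl so.
have r2l : r2 @ \oo --> B om om.
  have -> : r2 = (fun n => (tk n)^-1 *: ('d Xi (ubar + tk n *: w n) (w n) - 'd Xi ubar (w n))).
    by apply/funext => n; rewrite /r2 -ukE.
  by have := diff_quotient_cvg tk0 wl so wl.
have lim1 : (fun n => inner (mk n) (r2 n - r1 n) + inner (mhk n) (r1 n)) @ \oo --> inner ml (B om om).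
  have -> : inner ml (B om om) = inner ml (B om om - 2^-1 *: B om om) + inner ml (2^-1 *: B om om).
    by rewrite -innerDr subrK.
  apply: cvgD; apply: continuous_inner => //; exact: cvgB.
have ineq1 : inner ml (B om om) <= inner eta om.
  apply: (ler_cvg_to lim1 (continuous_inner etl wl)); apply: nearW => n.
  have tn0 : tk n != 0 by rewrite gt_eqF.
  rewrite -subr_ge0.
  have -> : inner (et n) (w n) - (inner (mk n) (r2 n - r1 n) + inner (mhk n) (r1 n)) =
     (tk n ^+ 2)^-1 * (inner (mk n) (Xi (uk n)) - inner (mhk n) (Xi (uk n))).
    have dZ : 'd Xi ubar (tk n *: w n) = tk n *: 'd Xi ubar (w n) by rewrite linearZ.
    by rewrite /et innerZl (innerBl (yk n)) mky mhky /r1 /r2 dZ multiplier_quotient.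
  rewrite mulr_ge0 ?invr_ge0 ?sqr_ge0 // subr_ge0 -lee_fin -mkt.
  by move/(subdiff_sublinear0 tp tl ts): (mhkC n); exact.
apply: (@le_trans _ _ (inner ml (B om om))%:E); last by rewrite lee_fin.
(* These subgradients at ubar carry the multipliers of the moving points, so the first-order terms
   match and the second-order quotient is exactly 2 <mk, r1>. *)
pose z n := adjoint ('d Xi ubar) (mk n).
have zE n h : inner (z n) h = inner (mk n) ('d Xi ubar h) by exact: adjointE.
have zl : z @ \oo --> ybar.
  have e1 h : inner ybar h = inner ml ('d Xi ubar h).
    have l1 : (fun n => inner (mk n) ('d Xi (uk n) h)) @ \oo --> inner ml ('d Xi ubar h).
      by apply: continuous_inner => //; apply: dXk; exact: cvg_cst.
    have l2 : (fun n => inner (yk n) h) @ \oo --> inner ybar h.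
      by apply: continuous_inner => //; exact: cvg_cst.
    have E : (fun n => inner (yk n) h) = (fun n => inner (mk n) ('d Xi (uk n) h)) by apply/funext => n.
    by rewrite E in l2; exact: cvg_unique l2 l1.
  apply/subr_cvg0/norm_cvg0P.
  have l3 : (fun n => L * `|mk n - ml|) @ \oo --> L * `|ml - ml|.
    by apply: cvgMr; apply: cvg_norm; apply: cvgB => //; exact: cvg_cst.
  rewrite subrr normr0 mulr0 in l3.
  apply: (squeeze_cvgr _ (cvg_cst 0) l3); apply: nearW => n; rewrite normr_ge0 /=.
  apply: norm_le_inner; first by rewrite mulr_ge0 // ltW.
  move=> h; rewrite innerBl zE e1 -innerBl (le_trans (inner_le _ _)) //.
  by rewrite (mulrC L) -mulrA ler_wpM2l.
have zs n : subdiff g ubar (z n) by exact: decomposable_subdiff.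
have lim2 : (fun n => 2 * inner (mk n) (r1 n)) @ \oo --> inner ml (B om om).
  have -> : inner ml (B om om) = 2 * inner ml (2^-1 *: B om om) by rewrite innerZr; field.
  by apply: cvgMr; exact: continuous_inner.
apply: (semistrict_subderiv2_le_cvg tk0 wl zl zs lim2); apply: nearW => n.
have Ouk : O (uk n) by have [] := hr' _ (ukr' n).
have gukE : g (ubar + tk n *: w n) = (g0 + inner (mk n) (Xi (uk n)))%:E.
  by rewrite -ukE (gO Ouk) g0E mkt.
rewrite (diff2_fin (z n) g0E gukE) lee_fin zE.
have tn0 : tk n != 0 by rewrite gt_eqF.
have dZ : 'd Xi ubar (tk n *: w n) = tk n *: 'd Xi ubar (w n) by rewrite linearZ.
rewrite /r1 dZ innerZr innerBr innerZr le_eqVlt; apply/orP; left; apply/eqP.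
by field.
Unshelve. all: by end_near.
Qed.

End DecomposableStar.

(** * Second-order regularity and stationarity *)

Section Star.
Context {R : realType} {Y : finHilbertType R} (g : Y -> \bar R) (ubar ybar : Y).

(** The alternative of hypothesis (ii); only [semistrict_graphical_deriv_ge] looks inside it. *)
Definition second_order_regular : Prop :=
  (exists (Z : finHilbertType R) (O : set Y) (theta : Z -> \bar R) (Xi : Y -> Z),
     C2_decomposition g ubar O theta Xi /\ nondegenerate_at ubar theta Xi) \/
  (twice_epi_differentiable g ubar ybar /\
   forall w : Y, semistrict_graphical_deriv (subdiff g) ubar ybar w =
     closure [set a - b | a in graphical_deriv (subdiff g) ubar ybar w &
                          b in polar (crit_cone g ubar ybar)]).

(** In the second case eta is a limit of elements a - b: <a, om> is bounded by [graphical_deriv_ge],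
    and <b, om> <= 0 because om is critical. The strict inequality to be refuted is open in eta, so
    it would hold for such an a - b. *)
Lemma semistrict_graphical_deriv_ge om eta :
  eproper g -> econvex g -> subdiff g ubar ybar -> semistable g ubar ybar ->
  second_order_regular -> semistrict_graphical_deriv (subdiff g) ubar ybar om eta ->
  (subderiv2 g ubar ybar om <= (inner eta om)%:E)%E.
Proof.
move=> gpr gconv sy ss hii hst; case: hii => [[Z [W [theta [Xi [dec nd]]]]]|[epi formula]].
  exact: (decomposable_star (proj1 gpr) gconv dec nd sy ss hst).
have crit := semistrict_graphical_deriv_crit sy hst.
rewrite leNgt; apply/negP => hlt.
move: hst; rewrite formula => hcl.
have nb : nbhs eta [set e | ((inner e om)%:E < subderiv2 g ubar ybar om)%E].
  case E : (subderiv2 g ubar ybar om) hlt => [D| |] //.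
    rewrite lte_fin => h.
    have : inner e om @[e --> eta] --> inner eta om.
      by apply: continuous_inner; [exact: cvg_id|exact: cvg_cst].
    by move=> /cvgr_lt /(_ _ h); apply: filterS => e /= he; rewrite lte_fin.
  by move=> _; apply: filterE => e; exact: ltry.
have [_ [[a ha [b hb <-]] /=]] := hcl _ nb.
rewrite ltNge => /negP; apply.
apply: le_trans (graphical_deriv_ge sy epi ha) _.
rewrite lee_fin innerBl lerBrDr gerDl.
exact: (hb om crit).
Qed.

End Star.

Section Problem.
Context {R : realType} {X Y : finHilbertType R}.
Variables (phi : X -> R) (Phi : X -> Y) (g : Y -> \bar R) (Theta : set X) (xbar : X) (ybar : Y).
Hypotheses (phiC2 : C2_on [set: X] phi) (PhiC2 : C2_on [set: X] Phi).
Hypotheses (g_proper : eproper g) (g_lsc : lower_semicontinuous g) (g_convex : econvex g).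
Hypotheses (Theta_affine : affine_set Theta) (kkt : KKT phi Phi g Theta xbar ybar).

Let phi_diff x : differentiable phi x. Proof. by have [] := phiC2 (x := x) 0 0 I. Qed.
Let Phi_diff x : differentiable Phi x. Proof. by have [] := PhiC2 (x := x) 0 0 I. Qed.

Let Txbar : Theta xbar. Proof. by case: kkt => -[]. Qed.
Let sybar : subdiff g (Phi xbar) ybar. Proof. by case: kkt. Qed.

(** The linear lower bound comes from the subgradient [ybar] at [Phi xbar]. *)
Lemma g_lsc_convex : lsc_convex g.
Proof.
split => //; first by case: g_proper.
have [/fin_num_real[r rE] h] := sybar.
exists (`|r| + `|ybar| * `|Phi xbar|), `|ybar|; split => // z.
apply: le_trans (h z); rewrite rE -EFinD lee_fin innerBr.
have := inner_norm_le ybar (Phi xbar); have := inner_norm_le ybar z.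
rewrite !ler_norml => /andP[h1 h2] /andP[h3 h4].
have := ler_norm (- r); rewrite normrN; lra.
Qed.

Definition lin_space : set X := [set h | Theta (xbar + h)].

Lemma Theta_sub x x' : Theta x -> Theta x' -> lin_space (x - x').
Proof. by move=> Tx Tx'; exact: affine_addB. Qed.

Lemma Theta_add x h : Theta x -> lin_space h -> Theta (x + h).
Proof.
move=> Tx Lh; have -> : x + h = x + ((xbar + h) - xbar) by vec.
exact: affine_addB.
Qed.

Lemma lin_spaceZ (t : R) h : lin_space h -> lin_space (t *: h).
Proof. exact: affine_directionZ. Qed.

Lemma Theta_closed : closed Theta.
Proof.
have -> : Theta = (fun x => x - xbar) @^-1` lin_space.
  apply/seteqP; split => x; rewrite /preimage /= /lin_space /= => h; first by rewrite addrC subrK.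
  by move: h; rewrite addrC subrK.
apply: closed_comp; last exact: affine_direction_closed.
by move=> x _; apply: cvgB; [exact: cvg_id|exact: cvg_cst].
Qed.

(** With h also -h is feasible, so at every point of [Theta] the normal cone is the same subspace,
    the orthogonal complement of [lin_space]. *)
Lemma normal_coneE x v : Theta x ->
  normal_cone Theta x v <-> forall h, lin_space h -> inner v h = 0.
Proof.
move=> Tx; split => [[_ h] e Le|h].
  apply/eqP; rewrite eq_le; apply/andP; split.
    by have := h _ (Theta_add Tx Le); rewrite (_ : x + e - x = e) //; vec.
  have := h _ (Theta_add Tx (lin_spaceZ (-1) Le)).
  by rewrite (_ : x + -1 *: e - x = -1 *: e); [rewrite innerZr mulN1r oppr_le0|vec].
by split => // x' Tx'; rewrite h //; exact: Theta_sub.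
Qed.

Lemma normal_cone_closed x : Theta x -> closed (normal_cone Theta x).
Proof.
move=> Tx; apply: subspace_closed.
- by apply/normal_coneE => // h _; rewrite inner0l.
- move=> v w /(normal_coneE _ Tx) hv /(normal_coneE _ Tx) hw; apply/normal_coneE => // h Lh.
  by rewrite innerDl hv // hw // addr0.
- move=> t v /(normal_coneE _ Tx) hv; apply/normal_coneE => // h Lh.
  by rewrite innerZl hv // mulr0.
Qed.

Lemma gradLE x y h : inner (gradx_L phi Phi x y) h = 'd phi x h + inner y ('d Phi x h).
Proof.
rewrite gradE.
have [_ E] : has_diff ((lagrangian phi Phi)^~ y) x (fun h => 'd phi x h + inner y ('d Phi x h)).
  apply: has_diffD (conj (phi_diff x) (fun _ => erefl)) _.
  exact: has_diff_comp (conj (Phi_diff x) (fun _ => erefl)) (diff_inner y (Phi x)).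
exact: E.
Qed.

(** [hess_L] differentiates a gradient vector obtained by Riesz representation, whereas the
    expansions concern scalar derivatives; their operator-norm remainders show that the
    representative of the bilinear form is the differential. *)
Lemma hessLE Bp BP y h v : second_order phi xbar Bp -> second_order Phi xbar BP ->
  inner (hess_L phi Phi xbar y h) v = Bp h v + inner y (BP h v).
Proof.
move=> [p1 p2 [Kp Kp0 hKp] pd] [P1 P2 [KP KP0 hKP] Pd].
pose B h v : R := Bp h v + inner y (BP h v).
have Blin k : linear (B k).
  by move=> t a b; rewrite /B p2 P2 innerDr innerZr /GRing.scale /=; ring.
have hl k : exists u : X, forall v, inner u v = B k v.
  pose FL := HB.pack_for {linear X -> R} (B k) (GRing.isLinear.Build R X R _ (B k) (Blin k)).
  by have [u hu] := riesz FL; exists u => w; rewrite -hu.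
have [l lE] := choice hl.
have llin : linear l.
  move=> t a b; apply: inner_inj => w; rewrite innerDl innerZl !lE /B.
  by rewrite (p1 w t a b) (P1 w t a b) /= innerDr innerZr /GRing.scale /=; ring.
pose lL := HB.pack_for {linear X -> X} l (GRing.isLinear.Build R X X _ l llin).
have [|_ E] := @diff_intro R X X (gradx_L phi Phi ^~ y) xbar lL; last by rewrite /hess_L E /= lE.
move=> e e0.
have y1 : 0 < `|y| + 1 by rewrite ltr_wpDl.
have e1 : 0 < e / (2 * (`|y| + 1)) by rewrite divr_gt0 // mulr_gt0.
near=> k.
have [_ hp] : differentiable phi (xbar + k) /\ forall v,
   `|'d phi (xbar + k) v - 'd phi xbar v - Bp k v| <= e / 2 * `|k| * `|v|.
  by near: k; apply: pd; rewrite divr_gt0.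
have [_ hP] : differentiable Phi (xbar + k) /\ forall v,
   `|'d Phi (xbar + k) v - 'd Phi xbar v - BP k v| <= e / (2 * (`|y| + 1)) * `|k| * `|v|.
  by near: k; exact: Pd.
apply: norm_le_inner; first by rewrite mulr_ge0 // ltW.
move=> w; rewrite !innerBl (gradLE (xbar + k) y w) (gradLE xbar y w) lE /B.
have expand (a b c : R) (A B' C : Y) : a + inner y A - (b + inner y B') - (c + inner y C) =
  (a - b - c) + inner y (A - B' - C) by rewrite !innerBr; ring.
rewrite expand.
have h1 := le_trans (ler_norm _) (hp w).
have h2 := le_trans (inner_le y _) (ler_wpM2l (normr_ge0 y) (hP w)).
have h3 : `|y| * (e / (2 * (`|y| + 1)) * `|k| * `|w|) <= e / 2 * `|k| * `|w|.
  have -> : `|y| * (e / (2 * (`|y| + 1)) * `|k| * `|w|) =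
     (e / 2 * `|k| * `|w|) * (`|y| / (`|y| + 1)) by field; rewrite gt_eqF.
  rewrite ler_piMr //; first by rewrite !mulr_ge0 // ltW.
  by rewrite ler_pdivrMr // mul1r lerDl.
have -> : e * `|k| * `|w| = e / 2 * `|k| * `|w| + e / 2 * `|k| * `|w| by field.
exact: lerD h1 (le_trans h2 h3).
Unshelve. all: by end_near.
Qed.

(** The gradient is orthogonal to all feasible directions and the indicator does not grow along
    them, so the SOSC can be applied to any of them. *)
Lemma crit_cone_Theta h : lin_space h ->
  crit_cone (indicator Theta) xbar (- gradx_L phi Phi xbar ybar) h.
Proof.
move=> Lh; have [nc _] := kkt.
rewrite /crit_cone /=; have -> := (proj1 (normal_coneE _ Txbar)) nc h Lh.
have i0 : indicator Theta xbar = 0%E :> \bar R by rewrite /indicator; case: asboolP.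
apply/eqP; rewrite eq_le; apply/andP; split.
  apply: limf_einf_ge => e e0.
  exists ([set t | 0 < t], setT) => /=; first by split; [exact: nbhs_right_gt|exact: filterT].
  move=> [t w'] /= [t0 _]; rewrite i0 sube0 sub0r.
  apply: (@le_trans _ _ 0%E); first by rewrite lee_fin oppr_le0 ltW.
  rewrite mule_ge0 ?lee_fin ?invr_ge0 ?(ltW t0) //.
  by rewrite /indicator; case: asboolP.
have d0 : down0 (fun n => n.+1%:R^-1 : R).
  by split; [move=> k; rewrite invr_gt0|exact: cvg_harmonic].
apply: (@subderiv_le_cvg _ _ _ _ _ _ (fun=> h) (fun=> 0) 0 d0 (cvg_cst _) (cvg_cst _)).
apply: nearW => k; rewrite i0 sube0 /indicator; case: asboolP; first by rewrite mule0.
by case; apply: Theta_add => //; exact: lin_spaceZ.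
Qed.

End Problem.

(** * The augmented Lagrangian *)

Section AugmentedLagrangian.
Context {R : realType} {X Y : finHilbertType R}.
Variables (phi : X -> R) (Phi : X -> Y) (g : Y -> \bar R).
Hypotheses (phiC2 : C2_on [set: X] phi) (PhiC2 : C2_on [set: X] Phi) (gc : lsc_convex g).

Let phi_diff x : differentiable phi x. Proof. by have [] := phiC2 (x := x) 0 0 I. Qed.
Let Phi_diff x : differentiable Phi x. Proof. by have [] := PhiC2 (x := x) 0 0 I. Qed.

(** The point at which the infimum in the envelope of the augmented Lagrangian is attained. *)
Definition al_prox (rho : R) x y : Y := proxr g rho (Phi x + rho^-1 *: y).

(** The updated multiplier, by [grady_ALE], and at the same time a subgradient of g at [al_prox]. *)
Definition al_mult (rho : R) x y : Y := y + rho *: (Phi x - al_prox rho x y).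

Lemma al_multE rho x y : 0 < rho ->
  al_mult rho x y = rho *: (Phi x + rho^-1 *: y - al_prox rho x y).
Proof.
move=> r0; apply: inner_inj => h; rewrite ?(innerDl, innerBl, innerNl, innerZl).
by field; rewrite gt_eqF.
Qed.

Lemma al_mult_subdiff rho x y : 0 < rho -> subdiff g (al_prox rho x y) (al_mult rho x y).
Proof. by move=> r0; rewrite al_multE //; exact: proxr_subdiff. Qed.

Lemma al_proxE rho x y : 0 < rho ->
  al_prox rho x y = Phi x + rho^-1 *: (y - al_mult rho x y).
Proof.
move=> r0; apply: inner_inj => h; rewrite ?(innerDl, innerBl, innerNl, innerZl).
by field; rewrite gt_eqF.
Qed.

Lemma al_env x y rho : 0 < rho -> aug_lagrangian phi Phi g x y rho =
  phi x + env g rho (Phi x + rho^-1 *: y) - 2^-1 * rho^-1 * `|y| ^+ 2.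
Proof. by move=> r0; rewrite /aug_lagrangian moreauE. Qed.

Lemma alE x y rho : 0 < rho -> aug_lagrangian phi Phi g x y rho =
  phi x + fine (g (al_prox rho x y)) + inner y (Phi x - al_prox rho x y) +
  2^-1 * rho * `|Phi x - al_prox rho x y| ^+ 2.
Proof.
move=> r0; rewrite al_env // /env -/(al_prox rho x y).
have -> : Phi x + rho^-1 *: y - al_prox rho x y = (Phi x - al_prox rho x y) + rho^-1 *: y by vec.
rewrite normD_sqr innerZr normrZ exprMn real_normK ?num_real // innerC.
by field; rewrite gt_eqF.
Qed.

Lemma al_le x y rho z : 0 < rho -> g z \is a fin_num ->
  aug_lagrangian phi Phi g x y rho <=
  phi x + fine (g z) + inner y (Phi x - z) + 2^-1 * rho * `|Phi x - z| ^+ 2.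
Proof.
move=> r0 gz; rewrite al_env //.
have := env_le gc (Phi x + rho^-1 *: y) r0 gz.
have -> : Phi x + rho^-1 *: y - z = (Phi x - z) + rho^-1 *: y by vec.
rewrite normD_sqr innerZr normrZ exprMn real_normK ?num_real // (innerC _ y).
have -> : 2^-1 * rho * (`|Phi x - z| ^+ 2 + 2 * (rho^-1 * inner y (Phi x - z)) + rho^-1 ^+ 2 * `|y| ^+ 2)
  = 2^-1 * rho * `|Phi x - z| ^+ 2 + inner y (Phi x - z) + 2^-1 * rho^-1 * `|y| ^+ 2.
  by field; rewrite gt_eqF.
lra.
Qed.

Lemma al_diff x y rho : 0 < rho -> has_diff (fun x' => aug_lagrangian phi Phi g x' y rho) x
  (inner (gradx_L phi Phi x (al_mult rho x y))).
Proof.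
move=> r0; pose c := 2^-1 * rho^-1 * `|y| ^+ 2.
have hP : has_diff (fun x' => Phi x' + rho^-1 *: y) x (fun h => 'd Phi x h + 0).
  exact: has_diffD (conj (Phi_diff x) (fun _ => erefl)) (has_diff_cst _ _).
have := has_diffB (has_diffD (conj (phi_diff x) (fun _ => erefl))
  (has_diff_comp hP (env_diff gc (Phi x + rho^-1 *: y) r0))) (has_diff_cst c x).
apply: has_diff_ext => z; first by rewrite al_env.
by rewrite subr0 addr0 (gradLE phiC2 PhiC2) al_multE.
Qed.

Lemma gradx_ALE x y rho : 0 < rho ->
  gradx_AL phi Phi g x y rho = gradx_L phi Phi x (al_mult rho x y).
Proof. by move=> r0; apply: grad_eq => w; have [_ ->] := al_diff x y r0. Qed.

Lemma grady_ALE x y rho : 0 < rho ->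
  y + rho *: grady_AL phi Phi g x y rho = al_mult rho x y.
Proof.
move=> r0; suff -> : grady_AL phi Phi g x y rho = Phi x - al_prox rho x y by [].
have hk : has_diff (fun y' => Phi x + rho^-1 *: y') y (fun h => 0 + rho^-1 *: h).
  exact: has_diffD (has_diff_cst _ _) (has_diffZ _ (has_diff_id y)).
have hA := has_diffB (has_diffD (has_diff_cst (phi x) y)
  (has_diff_comp hk (env_diff gc (Phi x + rho^-1 *: y) r0)))
  (has_diffZ rho^-1 (diff_half_sqr 0 y)).
apply: grad_eq => w.
have [_ ->] // : has_diff (fun y' => aug_lagrangian phi Phi g x y' rho) y (inner (Phi x - al_prox rho x y)).
apply: has_diff_ext hA => z.
  by rewrite al_env // subr0 /GRing.scale /=; ring.
rewrite subr0 !add0r -al_multE // innerZr /GRing.scale /= -mulrBr -innerBl /al_mult.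
have -> : y + rho *: (Phi x - al_prox rho x y) - y = rho *: (Phi x - al_prox rho x y) by vec.
by rewrite innerZl mulrA mulVf ?gt_eqF // mul1r.
Qed.

End AugmentedLagrangian.

Section Stationarity.
Context {R : realType} {X Y : finHilbertType R}.
Variables (phi : X -> R) (Phi : X -> Y) (g : Y -> \bar R) (Theta : set X) (xbar : X) (ybar : Y).
Hypotheses (phiC2 : C2_on [set: X] phi) (PhiC2 : C2_on [set: X] Phi).
Hypotheses (Theta_affine : affine_set Theta) (kkt : KKT phi Phi g Theta xbar ybar).

Let Txbar : Theta xbar. Proof. by case: kkt => -[]. Qed.

(** The inclusion of v in the gradient plus the normal cone, tested on feasible directions as
    [normal_coneE] allows. *)
Definition stationary x y v : Prop := Theta x /\
  forall h, lin_space Theta xbar h -> inner v h = inner (gradx_L phi Phi x y) h.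

Lemma stationaryP x y v : Theta x -> stationary x y v <-> normal_cone Theta x (v - gradx_L phi Phi x y).
Proof.
move=> Tx; rewrite (normal_coneE Theta_affine kkt) //; split => [[_ h] e Le|h].
  by rewrite innerBl h // subrr.
by split => // e Le; apply/eqP; rewrite -subr_eq0 -innerBl h.
Qed.

Lemma dist_to_attained (x a : X) : Theta x -> exists2 c, normal_cone Theta x c &
  dist_to (@Num.norm _ X) a (normal_cone Theta x) = `|a - c|%:E.
Proof.
move=> Tx; have ne : normal_cone Theta x !=set0.
  by exists 0; apply/(normal_coneE Theta_affine kkt) => // h _; rewrite inner0l.
have [c Nc hc] := closed_projection a (normal_cone_closed Theta_affine kkt Tx) ne.
exists c => //; apply/eqP; rewrite eq_le; apply/andP; split.
  by apply: ereal_inf_lbound; exists c.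
by apply: le_ereal_inf_tmp => _ [c' Nc' <-]; rewrite lee_fin hc.
Qed.

Lemma dist_stationary x y : Theta x -> exists2 v, stationary x y v &
  dist_to (@Num.norm _ X) (- gradx_L phi Phi x y) (normal_cone Theta x) = `|v|%:E.
Proof.
move=> Tx; have [c Nc E] := dist_to_attained (- gradx_L phi Phi x y) Tx.
exists (gradx_L phi Phi x y + c); last by rewrite E -normrN opprB opprK addrC.
by apply/stationaryP => //; rewrite addrC addKr.
Qed.

Lemma dist_le_stationary x y v : stationary x y v ->
  (dist_to (@Num.norm _ X) (- gradx_L phi Phi x y) (normal_cone Theta x) <= `|v|%:E)%E.
Proof.
move=> sv; have [Tx _] := sv; move/(stationaryP y v Tx): sv => sv.
apply: ereal_inf_lbound; exists (v - gradx_L phi Phi x y) => //=.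
by congr (_%:E); rewrite -[RHS]normrN; congr (`| _ |); vec.
Qed.

Lemma dist_off_Theta x a : ~ Theta x -> dist_to (@Num.norm _ X) a (normal_cone Theta x) = +oo%E.
Proof.
move=> nTx; rewrite /dist_to (_ : [set _ | _ in _] = set0) ?ereal_inf0 //.
by apply/seteqP; split => // z [c [Tx _] _]; case: nTx.
Qed.

End Stationarity.

Lemma quotient1_cvg (R : realType) (V W : finHilbertType R) (f : V -> W) a B
    (t : nat -> R) (w : nat -> V) (wl : V) :
  down0 t -> w @ \oo --> wl -> second_order f a B ->
  (fun n => (t n)^-1 *: (f (a + t n *: w n) - f a)) @ \oo --> 'd f a wl.
Proof.
move=> t0 wc so; have [tp tc] := t0.
have -> : (fun n => (t n)^-1 *: (f (a + t n *: w n) - f a)) =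
  (fun n => t n *: ((t n ^+ 2)^-1 *: (f (a + t n *: w n) - f a - 'd f a (t n *: w n))) + 'd f a (w n)).
  apply/funext => n; rewrite scalerA.
  have -> : t n * t n ^- 2 = (t n)^-1 by field; rewrite gt_eqF.
  have -> : 'd f a (t n *: w n) = t n *: 'd f a (w n) by rewrite linearZ.
  by rewrite [in RHS]scalerBr (scalerA _ (t n)) mulVf ?gt_eqF // scale1r subrK.
rewrite -[X in _ --> X]add0r -(scale0r (2^-1 *: B wl wl)); apply: cvgD.
  by apply: cvgZ => //; have := taylor2_quotient_cvg t0 wc so.
exact: (continuous_cvg _ (@findim_linear_continuous _ _ _ ('d f a) wl) wc).
Qed.

(** * Linearly decaying sequences *)

Section LinearDecay.
Context {R : realType}.
Implicit Types (e : nat -> R).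

Lemma halving_cvg0 e : (forall k, 0 <= e k) -> (forall k, e k.+1 <= 2^-1 * e k) -> e @ \oo --> 0.
Proof.
move=> e0 eh.
have le k : e k <= e 0%N * 2^-1 ^+ k.
  elim: k => [|k IH]; first by rewrite expr0 mulr1.
  by apply: le_trans (eh k) _; rewrite exprS mulrCA ler_pM2l.
have l : (fun k => e 0%N * 2^-1 ^+ k) @ \oo --> e 0%N * 0.
  apply: cvgMr; apply: cvg_expr; rewrite ger0_norm ?invr_ge0 // invf_lt1 // ltr1n //.
rewrite mulr0 in l; apply: (squeeze_cvgr _ (cvg_cst 0) l).
by apply: nearW => k; rewrite e0 le.
Qed.

Lemma halving_Qlinear e : (forall k, e k.+1 <= 2^-1 * e k) -> Qlinear e.
Proof.
move=> eh; exists 2^-1; last by apply: nearW => k; exact: eh.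
by rewrite invr_gt0 ltr0n invf_lt1 // ltr1n.
Qed.

(** The ratio itself serves as q. Where e k = 0 the convention x / 0 = 0 makes it 0, and halving
    keeps e k.+1 at 0. *)
Lemma Qsuperlinear_ratio e : (forall k, 0 <= e k) -> (forall k, e k.+1 <= 2^-1 * e k) ->
  (forall eta, 0 < eta -> \forall k \near \oo, e k.+1 <= eta * e k) -> Qsuperlinear e.
Proof.
move=> e0 eh h; exists (fun k => e k.+1 / e k); last first.
  move=> k; have [ez|enz] := eqVneq (e k) 0; last by rewrite divfK.
  by have := eh k; rewrite ez !mulr0.
apply/cvgrPdist_le => eta eta0; apply: filterS (h eta eta0) => k hk.
rewrite sub0r normrN ger0_norm ?divr_ge0 //.
have [ez|enz] := eqVneq (e k) 0; first by rewrite ez invr0 mulr0 ltW.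
by rewrite ler_pdivrMr // lt_def enz e0.
Qed.

Lemma norm_step_add (V : normedModType R) (u : nat -> V) k m :
  `|u (k + m).+1 - u k| <= `|u (k + m)%N - u k| + `|u (k + m).+1 - u (k + m)%N|.
Proof. by rewrite [leRHS]addrC; exact: ler_distD. Qed.

(* The lengths A e_k telescope: A e_k <= 2 A (e_k - e_(k+1)). *)
Lemma halving_tail (V W : normedModType R) (x : nat -> V) (y : nat -> W) e (A : R) k n :
  0 <= A -> (forall j, (j < n)%N -> e (k + j).+1 <= 2^-1 * e (k + j)%N) ->
  (forall j, (j < n)%N -> `|x (k + j).+1 - x (k + j)%N| + `|y (k + j).+1 - y (k + j)%N| <= A * e (k + j)%N) ->
  `|x (k + n)%N - x k| + `|y (k + n)%N - y k| <= 2 * A * (e k - e (k + n)%N).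
Proof.
move=> A0; elim: n => [|n IH] he hl; first by rewrite addn0 !subrr !normr0 addr0 mulr0.
have h1 : `|x (k + n)%N - x k| + `|y (k + n)%N - y k| <= 2 * A * (e k - e (k + n)%N).
  by apply: IH => j jn; [apply: he|apply: hl]; exact: ltnW.
have h2 := hl n (ltnSn n).
have h3 := ler_wpM2l A0 (he n (ltnSn n)).
rewrite addnS; have h4 := norm_step_add x k n; have h5 := norm_step_add y k n.
by lra.
Qed.

End LinearDecay.

(** * Quadratic growth of the augmented Lagrangian *)

Section LocalAnalysis.
Context {R : realType} {X Y : finHilbertType R}.
Variables (phi : X -> R) (Phi : X -> Y) (g : Y -> \bar R) (Theta : set X) (xbar : X) (ybar : Y).
Hypotheses (phiC2 : C2_on [set: X] phi) (PhiC2 : C2_on [set: X] Phi).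
Hypotheses (g_proper : eproper g) (g_lsc : lower_semicontinuous g) (g_convex : econvex g).
Hypotheses (Theta_affine : affine_set Theta) (kkt : KKT phi Phi g Theta xbar ybar).
Hypotheses (sosc : SOSC phi Phi g Theta xbar ybar).
Hypotheses (M_calm : calm pnorm (multipliers phi Phi g Theta xbar) (0, 0) ybar).
Hypotheses (g_semistable : semistable g (Phi xbar) ybar).
Hypotheses (hii : second_order_regular g (Phi xbar) ybar).

Let Txbar : Theta xbar. Proof. by case: kkt => -[]. Qed.
Let sybar : subdiff g (Phi xbar) ybar. Proof. by case: kkt. Qed.
Let gc : lsc_convex g := g_lsc_convex g_proper g_lsc g_convex kkt.
Let M0 := multipliers phi Phi g Theta xbar (0, 0).
Let L := lin_space Theta xbar.
Local Notation stat := (stationary phi Phi Theta xbar).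
Local Notation gradL := (gradx_L phi Phi).
Local Notation AL := (aug_lagrangian phi Phi g).

Lemma M0P y : M0 y <-> stat xbar y 0 /\ subdiff g (Phi xbar) y.
Proof.
rewrite /M0 /multipliers /= addr0.
by split => -[h s]; split => //; move: h; rewrite (stationaryP Theta_affine kkt _ _ Txbar).
Qed.

Lemma M0ybar : M0 ybar.
Proof.
apply/M0P; split => //; split => // h Lh.
have [nc _] := kkt; have := (proj1 (normal_coneE Theta_affine kkt _ Txbar)) nc h Lh.
by rewrite inner0l innerNl => /eqP; rewrite oppr_eq0 => /eqP.
Qed.

Lemma M0_stat y h : M0 y -> L h -> inner (gradL xbar y) h = 0.
Proof. by move=> /M0P[[_ hs] _] Lh; rewrite -hs // inner0l. Qed.

Lemma M0_subdiff y : M0 y -> subdiff g (Phi xbar) y.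
Proof. by move=> /M0P[]. Qed.

Let soc := C2_second_order phiC2 (conj openT I : open_nbhs xbar setT).
Let sOc := C2_second_order PhiC2 (conj openT I : open_nbhs xbar setT).

(** The condition [|ybar| + 1 <= K] lets K also bound every multiplier within distance 1 of
    [ybar]. *)
Lemma local_bounds : exists K d : R, [/\ 1 <= K, `|ybar| + 1 <= K, 0 < d <= 1 & forall x, `|x - xbar| <= d ->
  [/\ `|Phi x - Phi xbar| <= K * `|x - xbar|,
      `|Phi x - Phi xbar - 'd Phi xbar (x - xbar)| <= K * `|x - xbar| ^+ 2,
      forall h, `|'d phi x h - 'd phi xbar h| <= K * `|x - xbar| * `|h|,
      forall h, `|'d Phi x h - 'd Phi xbar h| <= K * `|x - xbar| * `|h| &
      forall h, `|'d Phi xbar h| <= K * `|h|]].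
Proof.
have [Bp sp] := soc; have [BP sP] := sOc.
have [C1 C10 h1] := second_order_bound sp.
have [C2 C20 h2] := second_order_remainder sP.
have [k k0 hk] := linear_lipschitz (@findim_linear_continuous _ _ _ ('d Phi xbar)).
have [r /= r0 hr] := proj1 nbhs_norm0P (filterI h1 h2).
exists (1 + `|ybar| + C1 + C2 + k), (Num.min 1 (r / 2)).
have y0 := normr_ge0 ybar.
split; [lra|lra|by rewrite lt_min ltr01 divr_gt0 // ge_min lexx|].
move=> x; rewrite le_min => /andP[_ xr].
have xr' : `|x - xbar| < r by lra.
have xE : xbar + (x - xbar) = x by vec.
have := hr _ xr'; rewrite /= xE => -[hp [hP1 hP2 hP3]].
have n0 := normr_ge0 (x - xbar).
split.
- apply: le_trans hP2 _; rewrite ler_wpM2r //; lra.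
- apply: le_trans hP1 _; rewrite ler_wpM2r ?sqr_ge0 //; lra.
- move=> h; apply: le_trans (hp h) _; rewrite ler_wpM2r // ler_wpM2r //; lra.
- move=> h; apply: le_trans (hP3 h) _; rewrite ler_wpM2r // ler_wpM2r //; lra.
- move=> h; apply: le_trans (hk h) _; rewrite ler_wpM2r //; lra.
Qed.

(** Common end of two contradiction arguments, for [growth] and for [primal_error_bound]: each
    normalises a failing sequence to a unit direction xi. *)
Lemma sosc_contra xi (q : R) : L xi -> `|xi| = 1 ->
  crit_cone g (Phi xbar) ybar ('d Phi xbar xi) ->
  (subderiv2 g (Phi xbar) ybar ('d Phi xbar xi) <= (- q)%:E)%E ->
  inner (hess_L phi Phi xbar ybar xi) xi = q -> False.
Proof.
move=> Lxi xi1 cr d2 hq.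
have xi0 : xi != 0 by rewrite -normr_eq0 xi1 oner_eq0.
have := sosc (crit_cone_Theta Theta_affine kkt Lxi) cr xi0.
rewrite hq ltNge => /negP; apply.
apply: (@le_trans _ _ (q%:E + (- q)%:E)%E); first by rewrite leeD2l.
by rewrite -EFinD subrr.
Qed.

Let L_closed (u : nat -> X) l : (forall n, L (u n)) -> u @ \oo --> l -> L l.
Proof.
move=> hu ul.
apply: (@closed_cvg _ _ \oo _ u L (affine_direction_closed Theta_affine Txbar) _ l ul).
exact: nearW.
Qed.

Let phi_stat y h : M0 y -> L h -> 'd phi xbar h + inner y ('d Phi xbar h) = 0.
Proof. by move=> My Lh; rewrite -(gradLE phiC2 PhiC2); exact: M0_stat. Qed.

Let p_star := phi xbar + fine (g (Phi xbar)).

(** If growth fails, it fails with rho = n + 1 and l = d = 1 / (n + 1). Along the normalised failing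
    points the Lagrangian part contributes q / 2, so the part of g, measured with the multipliers of
    the sequence, has second-order quotients at most - q in the limit, against the SOSC. *)
Lemma growth : exists rho0 l d : R, [/\ 0 < rho0, 0 < l, 0 < d & forall yh x,
  M0 yh -> `|yh - ybar| <= d -> Theta x -> `|x - xbar| <= d ->
  p_star + l * `|x - xbar| ^+ 2 <= AL x yh rho0].
Proof.
apply: contrapT => hno.
have hn (n : nat) : exists p : X * Y, [/\ M0 p.2 /\ `|p.2 - ybar| <= n.+1%:R^-1, Theta p.1,
    `|p.1 - xbar| <= n.+1%:R^-1 & AL p.1 p.2 n.+1%:R < p_star + n.+1%:R^-1 * `|p.1 - xbar| ^+ 2].
  apply: contrapT => hnn; apply: hno; exists n.+1%:R, n.+1%:R^-1, n.+1%:R^-1.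
  split; rewrite ?invr_gt0 ?ltr0n // => yh x My yd Tx xd.
  by rewrite leNgt; apply/negP => hl; apply: hnn; exists (x, yh).
have [p hp] := choice hn.
pose rho (n : nat) : R := n.+1%:R.
have rho0 n : 0 < rho n by rewrite ltr0n.
have pM n : M0 (p n).2 by have [[]] := hp n.
have py n : `|(p n).2 - ybar| <= n.+1%:R^-1 by have [[]] := hp n.
have pT n : Theta (p n).1 by have [] := hp n.
have px n : `|(p n).1 - xbar| <= n.+1%:R^-1 by have [] := hp n.
have pA n : AL (p n).1 (p n).2 (rho n) < p_star + n.+1%:R^-1 * `|(p n).1 - xbar| ^+ 2 by have [] := hp n.
pose z n := al_prox Phi g (rho n) (p n).1 (p n).2.
have zf n : g (z n) \is a fin_num by exact: proxr_fin.
(* G and D split the excess over [p_star] into the part of g and the smooth part, by inserting <y,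
   Phi xbar>; G is nonnegative because the multiplier is a subgradient. *)
pose G n := fine (g (z n)) - fine (g (Phi xbar)) - inner (p n).2 (z n - Phi xbar).
have G0 n : 0 <= G n.
  by have := subdiff_le (M0_subdiff (pM n)) (zf n); rewrite /G; lra.
pose D n := phi (p n).1 - phi xbar + inner (p n).2 (Phi (p n).1 - Phi xbar).
pose s n := `|(p n).1 - xbar|.
have main n : D n + G n + 2^-1 * rho n * `|Phi (p n).1 - z n| ^+ 2 < n.+1%:R^-1 * s n ^+ 2.
  have := pA n; rewrite (alE phi Phi gc _ _ (rho0 n)) -/(z n) /p_star /D /G /s !innerBr.
  by set i := n.+1%:R^-1; lra.
have s0 n : 0 < s n.
  rewrite normr_gt0 subr_eq0; apply/eqP => xE; have := main n.
  rewrite /D /s xE !subrr inner0r normr0 expr0n mulr0 addr0 add0r => /lt_geF.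
  by rewrite addr_ge0 // mulr_ge0 ?sqr_ge0 // mulr_ge0 // ltW.
pose xi n := (s n)^-1 *: ((p n).1 - xbar).
have xi1 n : `|xi n| = 1 by rewrite normrZ gtr0_norm ?invr_gt0 // mulVf // gt_eqF.
have xi1' n : `|xi n| <= 1 by rewrite xi1.
have [si [xl [sin xlc]]] := bounded_subsequence xi1'.
have Lxi n : L (xi n) by apply: (lin_spaceZ Theta_affine kkt); apply: (Theta_sub Theta_affine kkt).
pose t n := s (si n); pose x n := (p (si n)).1; pose y n := (p (si n)).2.
have tp n : 0 < t n by exact: s0.
have inv_si : (fun n => (si n).+1%:R^-1 : R) @ \oo --> 0.
  exact: (cvg_subseq sin (@cvg_harmonic R)).
have t0 : down0 t.
  split => //; apply: (squeeze_cvgr _ (cvg_cst 0) inv_si); apply: nearW => n.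
  by rewrite (ltW (tp n)) /=; exact: px.
have yl : y @ \oo --> ybar.
  apply/subr_cvg0/norm_cvg0P; apply: (squeeze_cvgr _ (cvg_cst 0) inv_si); apply: nearW => n.
  by rewrite normr_ge0 /=; exact: py.
have xE n : x n = xbar + t n *: (xi \o si) n.
  by rewrite /xi /= scalerA divff ?gt_eqF // scale1r addrC subrK.
have Lxl : L xl by apply: (L_closed (u := xi \o si)) => // n; exact: Lxi.
have xl1 : `|xl| = 1.
  have h1 : (fun n => `|(xi \o si) n|) @ \oo --> `|xl| by exact: cvg_norm.
  have E : (fun n => `|(xi \o si) n|) = (fun=> 1) by apply/funext => n; exact: xi1.
  by rewrite E in h1; exact: cvg_unique h1 (cvg_cst _).
have [Bp sp] := soc; have [BP sP] := sOc.
pose q := inner (hess_L phi Phi xbar ybar xl) xl.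
have qE : q = Bp xl xl + inner ybar (BP xl xl) by exact: hessLE.
pose a n := (t n ^+ 2)^-1 * D (si n).
have al : a @ \oo --> 2^-1 * q.
  have l1 := taylor2_quotient_real t0 xlc sp.
  have l2 := taylor2_quotient_cvg t0 xlc sP.
  have l3 := continuous_inner yl l2.
  have -> : 2^-1 * q = 2^-1 * Bp xl xl + inner ybar (2^-1 *: BP xl xl) by rewrite qE innerZr; ring.
  have -> : a = (fun n => (t n ^+ 2)^-1 * (phi (xbar + t n *: (xi \o si) n) - phi xbar - 'd phi xbar (t n *: (xi \o si) n))
     + inner (y n) ((t n ^+ 2)^-1 *: (Phi (xbar + t n *: (xi \o si) n) - Phi xbar - 'd Phi xbar (t n *: (xi \o si) n)))).
    apply/funext => n; rewrite -xE /a /D -/(x n) -/(y n) innerZr !innerBr.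
    have Lt : L (t n *: (xi \o si) n) by apply: (lin_spaceZ Theta_affine kkt); exact: Lxi.
    have := phi_stat (pM (si n)) Lt; rewrite -/(y n) => /eqP; rewrite addr_eq0 => /eqP ->.
    by ring.
  by apply: cvgD => //; exact: l3.
pose u n := (t n)^-1 *: (z (si n) - Phi xbar).
have zE n : z (si n) = Phi xbar + t n *: u n.
  by rewrite /u scalerA divff ?gt_eqF // scale1r addrC subrK.
have aE n : t n ^+ 2 * a n = D (si n) by rewrite /a; field; rewrite gt_eqF.
have Gb n : G (si n) <= (t n ^+ 2) * ((si n).+1%:R^-1 - a n).
  have := main (si n); rewrite -/(t n).
  have : 0 <= 2^-1 * rho (si n) * `|Phi (p (si n)).1 - z (si n)| ^+ 2.
    by rewrite mulr_ge0 ?sqr_ge0 // mulr_ge0 // ltW.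
  rewrite mulrBr aE (mulrC (t n ^+ 2)). set i := (si n).+1%:R^-1; lra.
have pen n : (t n)^-1 ^+ 2 * `|Phi (x n) - z (si n)| ^+ 2 <= 2 * ((si n).+1%:R^-1 - a n) / rho (si n).
  have := main (si n); rewrite -/(t n) -/(x n).
  have h1 := G0 (si n).
  rewrite ler_pdivlMr //.
  have -> : (t n)^-1 ^+ 2 * `|Phi (x n) - z (si n)| ^+ 2 * rho (si n) =
     (t n ^+ 2)^-1 * (`|Phi (x n) - z (si n)| ^+ 2 * rho (si n)) by field; rewrite gt_eqF.
  rewrite ler_pdivrMl ?exprn_gt0 //.
  have -> : t n ^+ 2 * (2 * ((si n).+1%:R^-1 - a n)) = 2 * ((si n).+1%:R^-1 * t n ^+ 2 - D (si n)).
    by rewrite -aE; ring.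
  by set i := (si n).+1%:R^-1; lra.
(* Dividing [pen] by rho, which tends to infinity, shows that the proximal points differ from Phi x
   by o(t), so both have the same first-order quotients. *)
have ul : u @ \oo --> 'd Phi xbar xl.
  have l1 := quotient1_cvg t0 xlc sP.
  have l2 : (fun n => (t n)^-1 *: (Phi (x n) - z (si n))) @ \oo --> (0 : Y).
    apply/cvgr0Pnorm_lt => e e0.
    have l3 : (fun n => 2 * ((si n).+1%:R^-1 - a n) / rho (si n)) @ \oo --> 2 * (0 - 2^-1 * q) * 0.
      by apply: cvgM => //; apply: cvgMr; exact: cvgB.
    rewrite mulr0 in l3.
    have e2 : 0 < e ^+ 2 by rewrite exprn_gt0.
    have hev : \forall n \near \oo, 2 * ((si n).+1%:R^-1 - a n) / rho (si n) < e ^+ 2.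
      by move/cvgr_lt: l3 => /(_ _ e2).
    apply: filterS hev => n hn'.
    rewrite -ltr_sqr ?nnegrE ?(ltW e0) // normrZ exprMn (gtr0_norm (x := (t n)^-1)) ?invr_gt0 //.
    exact: le_lt_trans (pen n) hn'.
  have -> : u = (fun n => (t n)^-1 *: (Phi (xbar + t n *: (xi \o si) n) - Phi xbar) -
      (t n)^-1 *: (Phi (x n) - z (si n))).
    by apply/funext => n; rewrite -xE /u; vec.
  by rewrite -[X in _ --> X]subr0; apply: cvgB.
have [g0 g0E] := fin_num_real (proj1 sybar).
have gzE n : g (Phi xbar + t n *: u n) = (fine (g (z (si n))))%:E by rewrite -zE fineK.
have cl : (fun n => 2 * ((si n).+1%:R^-1 - a n)) @ \oo --> - q.
  have -> : - q = 2 * (0 - 2^-1 * q) by field.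
  by apply: cvgMr; exact: cvgB.
have GE n : fine (g (z (si n))) - g0 - t n * inner (y n) (u n) = G (si n).
  rewrite /G g0E /= -/(y n) -/(y n); congr (_ - _).
  have -> : z (si n) - Phi xbar = t n *: u n by rewrite /u scalerA divff ?gt_eqF // scale1r.
  by rewrite (innerZr (t n)).
have d2 : (semistrict_subderiv2 g (Phi xbar) ybar ('d Phi xbar xl) <= (- q)%:E)%E.
  apply: (semistrict_subderiv2_le_cvg t0 ul yl _ cl).
    by move=> k; apply: M0_subdiff; exact: pM.
  apply: nearW => n; rewrite (diff2_fin (y n) g0E (gzE n)) lee_fin GE.
  rewrite ler_pdivrMr ?mulr_gt0 ?exprn_gt0 //.
  apply: le_trans (Gb n) _; by rewrite le_eqVlt; apply/orP; left; apply/eqP; field.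
have cr : crit_cone g (Phi xbar) ybar ('d Phi xbar xl).
  have [M hM] : exists M, \forall n \near \oo, (si n).+1%:R^-1 - a n <= M.
    exists (0 - 2^-1 * q + 1).
    have l1 : (fun n => (si n).+1%:R^-1 - a n) @ \oo --> 0 - 2^-1 * q by exact: cvgB.
    by apply: (cvgr_le _ l1); rewrite ltrDl.
  apply: (@crit_cone_cvg _ _ g (Phi xbar) ybar _ t u y M sybar t0 ul yl).
  apply: filterS hM => n hn'; rewrite gzE g0E -EFinD lee_fin.
  have h1 : t n ^+ 2 * ((si n).+1%:R^-1 - a n) <= M * t n ^+ 2.
    by rewrite mulrC ler_wpM2r ?sqr_ge0.
  by have := Gb n; rewrite -GE; move: h1; set i := (si n).+1%:R^-1; lra.
rewrite (g_semistable cr) in d2.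
exact: (sosc_contra Lxl xl1 cr d2).
Qed.

(** * Error bounds *)

Lemma grad_bounds : exists C d : R, [/\ 1 <= C, 0 < d <= 1 & forall x, `|x - xbar| <= d ->
  [/\ `|Phi x - Phi xbar| <= C * `|x - xbar|,
      forall y yh, `|yh - ybar| <= 1 ->
        `|gradL x y - gradL xbar yh| <= C * (`|x - xbar| + `|y - yh|) &
      forall y y', `|gradL x y - gradL x y'| <= C * `|y - y'|]].
Proof.
have [K [d [K1 Ky /andP[d0 d1] hloc]]] := local_bounds.
have K0 : 0 <= K by apply: le_trans K1.
have CK : 0 <= K * K by rewrite mulr_ge0.
exists (2 * K + K * K), d; split; [lra|by rewrite d0|] => x xd.
have [h1 _ h3 h4 h5] := hloc x xd.
have s0 := normr_ge0 (x - xbar).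
have s1 : `|x - xbar| <= 1 by apply: le_trans xd d1.
have dPhi h : `|'d Phi x h| <= 2 * K * `|h|.
  have -> : 'd Phi x h = ('d Phi x h - 'd Phi xbar h) + 'd Phi xbar h by rewrite subrK.
  apply: le_trans (ler_normD _ _) _; rewrite mulrDl mul1r mulrDl lerD //.
  by apply: le_trans (h4 h) _; rewrite ler_wpM2r // ler_piMr.
split.
- by apply: le_trans h1 _; rewrite ler_wpM2r //; lra.
- move=> y yh yh1; have y0 := normr_ge0 (y - yh).
  have yhK : `|yh| <= K.
    by rewrite -[yh](subrK ybar) (le_trans (ler_normD _ _)) // (le_trans _ Ky) // addrC lerD2l.
  apply: norm_le_inner; first by rewrite mulr_ge0 // addr_ge0 // mulr_ge0.
  move=> h.
  have expand (a b : R) (u v : Y) : a + inner y u - (b + inner yh v) =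
    (a - b) + inner yh (u - v) + inner (y - yh) u by rewrite innerBr innerBl; ring.
  have -> : inner (gradL x y - gradL xbar yh) h = ('d phi x h - 'd phi xbar h) +
      inner yh ('d Phi x h - 'd Phi xbar h) + inner (y - yh) ('d Phi x h).
    apply: etrans (innerBl _ _ _) _.
    exact: etrans (congr2 (fun a b => a - b) (gradLE phiC2 PhiC2 x y h)
      (gradLE phiC2 PhiC2 xbar yh h)) (expand _ _ _ _).
  have e1 := le_trans (ler_norm _) (h3 h).
  have e2 : inner yh ('d Phi x h - 'd Phi xbar h) <= K * (K * `|x - xbar| * `|h|).
    apply: le_trans (inner_le _ _) _; apply: le_trans (ler_wpM2l (normr_ge0 _) (h4 h)) _.
    by rewrite ler_wpM2r // !mulr_ge0.
  have e3 : inner (y - yh) ('d Phi x h) <= `|y - yh| * (2 * K * `|h|).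
    by apply: le_trans (inner_le _ _) _; rewrite ler_wpM2l.
  have p1 : 0 <= K * `|x - xbar| * `|h| by rewrite !mulr_ge0.
  have p2 : 0 <= K * K * `|y - yh| * `|h| by rewrite !mulr_ge0.
  apply: le_trans (lerD (lerD e1 e2) e3) _; move: p1 p2.
  move: `|x - xbar| `|y - yh| `|h| => s D n p1 p2.
  have -> : (2 * K + K * K) * (s + D) * n =
    (K * s * n + K * (K * s * n) + D * (2 * K * n)) + (K * s * n + K * K * D * n) by ring.
  by rewrite lerDl addr_ge0.
- move=> y y'; apply: norm_le_inner; first by rewrite mulr_ge0 // addr_ge0 // mulr_ge0.
  have expand (a : R) (u : Y) : a + inner y u - (a + inner y' u) = inner (y - y') u.
    by rewrite innerBl; ring.
  move=> h.
  have -> : inner (gradL x y - gradL x y') h = inner (y - y') ('d Phi x h).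
    apply: etrans (innerBl _ _ _) _.
    exact: etrans (congr2 (fun a b => a - b) (gradLE phiC2 PhiC2 x y h)
      (gradLE phiC2 PhiC2 x y' h)) (expand _ _).
  apply: le_trans (inner_le _ _) _; apply: le_trans (ler_wpM2l (normr_ge0 _) (dPhi h)) _.
  rewrite (_ : _ * (_ * `|h|) = 2 * K * `|y - y'| * `|h|); last by ring.
  by rewrite ler_wpM2r // ler_wpM2r // lerDl.
Qed.

Lemma pnorm_fst (p : X * Y) : `|p.1| <= pnorm p.
Proof. by rewrite /pnorm -[leLHS]ger0_norm // -sqrtr_sqr ler_sqrt ?addr_ge0 ?sqr_ge0 // lerDl sqr_ge0. Qed.

Lemma pnorm_snd (p : X * Y) : `|p.2| <= pnorm p.
Proof. by rewrite /pnorm -[leLHS]ger0_norm // -sqrtr_sqr ler_sqrt ?addr_ge0 ?sqr_ge0 // lerDr sqr_ge0. Qed.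

Lemma pnorm_le_sum (p : X * Y) : pnorm p <= `|p.1| + `|p.2|.
Proof.
rewrite /pnorm -[leRHS]ger0_norm ?addr_ge0 // -sqrtr_sqr ler_sqrt ?sqr_ge0 //.
by rewrite sqrrD lerD2r lerDl mulrn_wge0 // mulr_ge0.
Qed.

(* The multiplier mapping is calm in both perturbations, so the dual distance
   is controlled once the primal one is. *)
Lemma dual_error_bound : exists k d : R, [/\ 0 < k, 0 < d & forall x y v w,
  `|x - xbar| <= d -> `|y - ybar| <= d -> `|v| <= d -> `|w| <= d ->
  stat x y v -> subdiff g (Phi x + w) y ->
  exists2 yh, M0 yh & `|y - yh| <= k * (`|v| + `|w| + `|x - xbar|)].
Proof.
have [K [d0 [K1 /andP[d00 d01] hloc]]] := grad_bounds.
have [A [Bn [kc [nA nB kc0 hcalm]]]] := M_calm.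
have [rA /= rA0 hA] : exists2 r : R, 0 < r & forall v w, `|v| < r -> `|w| < r -> A (v, w).
  have [[P Q] /= [/nbhs_norm0P[r1 /= r10 hr1] /nbhs_norm0P[r2 /= r20 hr2]] hPQ] := nA.
  exists (Num.min r1 r2); first by rewrite lt_min r10.
  move=> v w; rewrite !lt_min => /andP[v1 _] /andP[_ w2].
  by apply: (hPQ (v, w)); split => /=; [exact: hr1|exact: hr2].
have [rB /= rB0 hB] : exists2 r : R, 0 < r & forall y, `|y - ybar| < r -> Bn y.
  move: nB => /nbhs_ballP[r /= r0 hr]; exists r => // y hy; apply: hr.
  by rewrite -ball_normE /= distrC.
have K0 : 0 < K by apply: lt_le_trans K1.
pose d := Num.min d0 (Num.min (rB / 2) (rA / (2 * (1 + K)))).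
have d_gt0 : 0 < d by rewrite /d !lt_min d00 !divr_gt0 // mulr_gt0 // addr_gt0.
exists (kc * (2 * K)), d; split => //; first by rewrite !mulr_gt0.
move=> x y v w xd yd vd wd [Tx hv] sy.
have dd0 : d <= d0 by rewrite ge_min lexx.
have drB : d < rB by apply: (@le_lt_trans _ _ (rB / 2)); [rewrite !ge_min lexx orbT|rewrite ltr_pdivrMr // ltr_pMr // ltr1n].
have drA : d + K * d < rA.
  apply: (@le_lt_trans _ _ (rA / 2)); last by rewrite ltr_pdivrMr // ltr_pMr // ltr1n.
  have -> : rA / 2 = (1 + K) * (rA / (2 * (1 + K))) by field; rewrite gt_eqF // addr_gt0.
  by rewrite -{1}[d]mul1r -mulrDl ler_pM2l ?addr_gt0 // !ge_min lexx !orbT.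
have [h1 h2 _] := hloc x (le_trans xd dd0).
have y1 : `|y - ybar| <= 1 by apply: le_trans yd (le_trans dd0 d01).
have {}h2 : `|gradL xbar y - gradL x y| <= K * `|x - xbar|.
  have E : `|x - xbar| + `|y - y| = `|x - xbar| by rewrite subrr normr0 addr0.
  by rewrite distrC; have := h2 y y y1; rewrite E.
set s := `|x - xbar| in h1 h2 xd *.
have s0 : 0 <= s by exact: normr_ge0.
(* The base point is moved from x to xbar, and the change of gradient and of Phi is counted as
   perturbation, which is how |x - xbar| enters the bound. *)
pose v' := v + (gradL xbar y - gradL x y).
pose w' := w + (Phi x - Phi xbar).
have nv' : `|v'| <= `|v| + K * s by rewrite (le_trans (ler_normD _ _)) // lerD2l.
have nw' : `|w'| <= `|w| + K * s by rewrite (le_trans (ler_normD _ _)) // lerD2l.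
have Ks : K * s <= K * d by rewrite ler_pM2l.
have Av' : A (v', w').
  by apply: hA; [apply: le_lt_trans nv' _|apply: le_lt_trans nw' _]; apply: le_lt_trans drA; exact: lerD.
have By : Bn y by apply: hB; apply: le_lt_trans yd _.
have My : multipliers phi Phi g Theta xbar (v', w') y.
  split => /=; last by have -> : Phi xbar + w' = Phi x + w by rewrite /w'; vec.
  apply/(normal_coneE Theta_affine kkt _ Txbar) => h Lh.
  have shift (a b : X) : v + (a - b) - a = v - b by vec.
  rewrite shift.
  by rewrite innerBl hv // subrr.
have [z Mz [b /= b1 yE]] := hcalm _ Av' y (conj My By).
exists z => //; rewrite -yE addrAC subrr add0r normrZ.
have pn : pnorm ((0, 0) - (v', w')) <= `|v'| + `|w'|.
  by apply: le_trans (pnorm_le_sum _) _; rewrite /= !sub0r !normrN.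
have pn0 : 0 <= pnorm ((0, 0) - (v', w') : X * Y) by exact: sqrtr_ge0.
rewrite ger0_norm ?mulr_ge0 ?(ltW kc0) //.
apply: (@le_trans _ _ (kc * pnorm ((0, 0) - (v', w')))).
  by rewrite ler_piMr // mulr_ge0 // ltW.
rewrite -mulrA ler_pM2l //; apply: le_trans pn _.
apply: (@le_trans _ _ (2 * (`|v| + `|w|) + 2 * K * s)).
  have : 0 <= `|v| + `|w| by rewrite addr_ge0.
  by move: nv' nw'; lra.
rewrite [leRHS]mulrDr lerD2r ler_wpM2r ?addr_ge0 // ler_pMr //.
Qed.

(* A failing sequence, normalised by |x - xbar|, produces an element of the
   semi-strict graphical derivative that contradicts the SOSC. *)
Lemma primal_error_bound : exists k d : R, [/\ 0 < k, 0 < d & forall x y v w,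
  `|x - xbar| <= d -> `|y - ybar| <= d -> `|v| <= d -> `|w| <= d ->
  stat x y v -> subdiff g (Phi x + w) y -> `|x - xbar| <= k * (`|v| + `|w|)].
Proof.
have [k2 [d2 [k20 d20 hdual]]] := dual_error_bound.
have [Bp sp] := soc; have [BP sP] := sOc.
apply: contrapT => hno.
have hn (n : nat) : exists p : (X * Y) * (X * Y), let: ((x, y), (v, w)) := p in
   [/\ [/\ `|x - xbar| <= d2 / n.+1%:R, `|y - ybar| <= d2 / n.+1%:R, `|v| <= d2 / n.+1%:R & `|w| <= d2 / n.+1%:R],
   stat x y v, subdiff g (Phi x + w) y & n.+1%:R * (`|v| + `|w|) < `|x - xbar|].
  apply: contrapT => hnn; apply: hno; exists n.+1%:R, (d2 / n.+1%:R).
  split; rewrite ?divr_gt0 ?ltr0n // => x y v w h1 h2 h3 h4 h5 h6.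
  by rewrite leNgt; apply/negP => h7; apply: hnn; exists ((x, y), (v, w)).
have [p hp] := choice hn.
pose x0 n := (p n).1.1; pose y0 n := (p n).1.2; pose v0 n := (p n).2.1; pose w0 n := (p n).2.2.
have {}hp n : [/\ [/\ `|x0 n - xbar| <= d2 / n.+1%:R, `|y0 n - ybar| <= d2 / n.+1%:R,
     `|v0 n| <= d2 / n.+1%:R & `|w0 n| <= d2 / n.+1%:R],
   stat (x0 n) (y0 n) (v0 n), subdiff g (Phi (x0 n) + w0 n) (y0 n) &
   n.+1%:R * (`|v0 n| + `|w0 n|) < `|x0 n - xbar|].
  by have := hp n; rewrite /x0 /y0 /v0 /w0; case: (p n) => -[? ?] [? ?].
have dn n : d2 / n.+1%:R <= d2 by rewrite ler_pdivrMr ?ltr0n // ler_peMr ?ler1n // ltW.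
(* The dual bound supplies a multiplier within O(s n) of [y0 n], which keeps the dual quotients
   bounded; the radii d2 / (n + 1) stay in its domain. *)
have hyh n : exists yh, M0 yh /\ `|y0 n - yh| <= k2 * (`|v0 n| + `|w0 n| + `|x0 n - xbar|).
  have [[h1 h2 h3 h4] h5 h6 _] := hp n.
  have [||||yh Myh hyh] := hdual _ _ _ _ _ _ _ _ h5 h6; last by exists yh.
  - exact: le_trans h1 (dn n).
  - exact: le_trans h2 (dn n).
  - exact: le_trans h3 (dn n).
  - exact: le_trans h4 (dn n).
have [yh0 hyh0] := choice hyh.
pose s n := `|x0 n - xbar|.
have vws n : `|v0 n| + `|w0 n| <= s n * n.+1%:R^-1.
  by have [_ _ _ h] := hp n; rewrite ler_pdivlMr ?ltr0n // mulrC ltW.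
have s0 n : 0 < s n.
  have [_ _ _ h] := hp n; apply: le_lt_trans h; by rewrite mulr_ge0 // addr_ge0.
have vws1 n : `|v0 n| + `|w0 n| <= s n.
  by apply: le_trans (vws n) _; rewrite ler_piMr ?(ltW (s0 n)) // invf_le1 ?ltr0n // ler1n.
pose xi n := (s n)^-1 *: (x0 n - xbar).
have xi1 n : `|xi n| = 1 by rewrite normrZ gtr0_norm ?invr_gt0 // mulVf // gt_eqF.
pose et n := (s n)^-1 *: (y0 n - yh0 n).
have yyh n : `|y0 n - yh0 n| <= k2 * 2 * s n.
  have [_ h] := hyh0 n; apply: le_trans h _; rewrite -mulrA ler_pM2l //.
  by have := vws1 n; rewrite -/(s n); lra.
have et1 n : `|et n| <= k2 * 2.
  by rewrite normrZ gtr0_norm ?invr_gt0 // ler_pdivrMl // mulrC.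
have xi1' n : `|xi n| <= 1 by rewrite xi1.
have [s1 [xl [s1n xlc1]]] := bounded_subsequence xi1'.
have [s2 [el [s2n elc]]] := bounded_subsequence (fun n => et1 (s1 n)).
pose si n := s1 (s2 n).
have sin n : (n <= si n)%N by rewrite (leq_trans (s2n n)).
have xlc : (xi \o si) @ \oo --> xl := cvg_subseq s2n xlc1.
pose t n := s (si n); pose x n := x0 (si n); pose y n := y0 (si n).
pose v n := v0 (si n); pose w n := w0 (si n); pose yh n := yh0 (si n).
have tp n : 0 < t n by exact: s0.
have Myh n : M0 (yh n) by have [] := hyh0 (si n).
have inv_si : (fun n => (si n).+1%:R^-1 : R) @ \oo --> 0.
  exact: (cvg_subseq sin (@cvg_harmonic R)).
have dinv : (fun n => d2 / (si n).+1%:R) @ \oo --> 0.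
  by rewrite -(mulr0 d2); apply: cvgMr.
have t0 : down0 t.
  split => //; apply: (squeeze_cvgr _ (cvg_cst 0) dinv); apply: nearW => n.
  by rewrite (ltW (tp n)) /=; have [[]] := hp (si n).
have tc : t @ \oo --> 0 by case: t0.
have yl : y @ \oo --> ybar.
  apply/subr_cvg0/norm_cvg0P; apply: (squeeze_cvgr _ (cvg_cst 0) dinv); apply: nearW => n.
  by rewrite normr_ge0 /=; have [[]] := hp (si n).
have yyhl : (fun n => y n - yh n) @ \oo --> (0 : Y).
  apply/norm_cvg0P; have l1 : (fun n => k2 * 2 * t n) @ \oo --> k2 * 2 * 0 by exact: cvgMr.
  rewrite mulr0 in l1.
  apply: (squeeze_cvgr _ (cvg_cst 0) l1); apply: nearW => n.
  by rewrite normr_ge0 /=; exact: yyh.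
have yhl : yh @ \oo --> ybar.
  have -> : yh = (fun n => y n - (y n - yh n)) by apply/funext => n; vec.
  by rewrite -[X in _ --> X]subr0; exact: cvgB.
have vt0 : (fun n => (t n)^-1 *: v n) @ \oo --> (0 : X).
  apply/norm_cvg0P; apply: (squeeze_cvgr _ (cvg_cst 0) inv_si); apply: nearW => n.
  rewrite normr_ge0 /= normrZ gtr0_norm ?invr_gt0 // ler_pdivrMl //.
  by apply: le_trans (vws (si n)); rewrite lerDl.
have wt0 : (fun n => (t n)^-1 *: w n) @ \oo --> (0 : Y).
  apply/norm_cvg0P; apply: (squeeze_cvgr _ (cvg_cst 0) inv_si); apply: nearW => n.
  rewrite normr_ge0 /= normrZ gtr0_norm ?invr_gt0 // ler_pdivrMl //.
  by apply: le_trans (vws (si n)); rewrite lerDr.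
have xE n : x n = xbar + t n *: (xi \o si) n.
  by rewrite /xi /= scalerA divff ?gt_eqF // scale1r addrC subrK.
have Lxi n : L (xi n).
  apply: (lin_spaceZ Theta_affine kkt); apply: (Theta_sub Theta_affine kkt) => //.
  by have [_ []] := hp n.
have Lxl : L xl by apply: (L_closed (u := xi \o si)) => // n; exact: Lxi.
have xl1 : `|xl| = 1.
  have h1 : (fun n => `|(xi \o si) n|) @ \oo --> `|xl| by exact: cvg_norm.
  have E : (fun n => `|(xi \o si) n|) = (fun=> 1) by apply/funext => n; exact: xi1.
  by rewrite E in h1; exact: cvg_unique h1 (cvg_cst _).
pose q := inner (hess_L phi Phi xbar ybar xl) xl.
have qE : q = Bp xl xl + inner ybar (BP xl xl) by exact: hessLE.
pose u n := Phi (x n) + w n.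
have ul : (fun n => (t n)^-1 *: (u n - Phi xbar)) @ \oo --> 'd Phi xbar xl.
  have l1 := quotient1_cvg t0 xlc sP.
  have -> : (fun n => (t n)^-1 *: (u n - Phi xbar)) =
     (fun n => (t n)^-1 *: (Phi (xbar + t n *: (xi \o si) n) - Phi xbar) + (t n)^-1 *: w n).
    by apply/funext => n; rewrite -xE /u; vec.
  by rewrite -[X in _ --> X]addr0; exact: cvgD.
have ub : u @ \oo --> Phi xbar.
  have -> : u = (fun n => Phi xbar + t n *: ((t n)^-1 *: (u n - Phi xbar))).
    by apply/funext => n; rewrite scalerA divff ?gt_eqF // scale1r addrC subrK.
  rewrite -[X in _ --> X]addr0 -[X in _ --> _ + X](scale0r ('d Phi xbar xl)).
  by apply: cvgD; [exact: cvg_cst|exact: cvgZ].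
have hst : semistrict_graphical_deriv (subdiff g) (Phi xbar) ybar ('d Phi xbar xl) el.
  exists t, u, y, yh; split => //.
  by move=> n; split; [have [] := hp (si n)|exact: M0_subdiff].
have cr := semistrict_graphical_deriv_crit sybar hst.
have d2le := semistrict_graphical_deriv_ge g_proper g_convex sybar g_semistable hii hst.
(* Stationarity at the moving point minus stationarity at xbar with [yh n], tested with xi and
   divided by t. Hence <el, dPhi xl> = - q, and [d2le] contradicts the SOSC. *)
have lim0 : q + inner el ('d Phi xbar xl) = 0.
  have l1 : (fun n => inner ((t n)^-1 *: v n) ((xi \o si) n)) @ \oo --> inner 0 xl by exact: continuous_inner.
  have lp := diff_quotient_cvg t0 xlc sp xlc.
  have lP := diff_quotient_cvg t0 xlc sP xlc.
  have l2 : (fun n => (t n)^-1 * ('d phi (xbar + t n *: (xi \o si) n) ((xi \o si) n) - 'd phi xbar ((xi \o si) n)) +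
     (inner (y n) ((t n)^-1 *: ('d Phi (xbar + t n *: (xi \o si) n) ((xi \o si) n) - 'd Phi xbar ((xi \o si) n))) +
      inner (et (si n)) ('d Phi xbar ((xi \o si) n)))) @ \oo -->
      Bp xl xl + (inner ybar (BP xl xl) + inner el ('d Phi xbar xl)).
    apply: cvgD => //; apply: cvgD; apply: continuous_inner => //.
    exact: (continuous_cvg _ (@findim_linear_continuous _ _ _ ('d Phi xbar) xl) xlc).
  have E : (fun n => inner ((t n)^-1 *: v n) ((xi \o si) n)) =
    (fun n => (t n)^-1 * ('d phi (xbar + t n *: (xi \o si) n) ((xi \o si) n) - 'd phi xbar ((xi \o si) n)) +
     (inner (y n) ((t n)^-1 *: ('d Phi (xbar + t n *: (xi \o si) n) ((xi \o si) n) - 'd Phi xbar ((xi \o si) n))) +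
      inner (et (si n)) ('d Phi xbar ((xi \o si) n)))).
    apply/funext => n; rewrite -xE.
    have [_ [_ hv] _ _] := hp (si n).
    have expand (i a b : R) (z zh A B : Y) : b + inner zh B = 0 -> i * (a + inner z A) =
      i * (a - b) + (inner z (i *: (A - B)) + inner (i *: (z - zh)) B).
      move=> h0; rewrite innerZr innerZl innerBr innerBl.
      have -> : b = - inner zh B by lra.
      by ring.
    rewrite innerZl -/(v n) hv; last exact: Lxi.
    rewrite (gradLE phiC2 PhiC2); apply: expand.
    exact: phi_stat (Myh n) (Lxi (si n)).
  rewrite qE -addrA -(inner0l xl); rewrite E in l1; exact: cvg_unique l2 l1.
apply: (sosc_contra Lxl xl1 cr (q := q)) => //.
by apply: le_trans d2le _; rewrite lee_fin; lra.
Qed.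

Lemma error_bound : exists k d : R, [/\ 0 < k, 0 < d & forall x y v w,
  `|x - xbar| <= d -> `|y - ybar| <= d -> `|v| <= d -> `|w| <= d ->
  stat x y v -> subdiff g (Phi x + w) y ->
  exists2 yh, M0 yh & `|x - xbar| + `|y - yh| <= k * (`|v| + `|w|)].
Proof.
have [k1 [d1 [k10 d10 h1]]] := primal_error_bound.
have [k2 [d2 [k20 d20 h2]]] := dual_error_bound.
exists (k1 + k2 * (1 + k1)), (Num.min d1 d2); split.
- by rewrite addr_gt0 // mulr_gt0 // addr_gt0.
- by rewrite lt_min d10.
move=> x y v w; rewrite !le_min => /andP[x1 x2] /andP[y1 y2] /andP[v1 v2] /andP[w1 w2] st sy.
have e1 := h1 _ _ _ _ x1 y1 v1 w1 st sy.
have [yh Myh e2] := h2 _ _ _ _ x2 y2 v2 w2 st sy.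
exists yh => //; rewrite mulrDl -mulrA; apply: lerD (e1) _.
apply: le_trans e2 _; rewrite ler_pM2l // mulrDl mul1r.
by rewrite lerD2l.
Qed.

(** * The residual *)

Local Notation res := (residual phi Phi g Theta).

Lemma residual_fin x y : res x y \is a fin_num -> Theta x.
Proof. by move=> h; apply: contrapT => nT; move: h; rewrite /residual dist_off_Theta. Qed.

Lemma residual_stat x y : Theta x -> exists2 v, stat x y v &
  res x y = (`|v| + `|Phi x - proxr g 1 (Phi x + y)|)%:E.
Proof.
move=> Tx; have [v sv E] := dist_stationary Theta_affine kkt y Tx.
by exists v => //; rewrite /residual E prox_proxr -EFinD.
Qed.

Lemma residual_le x y v : stat x y v ->
  fine (res x y) <= `|v| + `|Phi x - proxr g 1 (Phi x + y)|.
Proof.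
move=> sv; have [Tx _] := sv; have [v' _ E] := residual_stat y Tx.
rewrite E /= -lee_fin -E /residual prox_proxr EFinD leeD2r //.
exact: (dist_le_stationary Theta_affine kkt).
Qed.

Lemma residual_ge0 x y : 0 <= fine (res x y).
Proof.
have [Tx|nTx] := pselect (Theta x); last by rewrite /residual dist_off_Theta.
by have [v _ ->] := residual_stat y Tx; rewrite /= addr_ge0.
Qed.

Lemma prox_shift y : subdiff g (Phi xbar) y -> proxr g 1 (Phi xbar + y) = Phi xbar.
Proof.
move=> sy; apply: (proxr_unique gc) => //.
by rewrite addrAC subrr add0r scale1r.
Qed.

(** A KKT pair makes Phi xbar a fixed point of the proximal map, by [prox_shift]; nonexpansiveness
    and the Lipschitz bound of the gradient measure the departure from it. *)
Lemma residual_upper : exists C d : R, [/\ 0 < C, 0 < d & forall x y yh, Theta x ->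
  `|x - xbar| <= d -> M0 yh -> `|yh - ybar| <= d ->
  fine (res x y) <= C * (`|x - xbar| + `|y - yh|)].
Proof.
have [C [d [C1 /andP[d0 d1] hb]]] := grad_bounds.
exists (3 * C + 1), d; split => //; first by lra.
move=> x y yh Tx xd Myh yhd; have [h1 h2 _] := hb x xd.
have sv : stat x y (gradL x y - gradL xbar yh).
  split => [|h Lh]; first exact: Tx.
  apply: etrans (innerBl _ _ _) _.
  exact: etrans (congr2 (fun a b => a - b) erefl (M0_stat Myh Lh)) (subr0 _).
apply: le_trans (residual_le sv) _.
have e1 := h2 y yh (le_trans yhd d1).
have e2 : `|Phi x - proxr g 1 (Phi x + y)| <= `|Phi x - Phi xbar| + (`|Phi x - Phi xbar| + `|y - yh|).
  have -> : Phi x - proxr g 1 (Phi x + y) = (Phi x - Phi xbar) +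
    (proxr g 1 (Phi xbar + yh) - proxr g 1 (Phi x + y)).
    by rewrite (prox_shift (M0_subdiff Myh)); vec.
  apply: le_trans (ler_normD _ _) _; rewrite lerD2l; apply: le_trans (proxr_lip gc _ _ _) _ => //.
  rewrite distrC; have -> : Phi x + y - (Phi xbar + yh) = (Phi x - Phi xbar) + (y - yh) by vec.
  exact: ler_normD.
have y0 := normr_ge0 (y - yh); have x0 := normr_ge0 (x - xbar).
have p : `|y - yh| <= C * `|y - yh| by rewrite ler_peMl.
move: e1 e2 h1 p y0 x0; lra.
Qed.

(** The residual is read as a perturbation of the KKT system: with p the proximal point and w = p -
    Phi x, y - w is a subgradient at Phi x + w. [error_bound] is applied to the multiplier y - w,
    the change of gradient going into v'. *)
Lemma residual_error_bound : exists k d : R, [/\ 0 < k, 0 < d & forall x y, Theta x ->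
  `|x - xbar| <= d -> `|y - ybar| <= d ->
  exists2 yh, M0 yh & `|x - xbar| + `|y - yh| <= k * fine (res x y)].
Proof.
have [k [d1 [k0 d10 heb]]] := error_bound.
have [C [d2 [C0 d20 hru]]] := residual_upper.
have [G [d3 [G1 /andP[d30 d31] hgb]]] := grad_bounds.
(* By [residual_upper] the residual is at most 2 C e near the reference point, so v', w and the
   shifted multiplier stay within d1. *)
pose e := Num.min d2 (Num.min d3 (d1 / (2 * C * (1 + G) + 1))).
have D0 : 0 < 2 * C * (1 + G) + 1.
  by rewrite addr_gt0 // mulr_gt0 ?mulr_gt0 //; lra.
have e0 : 0 < e by rewrite !lt_min d20 d30 divr_gt0.
have ed2 : e <= d2 by rewrite ge_min lexx.
have ed3 : e <= d3 by rewrite !ge_min lexx orbT.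
have ed1 : (2 * C * (1 + G) + 1) * e <= d1.
  by rewrite mulrC -ler_pdivlMr // !ge_min lexx !orbT.
exists (k * (1 + G) + 1), e; split => //.
  by rewrite addr_gt0 // mulr_gt0 //; lra.
move=> x y Tx xe ye; have [h1 h2 h3] := hgb x (le_trans xe ed3).
have ru : fine (res x y) <= C * (`|x - xbar| + `|y - ybar|).
  by apply: hru => //; [exact: le_trans xe ed2|exact: M0ybar|rewrite subrr normr0 ltW].
have [v [_ hv] rE] := residual_stat y Tx; rewrite rE /= in ru *.
set p := proxr g 1 (Phi x + y) in ru *.
pose w := p - Phi x.
have nw : `|Phi x - p| = `|w| by rewrite distrC.
rewrite nw in ru *.
pose v' := v + (gradL x (y - w) - gradL x y).
have nv' : `|v'| <= `|v| + G * `|w|.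
  apply: le_trans (ler_normD _ _) _; rewrite lerD2l; apply: le_trans (h3 _ _) _.
  by rewrite addrAC subrr add0r normrN.
have v0 := normr_ge0 v; have w0 := normr_ge0 w.
have CC : C * (`|x - xbar| + `|y - ybar|) <= C * (e + e) by rewrite ler_pM2l // lerD.
have vw2 : `|v| + `|w| <= 2 * C * e by move: ru CC; lra.
have Gvw : G * (`|v| + `|w|) <= G * (2 * C * e) by rewrite ler_wpM2l //; lra.
have Gv : 0 <= G * `|v| by rewrite mulr_ge0 //; lra.
have GCe : 0 <= G * (2 * C * e).
  by rewrite mulr_ge0 ?(le_trans _ G1) // mulr_ge0 ?(ltW e0) // mulr_ge0 // ltW.
have yw : `|y - w - ybar| <= d1.
  rewrite addrAC; apply: le_trans (ler_normB _ _) _.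
  move: ye vw2 v0 GCe ed1; lra.
have [||||||yh Myh hyh] := heb x (y - w) v' w.
- move: xe ed1 GCe vw2 v0 w0; lra.
- exact: yw.
- move: nv' vw2 Gvw Gv v0 w0 ed1 e0; lra.
- move: vw2 v0 w0 GCe e0 ed1; lra.
- split; first exact: Tx.
  move=> h Lh; rewrite /v' innerDl (hv h Lh) innerBl addrC; exact: subrK.
- have -> : Phi x + w = p by rewrite /w; vec.
  have := proxr_subdiff gc (Phi x + y) (ltr01 : 0 < 1 :> R); rewrite -/p scale1r.
  by have -> : Phi x + y - p = y - w by rewrite /w; vec.
exists yh => //.
have : `|y - yh| <= `|y - w - yh| + `|w|.
  have -> : y - yh = (y - w - yh) + w by vec.
  exact: ler_normD.
have : k * (`|v'| + `|w|) <= k * (`|v| + G * `|w| + `|w|) by rewrite ler_pM2l // lerD2r.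
have : 0 <= k * (G * `|v|) by rewrite mulr_ge0 // ltW.
move: hyh v0 w0; lra.
Qed.

(** * Existence of augmented Lagrangian steps *)

Lemma al_mult_base rho yh : 0 < rho -> M0 yh -> al_mult Phi g rho xbar yh = yh.
Proof.
move=> r0 My; rewrite /al_mult /al_prox (proxr_unique gc (p := Phi xbar)) //.
  by rewrite subrr scaler0 addr0.
have -> : rho *: (Phi xbar + rho^-1 *: yh - Phi xbar) = yh.
  by rewrite addrAC subrr add0r scalerA divff ?gt_eqF // scale1r.
exact: M0_subdiff.
Qed.

Lemma al_mono x y rho0 rho : 0 < rho0 -> rho0 <= rho -> AL x y rho0 <= AL x y rho.
Proof.
move=> r0 rr; have r1 := lt_le_trans r0 rr.
apply: le_trans (al_le phi Phi gc x y r0 (proxr_fin gc (Phi x + rho^-1 *: y) r1)) _.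
rewrite (alE phi Phi gc x y r1) -/(al_prox Phi g rho x y) lerD2l.
by rewrite ler_wpM2r ?sqr_ge0 // ler_pM2l.
Qed.

Lemma al_le_pstar rho y : 0 < rho -> AL xbar y rho <= p_star.
Proof.
move=> r0; have [gu _] := sybar.
apply: le_trans (al_le phi Phi gc xbar y r0 gu) _.
by rewrite subrr inner0r normr0 expr0n /= mulr0 !addr0.
Qed.

(* The augmented Lagrangian is an infimum over z of functions affine in y, and
   al_prox rho x y is the minimising z: this compares its values at y and yh. *)
Lemma al_descent rho0 l d : 0 < rho0 -> (forall yh x, M0 yh -> `|yh - ybar| <= d -> Theta x ->
    `|x - xbar| <= d -> p_star + l * `|x - xbar| ^+ 2 <= AL x yh rho0) ->
  forall rho x y yh, rho0 <= rho -> M0 yh -> `|yh - ybar| <= d -> Theta x -> `|x - xbar| <= d ->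
  AL x y rho <= AL xbar y rho ->
  rho * l * `|x - xbar| ^+ 2 <= `|y - yh| ^+ 2 + `|al_mult Phi g rho x y - yh| * `|y - yh|.
Proof.
move=> r0 hg rho x y yh rr My yd Tx xd le1; have r1 := lt_le_trans r0 rr.
(* The chain is p_star + l s^2 <= AL x yh rho0 <= AL x yh rho <= AL x y rho + <yh - y, Phi x - p> <=
   p_star + <yh - y, Phi x - p>, with s = |x - xbar|. Since rho (Phi x - p) is the multiplier step,
   multiplying by rho gives the claim. *)
have e1 := hg yh x My yd Tx xd.
have e2 := al_mono x yh r0 rr.
have e3 := al_le_pstar y r1.
have e4 := al_le phi Phi gc x yh r1 (proxr_fin gc (Phi x + rho^-1 *: y) r1).
have e5 := alE phi Phi gc x y r1.
rewrite -/(al_prox Phi g rho x y) in e4.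
set p := al_prox Phi g rho x y in e4 e5.
have aE : al_mult Phi g rho x y = y + rho *: (Phi x - p) by [].
set a := al_mult Phi g rho x y in aE *.
have e6 : rho * inner (yh - y) (Phi x - p) <= `|y - yh| ^+ 2 + `|a - yh| * `|y - yh|.
  rewrite -innerZr; have -> : rho *: (Phi x - p) = (a - yh) - (y - yh) by rewrite aE; vec.
  rewrite innerBr; have -> : inner (yh - y) (y - yh) = - `|y - yh| ^+ 2.
    by rewrite normr_inner -innerNl opprB.
  have := inner_le (yh - y) (a - yh); rewrite distrC mulrC; lra.
apply: le_trans e6; rewrite -mulrA ler_pM2l //.
by move: e1 e2 e3 e4 e5 le1; rewrite innerBl; lra.
Qed.

Lemma al_local_min rho x y d : 0 < rho -> Theta x -> `|x - xbar| < d ->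
  (forall x', Theta x' -> `|x' - xbar| <= d -> AL x y rho <= AL x' y rho) ->
  stat x (al_mult Phi g rho x y) 0.
Proof.
move=> r0 Tx xd hmin; split; first exact: Tx.
move=> h Lh; rewrite inner0l; have [dF dE] := al_diff phiC2 PhiC2 gc x y r0.
rewrite -dE; apply/esym.
have h0 : 0 < `|h| + 1 by rewrite ltr_wpDl.
apply: (diff_min0 dF (d := (d - `|x - xbar|) / (`|h| + 1))).
  by rewrite divr_gt0 // subr_gt0.
move=> t td; apply: hmin.
  by apply: (Theta_add Theta_affine kkt) => //; exact: (lin_spaceZ Theta_affine kkt).
rewrite addrAC; apply: le_trans (ler_normD _ _) _; rewrite normrZ -lerBrDl.
apply: le_trans (_ : `|t| * (`|h| + 1) <= _); first by rewrite ler_wpM2l // lerDl.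
by rewrite -ler_pdivlMr // ltW.
Qed.

Lemma al_minimizer rho y d : 0 < rho -> 0 <= d -> exists x, [/\ Theta x, `|x - xbar| <= d &
  forall x', Theta x' -> `|x' - xbar| <= d -> AL x y rho <= AL x' y rho].
Proof.
move=> r0 d0; pose A := [set x | `|x - xbar| <= d] `&` Theta.
have cA : compact A by apply: compact_closedI; [exact: compact_closed_ball|exact: (Theta_closed Theta_affine kkt)].
have neA : A !=set0 by exists xbar; split => //=; rewrite subrr normr0.
have cF : {within A, continuous (fun x => AL x y rho)}.
  apply: continuous_subspaceT => x; apply: differentiable_continuous.
  by have [] := al_diff phiC2 PhiC2 gc x y r0.
have [x] := compact_EVT_min neA cA cF; rewrite inE => -[xd Tx] hx.
by exists x; split => // x' Tx' xd'; apply: hx; rewrite inE.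
Qed.

(** Here a, the distance of the new multiplier, may grow like rho K s. If D < s, inserting this
    bound makes every term of the right side at most a multiple of rho s D, and rho cancels against
    the left side. *)
Lemma primal_step_arith (rho0 rho l K s D a : R) : 0 < rho0 -> rho0 <= rho -> 0 < l ->
  0 <= K -> 0 <= s -> 0 <= D -> 0 <= a -> rho * l * s ^+ 2 <= D ^+ 2 + a * D -> a <= rho * K * s + D ->
  s <= ((2 / rho0 + K) / l + 1) * D.
Proof.
move=> r0 rr l0 K0 s0 D0 a0 h1 h2.
have r1 := lt_le_trans r0 rr.
have c0 : 0 <= (2 / rho0 + K) / l by rewrite divr_ge0 ?addr_ge0 ?divr_ge0 // ltW.
have [sD|Ds] := leP s D; first by rewrite mulrDl mul1r ler_wpDl // mulr_ge0.
have sp : 0 < s by exact: le_lt_trans Ds.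
apply: (@le_trans _ _ ((2 / rho0 + K) / l * D)); last by rewrite [leRHS]mulrDl lerDl mul1r.
rewrite mulrAC ler_pdivlMr // -(ler_pM2r sp) -(ler_pM2l r1).
have e1 : a * D <= (rho * K * s + D) * D by rewrite ler_wpM2r.
have e2 : D * D <= D * s by rewrite ler_wpM2l // ltW.
have e3 : 1 * (D * s) <= rho / rho0 * (D * s).
  by rewrite ler_wpM2r ?mulr_ge0 // ler_pdivlMr // mul1r.
have -> : rho * (s * l * s) = rho * l * s ^+ 2 by ring.
have -> : rho * ((2 / rho0 + K) * D * s) = 2 * (rho / rho0 * (D * s)) + rho * K * s * D by ring.
move: h1 e1 e2 e3; rewrite expr2; set u := rho / rho0 * (D * s); lra.
Qed.

(** The first estimate replaces rho s^2 by (D^2 + a D) / l, which removes rho from the second. The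
    term in a^2 D that this creates is absorbed into a^2 thanks to 8 K D <= l. *)
Lemma dual_step_arith (rho l K2 K s D a : R) : 0 < rho -> 0 < l ->
  0 <= K -> 0 <= K2 -> 0 <= D -> 0 <= a -> rho * l * s ^+ 2 <= D ^+ 2 + a * D ->
  a ^+ 2 <= a * D + rho * ((K2 + 2 * K * a) * s ^+ 2) -> 8 * K * D <= l ->
  a <= 4 * (2 + K2 / l) * D.
Proof.
move=> r0 l0 K0 K20 D0 a0 h1 h2 h3.
have k0 : 0 <= K2 / l by rewrite divr_ge0 // ltW.
have [aD|Da] := leP a D.
  by apply: le_trans aD _; rewrite ler_peMl //; lra.
have ap : 0 < a by exact: le_lt_trans Da.
rewrite -(ler_pM2l ap).
have e1 : (K2 + 2 * K * a) / l * (rho * l * s ^+ 2) <= (K2 + 2 * K * a) / l * (D ^+ 2 + a * D).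
  by rewrite ler_wpM2l // divr_ge0 ?addr_ge0 ?mulr_ge0 // ltW.
have e2 : (K2 + 2 * K * a) / l * (rho * l * s ^+ 2) = rho * ((K2 + 2 * K * a) * s ^+ 2).
  by field; rewrite gt_eqF.
have e3 : (K2 + 2 * K * a) / l * (D ^+ 2 + a * D) =
   K2 / l * (D * D) + K2 / l * (a * D) + 2 * K * D / l * (a * D) + 2 * K * D / l * (a * a).
  by field; rewrite gt_eqF.
have e4 : 2 * K * D / l <= 4^-1 by rewrite ler_pdivrMr //; lra.
have aD0 : 0 <= a * D by rewrite mulr_ge0.
have e5 : 2 * K * D / l * (a * D) <= 4^-1 * (a * D) by rewrite ler_wpM2r.
have e6 : 2 * K * D / l * (a * a) <= 4^-1 * (a * a) by rewrite ler_wpM2r // mulr_ge0.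
have e7 : K2 / l * (D * D) <= K2 / l * (a * D) by rewrite ler_wpM2l // ler_wpM2r // ltW.
have kaD : 0 <= K2 / l * (a * D) by rewrite mulr_ge0.
have -> : a * (4 * (2 + K2 / l) * D) = 8 * (a * D) + 4 * (K2 / l * (a * D)) by ring.
move: h2 e1 e5 e6 e7 aD0 kaD; rewrite e2 e3 !expr2.
set p := K2 / l * (a * D); set q := _ * (a * D); set r := _ * (D * D); set t := _ * (a * a); lra.
Qed.

(* Testing stationarity at x and at xbar with x - xbar bounds the component of
   the dual step along the range of the derivative. *)
Lemma dual_step_inner K x y yh : 0 <= K -> `|yh| <= K -> M0 yh -> stat x y 0 ->
  `|Phi x - Phi xbar - 'd Phi xbar (x - xbar)| <= K * `|x - xbar| ^+ 2 ->
  (forall h, `|'d phi x h - 'd phi xbar h| <= K * `|x - xbar| * `|h|) ->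
  (forall h, `|'d Phi x h - 'd Phi xbar h| <= K * `|x - xbar| * `|h|) ->
  inner (y - yh) (Phi x - Phi xbar) <= (K + K * K + 2 * K * `|y - yh|) * `|x - xbar| ^+ 2.
Proof.
move=> K0 yhK My [Tx st] h2 h3 h4; set h := x - xbar in h2 h3 h4 *.
have Lh : L h by exact: (Theta_sub Theta_affine kkt).
have := st h Lh; rewrite inner0l (gradLE phiC2 PhiC2) => st1.
have st0 := phi_stat My Lh.
have expand (a b : R) (u v : Y) : b + inner yh v = 0 -> 0 = a + inner y u ->
    inner (y - yh) v = - (a - b) - inner (y - yh) (u - v) - inner yh (u - v).
  by move=> b0 a0; rewrite !innerBl !innerBr; lra.
have E := expand _ _ _ _ st0 st1.
have -> : Phi x - Phi xbar = (Phi x - Phi xbar - 'd Phi xbar h) + 'd Phi xbar h by rewrite subrK.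
rewrite innerDr E; set a := y - yh.
have e1 : inner a (Phi x - Phi xbar - 'd Phi xbar h) <= `|a| * (K * `|h| ^+ 2).
  by apply: le_trans (inner_le _ _) _; rewrite ler_wpM2l.
have e2 : - ('d phi x h - 'd phi xbar h) <= K * `|h| * `|h|.
  by apply: le_trans (ler_norm _) _; rewrite normrN.
have e3 : - inner a ('d Phi x h - 'd Phi xbar h) <= `|a| * (K * `|h| * `|h|).
  rewrite -innerNl; apply: le_trans (inner_le _ _) _; rewrite normrN ler_wpM2l //.
have e4 : - inner yh ('d Phi x h - 'd Phi xbar h) <= K * (K * `|h| * `|h|).
  rewrite -innerNl; apply: le_trans (inner_le _ _) _; rewrite normrN; apply: ler_pM => //.
have -> : (K + K * K + 2 * K * `|a|) * `|h| ^+ 2 = `|a| * (K * `|h| ^+ 2) +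
  (K * `|h| * `|h| + `|a| * (K * `|h| * `|h|) + K * (K * `|h| * `|h|)) by ring.
by rewrite lerD // !lerD.
Qed.

(* An exact minimiser of the augmented Lagrangian over a small ball around xbar
   is interior, so it is an exact solution of the inner problem. *)
Lemma alm_step : exists rho0 C d : R, [/\ 0 < rho0, 0 < C, 0 < d & forall rho y yh,
  rho0 <= rho -> M0 yh -> `|yh - ybar| <= d -> `|y - yh| <= d ->
  exists x, [/\ stat x (al_mult Phi g rho x y) 0, `|x - xbar| <= C * `|y - yh| &
    `|al_mult Phi g rho x y - yh| <= C * `|y - yh| ] ].
Proof.
have [rho0 [l [dg [r0 l0 dg0 hg]]]] := growth.
have [K [dl [K1 Ky /andP[dl0 dl1] hloc]]] := local_bounds.
have K0 : 0 < K by apply: lt_le_trans K1.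
pose C1 := (2 / rho0 + K) / l + 1.
pose C2 := 4 * (2 + (K + K * K) / l).
have C10 : 0 < C1 by rewrite ltr_wpDl // divr_ge0 ?(ltW l0) // addr_ge0 ?(ltW K0) // divr_ge0 // ltW.
have KK0 : 0 <= K + K * K by rewrite addr_ge0 ?mulr_ge0 // ltW.
have C20 : 0 < C2 by rewrite mulr_gt0 // ltr_wpDr // divr_ge0 // ltW.
pose r := Num.min dg dl.
have rp : 0 < r by rewrite lt_min dg0.
have rg : r <= dg by rewrite ge_min lexx.
have rl : r <= dl by rewrite ge_min lexx orbT.
(* The bound r / (2 C1) puts the minimiser within r / 2 of xbar, hence in the interior; l / (8 K) is
   the smallness required by [dual_step_arith]. *)
pose d := Num.min r (Num.min (r / (2 * C1)) (l / (8 * K))).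
have d0 : 0 < d by rewrite /d lt_min rp lt_min !divr_gt0 // mulr_gt0.
exists rho0, (C1 + C2), d; split => //; first by rewrite addr_gt0.
move=> rho y yh rr My yd Dd.
have r1 := lt_le_trans r0 rr.
have yr : `|yh - ybar| <= r by apply: le_trans yd _; rewrite ge_min lexx.
have [x [Tx xr hmin]] := al_minimizer y r1 (ltW rp).
have hmin0 : AL x y rho <= AL xbar y rho by apply: hmin => //; rewrite subrr normr0 ltW.
set a := al_mult Phi g rho x y.
set s := `|x - xbar|; set D := `|y - yh| in Dd *.
have D0 : 0 <= D by exact: normr_ge0.
have s0 : 0 <= s by exact: normr_ge0.
have main : rho * l * s ^+ 2 <= D ^+ 2 + `|a - yh| * D.
  apply: (al_descent r0 hg) => //; [exact: le_trans yr rg|exact: le_trans xr rg].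
have [h1 h2 h3 h4 h5] := hloc x (le_trans xr rl).
have ab : `|a - yh| <= rho * K * s + D.
  rewrite /a -[X in _ - X](al_mult_base r1 My) !al_multE //.
  apply: le_trans (proxr_grad_lip gc _ _ r1) _.
  have -> : Phi x + rho^-1 *: y - (Phi xbar + rho^-1 *: yh) = (Phi x - Phi xbar) + rho^-1 *: (y - yh) by vec.
  rewrite -mulrA; have -> : rho * (K * s) + D = rho * (K * s + rho^-1 * D) by field; rewrite gt_eqF.
  rewrite ler_pM2l //; apply: le_trans (ler_normD _ _) _; apply: lerD => //.
  by rewrite normrZ gtr0_norm ?invr_gt0.
have sC : s <= C1 * D by exact: (primal_step_arith r0 rr l0 (ltW K0) s0 D0 _ main ab).
have sr : s < r.
  apply: le_lt_trans sC _; apply: (@le_lt_trans _ _ (r / 2)); last by rewrite ltr_pdivrMr // ltr_pMr // ltr1n.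
  have -> : r / 2 = C1 * (r / (2 * C1)) by field; rewrite gt_eqF.
  by rewrite ler_pM2l // (le_trans Dd) // !ge_min lexx orbT.
have st := al_local_min r1 Tx sr hmin.
have yhK : `|yh| <= K.
  rewrite -[yh](subrK ybar) (le_trans (ler_normD _ _)) // (le_trans _ Ky) // addrC lerD2l.
  by rewrite (le_trans yr) // (le_trans rl).
have inn := dual_step_inner (ltW K0) yhK My st h2 h3 h4.
(* Monotonicity of the subdifferential between the proximal point and Phi xbar; the inner product
   left over is of order s^2 by [dual_step_inner], so rho occurs only through rho s^2. *)
have mono : `|a - yh| ^+ 2 <= `|a - yh| * D + rho * inner (a - yh) (Phi x - Phi xbar).
  have := subdiff_monotone (al_mult_subdiff Phi gc x y r1) (M0_subdiff My).
  rewrite -/a (al_proxE _ _ _ _ r1) -/a.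
  have -> : Phi x + rho^-1 *: (y - a) - Phi xbar = (Phi x - Phi xbar) + rho^-1 *: ((y - yh) - (a - yh)) by vec.
  rewrite innerDr innerZr (innerBr (y - yh)) -normr_inner.
  rewrite -(ler_pM2l r1) mulr0 mulrDr mulVKf ?gt_eqF // => e1.
  have := inner_le (a - yh) (y - yh); rewrite -/D; lra.
exists x; split => //.
  by apply: le_trans sC _; rewrite ler_wpM2r // lerDl ltW.
apply: (@le_trans _ _ (C2 * D)); last by rewrite ler_wpM2r // lerDr ltW.
apply: (dual_step_arith r1 l0 (ltW K0) KK0 D0 _ main) => //.
  by apply: le_trans mono _; rewrite lerD2l ler_pM2l.
rewrite mulrC -ler_pdivlMr ?mulr_gt0 // (le_trans Dd) // !ge_min lexx !orbT //.
Qed.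

(** * Distance to the solutions and convergence *)

(** Membership in M0 consists of linear inequalities in y, so M0 is the intersection of the closed
    half-spaces that contain it. *)
Lemma M0_closed : closed M0.
Proof.
pose P (p : Y * R) := forall y, M0 y -> inner y p.1 <= p.2.
have -> : M0 = \bigcap_(p in P) [set y | inner y p.1 <= p.2]; last first.
  apply: closed_bigI => -[w c] _ /=.
  have -> : [set y | inner y w <= c] = (fun y => inner y w) @^-1` [set x | x <= c] by [].
  apply: closed_comp; last exact: closed_le.
  by move=> y _; apply: continuous_inner; [exact: cvg_id|exact: cvg_cst].
apply/seteqP; split => [y My p Pp|y hy]; first exact: Pp.
have {}hy w c : (forall z, M0 z -> inner z w <= c) -> inner y w <= c by move=> h; exact: (hy (w, c) h).
apply/M0P; split.
  split; first exact: Txbar.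
  move=> h Lh; rewrite inner0l (gradLE phiC2 PhiC2).
  have h1 : inner y ('d Phi xbar h) <= - 'd phi xbar h.
    by apply: hy => z Mz; have := phi_stat Mz Lh; lra.
  have h2 : inner y (- 'd Phi xbar h) <= 'd phi xbar h.
    by apply: hy => z Mz; rewrite innerNr; have := phi_stat Mz Lh; lra.
  by apply/eqP; rewrite innerNr in h2; rewrite eq_le; lra.
have [gu _] := sybar; split => // z.
have [gz|] := boolP (g z \is a fin_num); last first.
  move=> ngz; have -> : g z = +oo%E by apply/eqP; rewrite -leye_eq leNgt; apply: contra ngz => /(lsc_convex_fin gc).
  exact: leey.
rewrite -(fineK gu) -(fineK gz) -EFinD lee_fin.
rewrite -lerBrDl; apply: hy => y' My'.
by have := subdiff_le (M0_subdiff My') gz; lra.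
Qed.

Definition sol_dist x y : R := fine (dist_to (@pnorm R X Y) (x, y) ([set xbar] `*` M0)).

Lemma sol_dist_attained x y : exists yh, [/\ M0 yh,
  sol_dist x y = pnorm ((x, y) - (xbar, yh)) &
  forall yh', M0 yh' -> sol_dist x y <= pnorm ((x, y) - (xbar, yh'))].
Proof.
have [yh Myh hmin] := closed_projection y M0_closed (ex_intro _ _ M0ybar).
have le yh' : M0 yh' -> pnorm ((x, y) - (xbar, yh)) <= pnorm ((x, y) - (xbar, yh')).
  move=> Myh'; rewrite /pnorm /= ler_sqrt ?addr_ge0 ?sqr_ge0 // lerD2l.
  by rewrite ler_sqr ?nnegrE // hmin.
suff E : sol_dist x y = pnorm ((x, y) - (xbar, yh)) by exists yh; split => // yh' My; rewrite E le.
rewrite /sol_dist; set A := dist_to _ _ _.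
suff -> : A = (pnorm ((x, y) - (xbar, yh)))%:E by [].
apply/eqP; rewrite eq_le; apply/andP; split.
  by apply: ereal_inf_lbound; exists (xbar, yh).
by apply: le_ereal_inf_tmp => _ [[a b] [/= -> Mb] <-]; rewrite lee_fin le.
Qed.

Lemma sol_dist_ge0 x y : 0 <= sol_dist x y.
Proof. by have [yh [_ -> _]] := sol_dist_attained x y; exact: sqrtr_ge0. Qed.

Lemma sol_dist_le x y yh : M0 yh -> sol_dist x y <= `|x - xbar| + `|y - yh|.
Proof.
move=> My; have [yh' [_ _ h]] := sol_dist_attained x y.
exact: le_trans (h _ My) (pnorm_le_sum _).
Qed.

Lemma sol_dist_proj x y : exists yh, [/\ M0 yh, `|x - xbar| <= sol_dist x y & `|y - yh| <= sol_dist x y].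
Proof.
have [yh [My -> _]] := sol_dist_attained x y; exists yh.
by split => //; [have := pnorm_fst ((x, y) - (xbar, yh))|have := pnorm_snd ((x, y) - (xbar, yh))].
Qed.

(** * One step of the method *)

Variable eps : R -> R.
Hypotheses (eps_ge0 : forall t : R, 0 <= t -> 0 <= eps t) (eps_o : eps =o_ (0^'+) id).

Lemma eps_small e : 0 < e -> exists2 d, 0 < d & forall t, 0 < t < d -> eps t <= e * t.
Proof.
move=> e0; have /eqoP/(_ e e0) := eps_o; rewrite near_withinE => /nbhs_ballP[r /= r0 hr].
exists r => // t /andP[t0 tr]; have := hr t.
rewrite -ball_normE /= sub0r normrN gtr0_norm // => /(_ tr t0).
exact: le_trans (ler_norm _).
Qed.

Definition alm_update (chat rho : R) x y x1 y1 : Prop :=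
  [/\ (dist_to (@Num.norm _ X) (- gradx_AL phi Phi g x1 y rho) (normal_cone Theta x1)
         <= (eps (fine (res x y)))%:E)%E,
      y1 = y + rho *: grady_AL phi Phi g x1 y rho &
      ((`|x1 - x| + `|y1 - y|)%:E <= chat%:E * res x y)%E].

Lemma alm_updateP chat rho x y x1 y1 : 0 < rho -> Theta x -> alm_update chat rho x y x1 y1 <->
  exists v, [/\ stat x1 y1 v, `|v| <= eps (fine (res x y)), y1 = al_mult Phi g rho x1 y &
    `|x1 - x| + `|y1 - y| <= chat * fine (res x y)].
Proof.
move=> r0 Tx; have [v0 _ rE] := residual_stat y Tx.
rewrite /alm_update (grady_ALE phi Phi gc) // (gradx_ALE phiC2 PhiC2 gc) // rE /= -EFinM lee_fin.
split => [[h1 yE h2]|[v [sv hv yE h2]]].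
  (* The inexactness criterion itself forces feasibility: off [Theta] the distance is +oo. *)
  have Tx1 : Theta x1.
    by apply: contrapT => nT; move: h1; rewrite (dist_off_Theta _ nT) leye_eq.
  have [v sv vE] := dist_stationary Theta_affine kkt (al_mult Phi g rho x1 y) Tx1.
  exists v; split; [by rewrite yE|by rewrite -lee_fin -vE|exact: yE|exact: h2].
split; [|exact: yE|exact: h2].
rewrite yE in sv; apply: le_trans (dist_le_stationary Theta_affine kkt sv) _.
by rewrite lee_fin.
Qed.

Let close d x y := [/\ Theta x, `|x - xbar| <= d & `|y - ybar| <= d].

Lemma residual_sol_dist : exists C k d : R, [/\ 0 < C, 0 < k, 0 < d & forall x y, close d x y ->
  fine (res x y) <= C * sol_dist x y /\ sol_dist x y <= k * fine (res x y)].
Proof.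
have [C [d1 [C0 d10 hC]]] := residual_upper.
have [k [d2 [k0 d20 hk]]] := residual_error_bound.
(* The projection of y on M0 is within 2 d of y, hence within 3 d of [ybar]. *)
pose d := Num.min (d1 / 3) d2.
have d0 : 0 < d by rewrite /d lt_min d20 divr_gt0.
have dd1 : 3 * d <= d1 by rewrite mulrC -ler_pdivlMr // ge_min lexx.
have dd2 : d <= d2 by rewrite ge_min lexx orbT.
exists (2 * C), k, d; split; [exact: mulr_gt0|exact: k0|exact: d0|].
move=> x y [Tx xd yd].
have e2 : sol_dist x y <= 2 * d.
  by have := sol_dist_le x y M0ybar; lra.
split.
  have [yh [My hx hy]] := sol_dist_proj x y.
  apply: le_trans (hC x y yh Tx _ My _) _; first by lra.
    have := ler_distD y yh ybar; rewrite (distrC yh y); lra.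
  by rewrite -mulrA mulrCA ler_pM2l //; lra.
have [yh My h] := hk x y Tx (le_trans xd dd2) (le_trans yd dd2).
exact: le_trans (sol_dist_le x y My) h.
Qed.

Lemma alm_update_exists : exists chat rho0 d : R, [/\ 0 < chat, 0 < rho0, 0 < d &
  forall x y rho, close d x y -> rho0 <= rho -> exists x1 y1, alm_update chat rho x y x1 y1].
Proof.
have [C [k [d1 [C0 k0 d10 hr]]]] := residual_sol_dist.
have [rho0 [Cs [d2 [r0 Cs0 d20 hs]]]] := alm_step.
pose d := Num.min d1 (d2 / 3).
have d0 : 0 < d by rewrite /d lt_min d10 divr_gt0.
have dd1 : d <= d1 by rewrite ge_min lexx.
have dd2 : 3 * d <= d2 by rewrite mulrC -ler_pdivlMr // ge_min lexx orbT.
(* Each component of the step is at most (Cs + 1) times the distance to the solutions, through xbar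
   or yh, and that distance is at most k times the residual. *)
exists (2 * (Cs + 1) * k), rho0, d; split; [by rewrite !mulr_gt0 // addr_gt0|exact: r0|exact: d0|].
move=> x y rho [Tx xd yd] rr.
have [_ er] := hr x y (And3 Tx (le_trans xd dd1) (le_trans yd dd1)).
have [yh [My hx hy]] := sol_dist_proj x y.
have e2 : sol_dist x y <= 2 * d by have := sol_dist_le x y M0ybar; lra.
have yhd : `|yh - ybar| <= d2 by have := ler_distD y yh ybar; rewrite (distrC yh y); lra.
have [|x1 [st h1 h2]] := hs rho y yh rr My yhd; first by lra.
exists x1, (al_mult Phi g rho x1 y); apply/(alm_updateP _ _ _ _ (lt_le_trans r0 rr) Tx).
exists 0; split; [exact: st|by rewrite normr0; exact/eps_ge0/residual_ge0|by []|].
have h3 : Cs * `|y - yh| <= Cs * sol_dist x y by rewrite ler_pM2l.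
have h4 := ler_distD xbar x1 x; rewrite (distrC xbar x) in h4.
have h5 := ler_distD yh (al_mult Phi g rho x1 y) y; rewrite (distrC yh y) in h5.
apply: (@le_trans _ _ (2 * (Cs + 1) * sol_dist x y)).
  by lra.
by rewrite -[leRHS]mulrA ler_pM2l // mulr_gt0 // addr_gt0.
Qed.

Lemma alm_update_theta chat rho x y x1 y1 : 0 < rho -> Theta x ->
  alm_update chat rho x y x1 y1 -> Theta x1.
Proof. by move=> r0 Tx /(alm_updateP _ _ _ _ r0 Tx)[v [[]]]. Qed.

Lemma alm_update_length chat : 0 < chat -> exists A d : R, [/\ 0 < A, 0 < d &
  forall x y rho x1 y1, close d x y -> 0 < rho -> alm_update chat rho x y x1 y1 ->
  `|x1 - x| + `|y1 - y| <= A * sol_dist x y].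
Proof.
move=> c0; have [C [k [d [C0 k0 d0 hr]]]] := residual_sol_dist.
exists (chat * C), d; split; [exact: mulr_gt0|exact: d0|].
move=> x y rho x1 y1 cl r0; have [Tx _ _] := cl.
move=> /(alm_updateP _ _ _ _ r0 Tx)[v [_ _ _ h]].
apply: le_trans h _; rewrite -mulrA ler_pM2l //.
by have [] := hr x y cl.
Qed.

(* The new iterate solves the KKT system perturbed by the inexactness of the
   inner problem and by (y - y1) / rho, both small relative to the residual. *)
Lemma alm_update_contraction chat : 0 < chat -> exists2 d : R, 0 < d &
  forall eta, 0 < eta -> exists delta R0 : R, [/\ 0 < delta, 0 < R0 &
  forall x y rho x1 y1, close d x y -> close d x1 y1 -> R0 <= rho ->
  sol_dist x y <= delta -> alm_update chat rho x y x1 y1 ->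
  sol_dist x1 y1 <= eta * sol_dist x y].
Proof.
move=> c0; have [C [k [d1 [C0 k0 d10 hr]]]] := residual_sol_dist.
have [k3 [d3 [k30 d30 heb]]] := error_bound.
pose d := Num.min d1 d3.
have d0 : 0 < d by rewrite /d lt_min d10.
have dd1 : d <= d1 by rewrite ge_min lexx.
have dd3 : d <= d3 by rewrite ge_min lexx orbT.
exists d => // eta eta0.
(* [e1] and [R0] leave half of eta to each of the errors v and w; [delta] puts the residual below
   the threshold t and both errors below d3. The radius d was fixed before eta, so a smaller eta can
   be applied later to the same trajectory. *)
pose e1 := Num.min 1 (eta / (2 * k3 * C)).
have e10 : 0 < e1 by rewrite /e1 lt_min ltr01 divr_gt0 // !mulr_gt0.
have [t t0 ht] := eps_small e10.
pose R0 := Num.max 1 (2 * k3 * (chat * C) / eta).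
have R00 : 0 < R0 by rewrite /R0 lt_max ltr01.
pose delta := Num.min (t / (2 * C)) (Num.min (d3 / C) (d3 / (chat * C))).
have dp : 0 < delta by rewrite /delta !lt_min !divr_gt0 // mulr_gt0.
exists delta, R0; split; [exact: dp|exact: R00|].
move=> x y rho x1 y1 [Tx xd yd] [Tx1 xd1 yd1] Rr ed up.
have r0 := lt_le_trans R00 Rr.
have [h1 h2] := hr x y (And3 Tx (le_trans xd dd1) (le_trans yd dd1)).
have e0 := sol_dist_ge0 x y.
have [v [sv hv yE hl]] := (alm_updateP _ _ _ _ r0 Tx).1 up.
have rg0 := residual_ge0 x y; set r := fine (res x y) in h1 h2 hv hl rg0.
(* The condition o(t) says nothing about the value of eps at 0. If the residual vanishes, the bound
   on the step length says that the pair does not move. *)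
have [rz|rnz] := eqVneq r 0.
  rewrite rz mulr0 in h2; rewrite rz mulr0 in hl.
  have x1E : x1 = x by apply/eqP; rewrite -subr_eq0 -normr_le0 (le_trans _ hl) // lerDl.
  have y1E : y1 = y by apply/eqP; rewrite -subr_eq0 -normr_le0 (le_trans _ hl) // lerDr.
  by rewrite x1E y1E (le_trans h2) // mulr_ge0 // ltW.
have rp : 0 < r by rewrite lt_def rnz.
have Ce : C * sol_dist x y <= C * delta by rewrite ler_pM2l.
have Cd1 : C * delta <= t / 2.
  by rewrite mulrC -ler_pdivlMr // -mulrA -invfM ge_min lexx.
have Cd2 : C * delta <= d3.
  by rewrite mulrC -ler_pdivlMr // !ge_min lexx orbT.
have Cd3 : chat * C * delta <= d3.
  by rewrite mulrC -ler_pdivlMr ?mulr_gt0 // !ge_min lexx !orbT.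
have vr : `|v| <= e1 * r.
  by apply: le_trans hv _; apply: ht; rewrite rp /=; lra.
have e1r : e1 * r <= e1 * (C * sol_dist x y) by rewrite ler_pM2l.
have e1r1 : e1 * (C * sol_dist x y) <= 1 * (C * sol_dist x y).
  by rewrite ler_wpM2r ?ge_min ?lexx // mulr_ge0 // ltW.
have vd : `|v| <= d3 by lra.
pose w := rho^-1 *: (y - y1).
have yl : `|y - y1| <= chat * C * sol_dist x y.
  rewrite distrC; apply: le_trans (_ : _ <= chat * r) _.
    by apply: le_trans hl; rewrite lerDr.
  by rewrite -mulrA ler_pM2l.
have nw : `|w| = rho^-1 * `|y - y1| by rewrite normrZ gtr0_norm ?invr_gt0.
have wd : `|w| <= d3.
  rewrite nw ler_pdivrMl //; apply: le_trans yl _.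
  apply: (@le_trans _ _ d3); first by apply: le_trans Cd3; rewrite ler_pM2l // mulr_gt0.
  by rewrite ler_peMl ?(ltW d30) // (le_trans _ Rr) // le_max lexx.
have sw : subdiff g (Phi x1 + w) y1.
  by have := al_mult_subdiff Phi gc x1 y r0; rewrite (al_proxE _ _ _ _ r0) -yE.
have [yh My hyh] := heb x1 y1 v w (le_trans xd1 dd3) (le_trans yd1 dd3) vd wd sv sw.
apply: le_trans (sol_dist_le x1 y1 My) _; apply: le_trans hyh _.
have b1 : k3 * `|v| <= eta / 2 * sol_dist x y.
  apply: (@le_trans _ _ (k3 * (eta / (2 * k3 * C) * (C * sol_dist x y)))).
    rewrite ler_pM2l // (le_trans vr) // (le_trans e1r) // ler_wpM2r ?ge_min ?lexx ?orbT //.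
    by rewrite mulr_ge0 // ltW.
  by rewrite le_eqVlt; apply/orP; left; apply/eqP; field; rewrite !gt_eqF.
have b2 : k3 * `|w| <= eta / 2 * sol_dist x y.
  rewrite nw mulrCA ler_pdivrMl //.
  apply: (@le_trans _ _ (k3 * (chat * C * sol_dist x y))); first by rewrite ler_pM2l.
  have : 2 * k3 * (chat * C) <= rho * eta.
    by rewrite -ler_pdivrMr // (le_trans _ Rr) // le_max lexx orbT.
  move/(ler_wpM2r e0) => b3; rewrite -(ler_pM2l (ltr0n _ 2 : 0 < 2 :> R)).
  have -> : 2 * (rho * (eta / 2 * sol_dist x y)) = rho * eta * sol_dist x y by field.
  by apply: le_trans b3; rewrite !mulrA.
rewrite mulrDr; have -> : eta * sol_dist x y = eta / 2 * sol_dist x y + eta / 2 * sol_dist x y by field.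
exact: lerD.
Qed.

(** Halving at a step presupposes that its endpoint is close, but the length bound does not. Length
    2 A (e_0 - e_j) up to j plus A e_j for the next step is at most 2 A e_0, which gives closeness
    first and then halving. *)
Lemma trajectory_close (A d : R) (x : nat -> X) (y : nat -> Y) n : 0 <= A -> Theta (x 0%N) ->
  `|x 0%N - xbar| + 2 * A * sol_dist (x 0%N) (y 0%N) <= d ->
  `|y 0%N - ybar| + 2 * A * sol_dist (x 0%N) (y 0%N) <= d ->
  (forall j, (j < n)%N -> close d (x j) (y j) -> [/\ Theta (x j.+1),
     `|x j.+1 - x j| + `|y j.+1 - y j| <= A * sol_dist (x j) (y j) &
     close d (x j.+1) (y j.+1) -> sol_dist (x j.+1) (y j.+1) <= 2^-1 * sol_dist (x j) (y j)]) ->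
  forall j, (j <= n)%N -> close d (x j) (y j) /\ forall i, (i < j)%N ->
    sol_dist (x i.+1) (y i.+1) <= 2^-1 * sol_dist (x i) (y i) /\
    `|x i.+1 - x i| + `|y i.+1 - y i| <= A * sol_dist (x i) (y i).
Proof.
move=> A0 T0 x0d y0d hs; elim=> [|j IH] jn.
  have p : 0 <= 2 * A * sol_dist (x 0%N) (y 0%N) by rewrite !mulr_ge0 ?sol_dist_ge0.
  split; last by [].
  by split; [exact: T0|apply: le_trans x0d; rewrite lerDl|apply: le_trans y0d; rewrite lerDl].
have [cl hi] := IH (ltnW jn).
have [Tx len half] := hs j jn cl.
pose e k := sol_dist (x k) (y k).
have tail : `|x j - x 0%N| + `|y j - y 0%N| <= 2 * A * (e 0%N - e j).
  have := @halving_tail R X Y x y e A 0 j A0; rewrite !add0n; apply => i ij; rewrite !add0n.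
    by have [] := hi i ij.
  by have [] := hi i ij.
have ej : 0 <= A * e j by rewrite mulr_ge0 ?sol_dist_ge0.
have tail1 : `|x j.+1 - x 0%N| + `|y j.+1 - y 0%N| <= 2 * A * e 0%N.
  have h1 := ler_distD (x j) (x j.+1) (x 0%N); have h2 := ler_distD (y j) (y j.+1) (y 0%N).
  by move: len ej tail; rewrite -/(e j); lra.
have cl1 : close d (x j.+1) (y j.+1).
  split; first exact: Tx.
    have h1 := ler_distD (x 0%N) (x j.+1) xbar.
    by have := normr_ge0 (y j.+1 - y 0%N); move: tail1 x0d; rewrite -/(e 0%N); lra.
  have h1 := ler_distD (y 0%N) (y j.+1) ybar.
  by have := normr_ge0 (x j.+1 - x 0%N); move: tail1 y0d; rewrite -/(e 0%N); lra.
split; first exact: cl1.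
move=> i; rewrite ltnS leq_eqVlt => /orP[/eqP ->|ij]; last exact: hi.
by split; [exact: half|exact: len].
Qed.

(* Steps are defined only close to the reference point, so the recursion uses
   a totalised step function and closeness is recovered along the way. *)
Lemma trajectory_exists (A d : R) (S : nat -> X -> Y -> X -> Y -> Prop) x0 y0 :
  0 <= A -> Theta x0 ->
  `|x0 - xbar| + 2 * A * sol_dist x0 y0 <= d -> `|y0 - ybar| + 2 * A * sol_dist x0 y0 <= d ->
  (forall k x y, close d x y -> exists x1 y1, S k x y x1 y1) ->
  (forall k x y x1 y1, close d x y -> S k x y x1 y1 -> [/\ Theta x1,
     `|x1 - x| + `|y1 - y| <= A * sol_dist x y &
     close d x1 y1 -> sol_dist x1 y1 <= 2^-1 * sol_dist x y]) ->
  exists (x : nat -> X) (y : nat -> Y), [/\ x 0%N = x0, y 0%N = y0 &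
    forall k, S k (x k) (y k) (x k.+1) (y k.+1)].
Proof.
move=> A0 T0 x0d y0d hex hS.
have hn (p : nat * (X * Y)) : exists q : X * Y,
    close d p.2.1 p.2.2 -> S p.1 p.2.1 p.2.2 q.1 q.2.
  have [cl|ncl] := pselect (close d p.2.1 p.2.2); last by exists (x0, y0) => cl; case: ncl.
  by have [x1 [y1 h]] := hex p.1 _ _ cl; exists (x1, y1).
have [f hf] := choice hn.
pose z := fix z k : X * Y := if k is k'.+1 then f (k', z k') else (x0, y0).
have cl k : close d (z k).1 (z k).2.
  have [] // := @trajectory_close A d (fun k => (z k).1) (fun k => (z k).2) k A0 T0 x0d y0d _ k (leqnn k).
  by move=> j _ clj; apply: (hS j) => //; exact: (hf (j, z j)).
exists (fun k => (z k).1), (fun k => (z k).2); split => // k.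
exact: (hf (k, z k) (cl k)).
Qed.

(** A cluster point of y lies in M0, because the projections of the y k on M0 have the same limit
    along the subsequence and M0 is closed. The tail estimate, passed to the limit along that
    subsequence, bounds every y k. *)
Lemma trajectory_limit (A : R) (x : nat -> X) (y : nat -> Y) : 0 < A ->
  (forall k, sol_dist (x k.+1) (y k.+1) <= 2^-1 * sol_dist (x k) (y k)) ->
  (forall k, `|x k.+1 - x k| + `|y k.+1 - y k| <= A * sol_dist (x k) (y k)) ->
  exists2 yhat, M0 yhat & forall k, `|y k - yhat| <= 2 * A * sol_dist (x k) (y k).
Proof.
move=> A0 eh el; pose e k := sol_dist (x k) (y k).
have e0 k : 0 <= e k by exact: sol_dist_ge0.
have ec : e @ \oo --> 0 by exact: halving_cvg0.
have tail k n : `|y (k + n)%N - y k| <= 2 * A * e k.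
  have := @halving_tail R X Y x y e A k n (ltW A0) (fun j _ => eh _) (fun j _ => el _).
  have := normr_ge0 (x (k + n)%N - x k); have : 0 <= A * e (k + n)%N by rewrite mulr_ge0 // ltW.
  by lra.
have yb k : `|y k| <= 2 * A * e 0%N + `|y 0%N|.
  by rewrite -[y k](subrK (y 0%N)) (le_trans (ler_normD _ _)) // lerD2r; exact: (tail 0%N k).
have [s [yhat [sn yc]]] := bounded_subsequence yb.
exists yhat.
  have hyh k : exists yh, M0 yh /\ `|y (s k) - yh| <= e (s k).
    by have [yh [? _ ?]] := sol_dist_proj (x (s k)) (y (s k)); exists yh.
  have [yh hyh'] := choice hyh.
  have dc : (fun k => (y \o s) k - yh k) @ \oo --> (0 : Y).
    apply/norm_cvg0P; apply: (squeeze_cvgr _ (cvg_cst 0) (cvg_subseq sn ec)).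
    by apply: nearW => k; rewrite normr_ge0 /=; have [] := hyh' k.
  have yhc : yh @ \oo --> yhat.
    have -> : yh = (fun k => (y \o s) k - ((y \o s) k - yh k)) by apply/funext => k; vec.
    by rewrite -[X in _ --> X]subr0; exact: cvgB.
  apply: (@closed_cvg _ _ \oo _ yh M0 M0_closed _ yhat yhc).
  by apply: nearW => k; have [] := hyh' k.
move=> k; rewrite distrC.
have l : (fun m => `|(y \o s) m - y k|) @ \oo --> `|yhat - y k|.
  by apply: cvg_norm; apply: cvgB => //; exact: cvg_cst.
apply: (cvg_le_const l); near=> m.
have km : (k <= s m)%N by apply: leq_trans (sn m); near: m; exact: nbhs_infty_ge.
by rewrite /= -(subnKC km); exact: tail.
Unshelve. all: by end_near.
Qed.

(* With sol_dist <= err <= (1 + 2 A) sol_dist, a contraction factor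
   1 / (2 (1 + 2 A)) of sol_dist gives the factor 1/2 for err. *)
Lemma trajectory_rates (A : R) (x : nat -> X) (y : nat -> Y) yhat : 0 < A -> M0 yhat ->
  (forall k, `|y k - yhat| <= 2 * A * sol_dist (x k) (y k)) ->
  (forall k, sol_dist (x k.+1) (y k.+1) <= (2 * (1 + 2 * A))^-1 * sol_dist (x k) (y k)) ->
  let err k := pnorm ((x k, y k) - (xbar, yhat)) in
  let err_sol k := sol_dist (x k) (y k) in
  [/\ (x k, y k) @[k --> \oo] --> (xbar, yhat), Qlinear err, Qlinear err_sol &
    (forall eta, 0 < eta -> \forall k \near \oo, err_sol k.+1 <= eta * err_sol k) ->
    Qsuperlinear err /\ Qsuperlinear err_sol].
Proof.
move=> A0 Myh hy hc err e.
have e0 k : 0 <= e k by exact: sol_dist_ge0.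
have B0 : 0 < 1 + 2 * A by rewrite addr_gt0 // mulr_gt0.
have hx k : `|x k - xbar| <= e k by have [yh [_ h _]] := sol_dist_proj (x k) (y k).
have errU k : err k <= (1 + 2 * A) * e k.
  apply: le_trans (pnorm_le_sum _) _ => /=; rewrite mulrDl mul1r.
  by apply: lerD; [exact: hx|exact: hy].
have errL k : e k <= err k.
  by have [_ [_ _ h]] := sol_dist_attained (x k) (y k); exact: h.
have err0 k : 0 <= err k by exact: sqrtr_ge0.
have step eta k : 0 < eta -> e k.+1 <= (1 + 2 * A)^-1 * eta * e k -> err k.+1 <= eta * err k.
  move=> eta0 h; apply: le_trans (errU _) _.
  have := ler_wpM2l (ltW B0) h; rewrite -mulrA mulVKf ?gt_eqF // => h1; apply: le_trans h1 _.
  by rewrite ler_pM2l.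
have eh k : e k.+1 <= 2^-1 * e k.
  apply: le_trans (hc k) _; apply: ler_wpM2r; first exact: sol_dist_ge0.
  by rewrite lef_pV2 ?posrE ?mulr_gt0 // ler_peMr // lerDl mulr_ge0 // ltW.
have errh k : err k.+1 <= 2^-1 * err k.
  by apply: step; [rewrite invr_gt0|rewrite -invfM (mulrC _ 2); exact: hc].
split.
- have errc : err @ \oo --> 0 by exact: halving_cvg0.
  apply: cvg_pair => /=; apply/subr_cvg0/norm_cvg0P; apply: (squeeze_cvgr _ (cvg_cst 0) errc);
    apply: nearW => k; rewrite normr_ge0 /=.
    by have := pnorm_fst ((x k, y k) - (xbar, yhat)).
  by have := pnorm_snd ((x k, y k) - (xbar, yhat)).
- exact: halving_Qlinear.
- exact: halving_Qlinear.
move=> sup; split; apply: Qsuperlinear_ratio => //.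
move=> eta eta0; have p : 0 < (1 + 2 * A)^-1 * eta by rewrite mulr_gt0 ?invr_gt0.
by apply: filterS (sup _ p) => k; exact: step.
Qed.

Lemma alm_convergence : exists chat rhobar eps0 : R, [/\ 0 < chat, 0 < rhobar, 0 < eps0 &
  forall (x0 : X) (y0 : Y) (rho : nat -> R), pnorm ((x0, y0) - (xbar, ybar)) <= eps0 ->
  res x0 y0 \is a fin_num -> (forall k, rhobar <= rho k) ->
  (exists (x : nat -> X) (y : nat -> Y),
    [/\ x 0%N = x0, y 0%N = y0 & ALM_sequence phi Phi g Theta eps chat rho x y]) /\
  (forall (x : nat -> X) (y : nat -> Y), x 0%N = x0 -> y 0%N = y0 ->
    ALM_sequence phi Phi g Theta eps chat rho x y ->
    exists2 yhat : Y, M0 yhat &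
      let err (k : nat) := pnorm ((x k, y k) - (xbar, yhat)) in
      let err_sol (k : nat) := sol_dist (x k) (y k) in
      [/\ (x k, y k) @[k --> \oo] --> (xbar, yhat), Qlinear err, Qlinear err_sol &
        rho @ \oo --> +oo -> Qsuperlinear err /\ Qsuperlinear err_sol])].
Proof.
(* The constant of the constructed steps is chosen first; the length and contraction estimates are
   then taken for all steps admissible with it. *)
have [chat [rho0 [d1 [c0 r0 d10 hex]]]] := alm_update_exists.
have [A [d2 [A0 d20 hlen]]] := alm_update_length c0.
have [d3 d30 hcon] := alm_update_contraction c0.
have B0 : 0 < 1 + 2 * A by rewrite addr_gt0 // mulr_gt0.
have th0 : 0 < (2 * (1 + 2 * A))^-1 by rewrite invr_gt0 mulr_gt0.
have th2 : (2 * (1 + 2 * A))^-1 <= 2^-1.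
  by rewrite lef_pV2 ?posrE ?mulr_gt0 // ler_peMr // lerDl mulr_ge0 // ltW.
have [delta [R0 [dl0 R00 hth]]] := hcon _ th0.
(* Points within d in each component have distance at most 2 d to the solutions, hence delta / 2. *)
pose d := Num.min (Num.min d1 (delta / 2)) (Num.min d2 d3).
have d0 : 0 < d by rewrite /d !lt_min d10 d20 d30 divr_gt0.
have close_le d' x y : d <= d' -> close d x y -> close d' x y.
  by move=> dd [Tx xd yd]; split; [exact: Tx|exact: le_trans dd|exact: le_trans dd].
have cl1 x y : close d x y -> close d1 x y by apply: close_le; rewrite !ge_min lexx.
have cl2 x y : close d x y -> close d2 x y by apply: close_le; rewrite !ge_min lexx !orbT.
have cl3 x y : close d x y -> close d3 x y by apply: close_le; rewrite !ge_min lexx !orbT.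
have cld x y : close d x y -> sol_dist x y <= delta.
  move=> /(close_le (delta / 2))[|_ xd yd]; first by rewrite !ge_min lexx !orbT.
  by have := sol_dist_le x y M0ybar; lra.
(* With this starting radius the initial distance plus the total length 2 A e_0 of the trajectory
   does not exceed d. *)
exists chat, (Num.max rho0 R0), (d / (1 + 2 * A)).
split; [exact: c0|by rewrite lt_max r0|by rewrite divr_gt0|].
move=> x0 y0 rho pB /residual_fin T0 hrho.
have rk k : rho0 <= rho k by apply: le_trans (hrho k); rewrite le_max lexx.
have Rk k : R0 <= rho k by apply: le_trans (hrho k); rewrite le_max lexx orbT.
have rp k : 0 < rho k by exact: lt_le_trans (rk k).
have e0p : sol_dist x0 y0 <= pnorm ((x0, y0) - (xbar, ybar)).
  by have [_ [_ _ h]] := sol_dist_attained x0 y0; exact: h M0ybar.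
have Ae : 2 * A * sol_dist x0 y0 <= 2 * A * pnorm ((x0, y0) - (xbar, ybar)).
  by rewrite ler_pM2l // mulr_gt0.
have pd' : (1 + 2 * A) * pnorm ((x0, y0) - (xbar, ybar)) <= d by rewrite mulrC -ler_pdivlMr.
have x0d : `|x0 - xbar| + 2 * A * sol_dist x0 y0 <= d.
  by have /= := pnorm_fst ((x0, y0) - (xbar, ybar)); lra.
have y0d : `|y0 - ybar| + 2 * A * sol_dist x0 y0 <= d.
  by have /= := pnorm_snd ((x0, y0) - (xbar, ybar)); lra.
have hT k x y x1 y1 : close d x y -> alm_update chat (rho k) x y x1 y1 -> [/\ Theta x1,
    `|x1 - x| + `|y1 - y| <= A * sol_dist x y &
    close d x1 y1 -> sol_dist x1 y1 <= (2 * (1 + 2 * A))^-1 * sol_dist x y].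
  move=> cl up; split; first by apply: (alm_update_theta (rp k) _ up); case: cl.
    exact: (hlen _ _ _ _ _ (cl2 _ _ cl) (rp k) up).
  by move=> cl'; exact: (hth _ _ _ _ _ (cl3 _ _ cl) (cl3 _ _ cl') (Rk k) (cld _ _ cl) up).
have hS k x y x1 y1 : close d x y -> alm_update chat (rho k) x y x1 y1 -> [/\ Theta x1,
    `|x1 - x| + `|y1 - y| <= A * sol_dist x y &
    close d x1 y1 -> sol_dist x1 y1 <= 2^-1 * sol_dist x y].
  move=> cl up; have [h1 h2 h3] := hT _ _ _ _ _ cl up; split; [exact: h1|exact: h2|].
  by move=> /h3 h; apply: le_trans h _; apply: ler_wpM2r => //; exact: sol_dist_ge0.
split.
  apply: (trajectory_exists (ltW A0) T0 x0d y0d _ hS) => k x y cl.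
  exact: hex (cl1 _ _ cl) (rk k).
move=> x y xE yE hseq; rewrite -{}xE -{}yE in T0 x0d y0d.
have hclose n : close d (x n) (y n) /\ forall i, (i < n)%N ->
    sol_dist (x i.+1) (y i.+1) <= 2^-1 * sol_dist (x i) (y i) /\
    `|x i.+1 - x i| + `|y i.+1 - y i| <= A * sol_dist (x i) (y i).
  by apply: (trajectory_close (ltW A0) T0 x0d y0d (n := n)) => // j _ cl; exact: (hS j).
have cl n : close d (x n) (y n) by have [] := hclose n.
have eh k : sol_dist (x k.+1) (y k.+1) <= 2^-1 * sol_dist (x k) (y k).
  by have [_ /(_ k (ltnSn k))[]] := hclose k.+1.
have el k : `|x k.+1 - x k| + `|y k.+1 - y k| <= A * sol_dist (x k) (y k).
  by have [_ /(_ k (ltnSn k))[]] := hclose k.+1.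
have hc k : sol_dist (x k.+1) (y k.+1) <= (2 * (1 + 2 * A))^-1 * sol_dist (x k) (y k).
  by have [_ _] := hT _ _ _ _ _ (cl k) (hseq k); apply.
have [yhat Myh hy] := trajectory_limit A0 eh el.
exists yhat; first exact: Myh.
have [r1 r2 r3 r4] := trajectory_rates A0 Myh hy hc.
split; [exact: r1|exact: r2|exact: r3|move=> rinf; apply: r4 => eta eta0].
(* When rho tends to infinity the contraction factor eta is arbitrary: both thresholds, on the
   distance and on rho, are eventually passed. *)
have [del [R1 [del0 R10 hsup]]] := hcon _ eta0.
have ec : (fun k => sol_dist (x k) (y k)) @ \oo --> 0.
  by apply: halving_cvg0 => // k; exact: sol_dist_ge0.
have E1 : \forall k \near \oo, sol_dist (x k) (y k) <= del by exact: (cvgr_le _ ec).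
have E2 : \forall k \near \oo, R1 <= rho k by move/cvgryPge: rinf; apply.
apply: filterS (filterI E1 E2) => k [e1 e2].
exact: (hsup _ _ _ _ _ (cl3 _ _ (cl k)) (cl3 _ _ (cl k.+1)) e2 e1 (hseq k)).
Qed.

End LocalAnalysis.

Theorem theorem5p6 (R : realType) (X Y : finHilbertType R)
  (phi : X -> R) (Phi : X -> Y) (g : Y -> \bar R) (Theta : set X)
  (xbar : X) (ybar : Y) (eps : R -> R)
  (phiC2 : C2_on [set: X] phi) (PhiC2 : C2_on [set: X] Phi)
  (g_proper : eproper g) (g_lsc : lower_semicontinuous g) (g_convex : econvex g)
  (Theta_affine : affine_set Theta)
  (kkt : KKT phi Phi g Theta xbar ybar)
  (sosc : SOSC phi Phi g Theta xbar ybar)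
  (hii :
    (exists (Z : finHilbertType R) (O : set Y) (theta : Z -> \bar R)
        (Xi : Y -> Z),
       C2_decomposition g (Phi xbar) O theta Xi /\
       nondegenerate_at (Phi xbar) theta Xi) \/
    (twice_epi_differentiable g (Phi xbar) ybar /\
     forall w : Y,
       semistrict_graphical_deriv (subdiff g) (Phi xbar) ybar w =
       closure [set a - b |
         a in graphical_deriv (subdiff g) (Phi xbar) ybar w &
         b in polar (crit_cone g (Phi xbar) ybar)]))
  (M_calm : calm pnorm (multipliers phi Phi g Theta xbar) (0, 0) ybar)
  (g_semistable : semistable g (Phi xbar) ybar)
  (eps_ge0 : forall t : R, 0 <= t -> 0 <= eps t)
  (eps_o : eps =o_ (0^'+) id) :
  let M0 := multipliers phi Phi g Theta xbar (0, 0) in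
  exists chat rhobar eps0 : R,
    [/\ 0 < chat, 0 < rhobar, 0 < eps0 &
    forall (x0 : X) (y0 : Y) (rho : nat -> R),
      pnorm ((x0, y0) - (xbar, ybar)) <= eps0 ->
      (* equivalently x0 is in Theta: off Theta the residual is +oo, at which
         eps is undefined *)
      residual phi Phi g Theta x0 y0 \is a fin_num ->
      (forall k, rhobar <= rho k) ->
      (exists (x : nat -> X) (y : nat -> Y),
         [/\ x 0%N = x0, y 0%N = y0 &
             ALM_sequence phi Phi g Theta eps chat rho x y]) /\
      (forall (x : nat -> X) (y : nat -> Y),
         x 0%N = x0 -> y 0%N = y0 ->
         ALM_sequence phi Phi g Theta eps chat rho x y ->
         exists2 yhat : Y, M0 yhat &
           let err (k : nat) := pnorm ((x k, y k) - (xbar, yhat)) in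
           let err_sol (k : nat) :=
             fine (dist_to (@pnorm R X Y) (x k, y k) ([set xbar] `*` M0)) in
           [/\ (x k, y k) @[k --> \oo] --> (xbar, yhat),
               Qlinear err, Qlinear err_sol &
               rho @ \oo --> +oo -> Qsuperlinear err /\ Qsuperlinear err_sol])].
Proof.
move=> M0.
exact: (alm_convergence phiC2 PhiC2 g_proper g_lsc g_convex Theta_affine kkt sosc
  M_calm g_semistable hii eps_ge0 eps_o).
Qed.
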